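(* Let $(A,G,\alpha)$ be a Banach algebra dynamical system over $\mathbb C$, where $A$ is a Banach algebra with bounded involution and where $G$ acts as involutive automorphisms on $A$. Assume that, for each $\varepsilon>0$, $A$ has a $(1+\varepsilon)$-bounded approximate left identity. Let $\mathcal H$ be a class of Hilbert spaces, and let $\mathcal R$ consist of all non-degenerate continuous covariant representations $(\pi,U)$ of $(A,G,\alpha)$ in elements of $\mathcal H$, such that $\pi$ is contractive and involutive, and $U_r$ is unitary, for all $r\in G$. If $\mathcal R$ is non-empty, then the map $(\pi,U)\mapsto(\pi\rtimes U)^{\mathcal R}$ is a bijection between $\mathcal R$ and the non-degenerate involutive representations of the $C^*$-algebra $(A\rtimes_\alpha G)^{\mathcal R}$ in spaces from $\mathcal H$. This map preserves the set of closed invariant subspaces, as well as the Banach space of bounded intertwining operators between two elements of $\mathcal R$.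
   Context: Banach algebras need not be unital. A representation of an algebra $A$ on a normed space $X$ is an algebra homomorphism $\pi:A\to B(X)$; it is non-degenerate if $\mathrm{span}\{\pi(a)x\}$ is dense in $X$. A representation of a group $G$ on $X$ is a group homomorphism $r\mapsto U_r$ into the invertible elements of $B(X)$. An $M$-bounded approximate left identity of $A$ is a net $(u_i)$ with $\|u_i\|\le M$ and $u_ia\to a$ for all $a\in A$. A Banach algebra dynamical system $(A,G,\alpha)$ consists of a Banach algebra $A$, a locally compact Hausdorff group $G$ and a strongly continuous homomorphism $\alpha:G\to\mathrm{Aut}(A)$ into the group of bounded automorphisms of $A$. A covariant representation $(\pi,U)$ on $X$ is a pair of representations with $\pi(\alpha_s(a))=U_s\pi(a)U_s^{-1}$ for all $a,s$. It is continuous if $\pi$ is norm bounded and $U$ is strongly continuous, and non-degenerate if $\pi$ is. Fix a left Haar measure on $G$, with modular function $\Delta$. $C_c(G,A)$ is an algebra under $[f*g](s)=\int_Gf(r)\alpha_r(g(r^{-1}s))\,dr$, with involution $f^*(s)=\Delta(s^{-1})\alpha_s(f(s^{-1})^* )$. For a continuous covariant representation, $\pi\rtimes U(f)=\int_G\pi(f(s))U_s\,ds$ (pointwise, as $x\mapsto\int_G\pi(f(s))U_sx\,ds$), $f\in C_c(G,A)$. For the non-empty class $\mathcal R$ above, $\sigma^{\mathcal R}(f)=\sup_{(\pi,U)\in\mathcal R}\|\pi\rtimes U(f)\|$ is a finite $C^*$-seminorm on $C_c(G,A)$, and the crossed product $(A\rtimes_\alpha G)^{\mathcal R}$ is the completion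 of $C_c(G,A)/\ker\sigma^{\mathcal R}$ in the induced norm, a $C^*$-algebra; $q^{\mathcal R}$ is the canonical map from $C_c(G,A)$ to it. For $(\pi,U)\in\mathcal R$, $(\pi\rtimes U)^{\mathcal R}$ is the representation of $(A\rtimes_\alpha G)^{\mathcal R}$ determined by $(\pi\rtimes U)^{\mathcal R}(q^{\mathcal R}(f))=\pi\rtimes U(f)$. A subspace is invariant for $(\pi,U)$ if it is invariant for both $\pi$ and $U$; a bounded intertwining operator between covariant representations is a bounded operator that intertwines both the algebra and the group representations. *)

(* Defs.v *)
From HB Require Import structures.
From mathcomp Require Import all_boot all_order all_algebra.
From mathcomp Require Import all_classical all_reals all_analysis.
From mathcomp Require Import complex.

Set Implicit Arguments.
Unset Strict Implicit.
Unset Printing Implicit Defensive.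

Import Order.TTheory GRing.Theory Num.Theory.
Import numFieldNormedType.Exports.

Local Open Scope classical_set_scope.
Local Open Scope ring_scope.
Local Open Scope complex_scope.

(* [Pointed] is only there because [measurableType] requires it. *)
HB.mixin Record isTopologicalGroup G of PointedTopological G & Group G := {
  continuous_mulg : continuous (fun p : G * G => (p.1 * p.2)%g) ;
  continuous_invg : continuous (fun s : G => (s^-1)%g)
}.

#[short(type="topGroupType")]
HB.structure Definition TopologicalGroup :=
  {G of PointedTopological G & Group G & isTopologicalGroup G}.

(* MathComp rings are unital, so the multiplication is a new operation. *)
HB.mixin Record isBanachAlgebra (R : realType) A
    of CompleteNormedModule R[i] A := {
  bmul : A -> A -> A ;
  bmulA : associative bmul ;
  bmul_linearl : forall b : A, linear (bmul ^~ b) ;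
  bmul_linearr : forall a : A, linear (bmul a) ;
  bmul_norm : forall a b : A, `|bmul a b| <= `|a| * `|b|
}.

#[short(type="banachAlgType")]
HB.structure Definition BanachAlgebra (R : realType) :=
  {A of CompleteNormedModule R[i] A & isBanachAlgebra R A}.

HB.mixin Record hasBoundedInvolution (R : realType) A of BanachAlgebra R A := {
  bstar : A -> A ;
  bstarD : {morph bstar : a b / a + b} ;
  bstarZ : forall (c : R[i]) (a : A), bstar (c *: a) = Num.conj c *: bstar a ;
  bstarM : forall a b : A, bstar (bmul a b) = bmul (bstar b) (bstar a) ;
  bstarK : involutive bstar ;
  bstar_bounded : exists M : R[i], forall a : A, `|bstar a| <= M * `|a|
}.

#[short(type="banachStarAlgType")]
HB.structure Definition BanachStarAlgebra (R : realType) :=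
  {A of BanachAlgebra R A & hasBoundedInvolution R A}.

HB.mixin Record isCstarAlgebra (R : realType) A of BanachStarAlgebra R A := {
  cstar_norm : forall a : A, `|bmul (bstar a) a| = `|a| ^+ 2
}.

#[short(type="cstarAlgType")]
HB.structure Definition CstarAlgebra (R : realType) :=
  {A of BanachStarAlgebra R A & isCstarAlgebra R A}.

HB.mixin Record isHilbert (R : realType) H
    of CompleteNormedModule R[i] H := {
  inner : {dot H for (@Num.conj R[i])} ;
  inner_norm : forall x : H, `|x| ^+ 2 = inner x x
}.

#[short(type="hilbertType")]
HB.structure Definition Hilbert (R : realType) :=
  {H of CompleteNormedModule R[i] H & isHilbert R H}.

(* [set] cannot be used on classes of Hilbert spaces, for universe reasons;
   this is [set_bij] for predicates on large types. *)
Definition class_bij (S T : Type) (P : S -> Prop) (Q : T -> Prop) (f : S -> T) :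
    Prop :=
  [/\ forall p, P p -> Q (f p),
      forall p p', P p -> P p' -> f p = f p' -> p = p'
    & forall t, Q t -> exists p, P p /\ f p = t].

Section Operators.
Variable R : realType.

(* Norms of R[i]-modules take their values in R[i]. *)
Definition rnorm (X : normedModType R[i]) (x : X) : R := complex.Re `|x|.

Definition bounded_op (X Y : normedModType R[i]) (T : X -> Y) : Prop :=
  linear T /\ exists M : R, forall x, rnorm (T x) <= M * rnorm x.

Definition opnorm (X Y : normedModType R[i]) (T : X -> Y) : R :=
  sup [set rnorm (T x) | x in [set x | rnorm x <= 1]].

Definition invertible_op (X : normedModType R[i]) (T : X -> X) : Prop :=
  bounded_op T /\ exists S : X -> X, [/\ bounded_op S, cancel T S & cancel S T].

Definition lspan (V : lmodType R[i]) (S : set V) : set V :=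
  [set x | exists n (c : 'I_n -> R[i]) (v : 'I_n -> V),
    (forall i, S (v i)) /\ x = \sum_(i < n) c i *: v i].

Definition closed_subspace (X : normedModType R[i]) (M : set X) : Prop :=
  [/\ M 0, forall (c : R[i]) x y, M x -> M y -> M (c *: x + y) & closed M].

Definition unitary_op (H : hilbertType R) (T : H -> H) : Prop :=
  range T = setT /\ forall x y, inner (T x) (T y) = inner x y.

End Operators.

Section Representations.
Variables (R : realType).

Definition algebra_rep (A : banachAlgType R) (X : normedModType R[i])
    (pi : A -> X -> X) : Prop :=
  [/\ forall a, bounded_op (pi a),
      forall (c : R[i]) a b x, pi (c *: a + b) x = c *: pi a x + pi b x
    & forall a b x, pi (bmul a b) x = pi a (pi b x)].

Definition nondegenerate (A : banachAlgType R) (X : normedModType R[i])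
    (pi : A -> X -> X) : Prop :=
  dense (lspan [set y | exists a x, y = pi a x]).

Definition bounded_rep (A : banachAlgType R) (X : normedModType R[i])
    (pi : A -> X -> X) : Prop :=
  exists M : R, forall a, opnorm (pi a) <= M * rnorm a.

Definition contractive_rep (A : banachAlgType R) (X : normedModType R[i])
    (pi : A -> X -> X) : Prop :=
  forall a, opnorm (pi a) <= rnorm a.

Definition involutive_rep (A : banachStarAlgType R) (H : hilbertType R)
    (pi : A -> H -> H) : Prop :=
  forall a x y, inner (pi a x) y = inner x (pi (bstar a) y).

Definition group_rep (G : topGroupType) (X : normedModType R[i])
    (U : G -> X -> X) : Prop :=
  (forall r, invertible_op (U r)) /\
  forall r s x, U (r * s)%g x = U r (U s x).

Definition strongly_continuous (G : topGroupType) (X : normedModType R[i])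
    (U : G -> X -> X) : Prop :=
  forall x, continuous (fun r => U r x).

Definition bounded_automorphism (A : banachAlgType R) (phi : A -> A) : Prop :=
  invertible_op phi /\ {morph phi : a b / bmul a b}.

Definition dynamical_system (A : banachAlgType R) (G : topGroupType)
    (alpha : G -> A -> A) : Prop :=
  [/\ locally_compact [set: G] /\ hausdorff_space G,
      forall s, bounded_automorphism (alpha s),
      forall s t a, alpha (s * t)%g a = alpha s (alpha t a)
    & strongly_continuous alpha].

Definition bounded_left_approx_id (A : banachAlgType R) (M : R) : Prop :=
  exists (I : Type) (le : I -> I -> Prop) (u : I -> A),
    [/\ inhabited I,
        [/\ forall i, le i i, forall i j k, le i j -> le j k -> le i k
          & forall i j, exists k, le i k /\ le j k],
        forall i, rnorm (u i) <= M
      & forall a (eps : R), 0 < eps ->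
          exists i0, forall i, le i0 i -> rnorm (bmul (u i) a - a) < eps].

Definition covariant_rep (A : banachAlgType R) (G : topGroupType)
    (alpha : G -> A -> A) (X : normedModType R[i])
    (pi : A -> X -> X) (U : G -> X -> X) : Prop :=
  [/\ algebra_rep pi, group_rep U
    & forall a s x, pi (alpha s a) x = U s (pi a (U (s^-1)%g x))].

Definition continuous_covariant_rep (A : banachAlgType R) (G : topGroupType)
    (alpha : G -> A -> A) (X : normedModType R[i])
    (pi : A -> X -> X) (U : G -> X -> X) : Prop :=
  [/\ covariant_rep alpha pi U, bounded_rep pi & strongly_continuous U].

End Representations.

Section Integration.
Variable R : realType.

Definition borel (G : topGroupType) := g_sigma_algebraType (@open G).

Definition left_haar_measure (G : topGroupType)
    (mu : {measure set (borel G) -> \bar R}) : Prop :=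
  [/\ forall K : set G, compact K -> (mu K < +oo)%E,
      forall E : set (borel G), measurable E ->
        mu E = ereal_inf [set mu O | O in [set O : set G | open O /\ E `<=` O]],
      forall O : set G, open O ->
        mu O = ereal_sup [set mu K | K in [set K : set G | compact K /\ K `<=` O]],
      forall (s : G) (E : set (borel G)), measurable E ->
        mu [set (s * x)%g | x in (E : set G)] = mu E
    & mu setT <> 0%E].

(* Convention: [mu (E s) = Delta s * mu E], that is,
   [\int f (s r) ds = Delta (r^-1) * \int f s ds] and
   [\int f (s^-1) * Delta (s^-1) ds = \int f s ds]. *)
Definition modular_function (G : topGroupType)
    (mu : {measure set (borel G) -> \bar R}) (Delta : G -> R) : Prop :=
  (forall s, 0 < Delta s) /\
  forall (s : G) (E : set (borel G)), measurable E ->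
    mu [set (x * s)%g | x in (E : set G)] = ((Delta s)%:E * mu E)%E.

Section BochnerIntegral.
Variables (G : topGroupType) (mu : {measure set (borel G) -> \bar R}).
Variable X : completeNormedModType R[i].

Definition bochner_integral (f : G -> X) (v : X) : Prop :=
  forall eps : R, 0 < eps ->
    exists n (E : 'I_n -> set (borel G)) (c : 'I_n -> X),
      let d := fun s : borel G =>
        rnorm (f s - \sum_(i < n | s \in E i) c i) in
      [/\ forall i, measurable (E i) /\ (mu (E i) < +oo)%E,
          measurable_fun setT d,
          (\int[mu]_s (d s)%:E < eps%:E)%E
        & rnorm (v - \sum_(i < n) (fine (mu (E i)))%:C *: c i) < eps].

Definition integral_of (f : G -> X) : X := xget 0 [set v | bochner_integral f v].

End BochnerIntegral.
End Integration.

Section CrossedProduct.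
Variables (R : realType) (A : banachStarAlgType R) (G : topGroupType).
Variable alpha : G -> A -> A.
Variable mu : {measure set (borel G) -> \bar R}.
Variable Delta : G -> R.

Definition Cc : set (G -> A) :=
  [set f | continuous f /\ compact (closure [set s | f s != 0])].

Definition convolution (f g : G -> A) : G -> A := fun s =>
  integral_of mu (fun r => bmul (f r) (alpha r (g (r^-1 * s)%g))).

Definition Cc_star (f : G -> A) : G -> A := fun s =>
  (Delta (s^-1)%g)%:C *: alpha s (bstar (f (s^-1)%g)).

Definition integrated_form (H : completeNormedModType R[i])
    (pi : A -> H -> H) (U : G -> H -> H) (f : G -> A) : H -> H := fun x =>
  integral_of mu (fun s => pi (f s) (U s x)).

(* A pair [(pi, U)] together with the space on which it acts. *)
Definition covpair :=
  {H : hilbertType R & ((A -> H -> H) * (G -> H -> H))%type}.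

Definition covariant_class (HH : hilbertType R -> Prop) (p : covpair) : Prop :=
  let: existT H (pi, U) := p in
  [/\ HH H, continuous_covariant_rep alpha pi U, nondegenerate pi,
      contractive_rep pi /\ involutive_rep pi
    & forall r, unitary_op (U r)].

Definition crossed_seminorm (RR : covpair -> Prop) (f : G -> A) : R :=
  sup [set y : R | exists p : covpair, RR p /\
    y = opnorm (integrated_form (projT2 p).1 (projT2 p).2 f)].

(* [(B, q)] is the completion of [Cc / ker sigma], with [q] the canonical map;
   values of [q] outside [Cc] are irrelevant. *)
Definition is_crossed_product (RR : covpair -> Prop) (B : cstarAlgType R)
    (q : (G -> A) -> B) : Prop :=
  [/\ forall (c : R[i]) f g, Cc f -> Cc g ->
        q (fun s => c *: f s + g s) = c *: q f + q g,
      forall f g, Cc f -> Cc g -> q (convolution f g) = bmul (q f) (q g),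
      forall f, Cc f -> q (Cc_star f) = bstar (q f),
      forall f, Cc f -> rnorm (q f) = crossed_seminorm RR f
    & dense (q @` Cc)].

Definition cp_reps (B : cstarAlgType R) :=
  {H : hilbertType R & B -> H -> H}.

Definition involutive_rep_class (HH : hilbertType R -> Prop)
    (B : cstarAlgType R) (p : cp_reps B) : Prop :=
  let: existT H T := p in
  [/\ HH H, algebra_rep T, nondegenerate T & involutive_rep T].

(* The representation of [B] determined by [T (q f) = integrated_form pi U f]. *)
Definition crossed_rep (B : cstarAlgType R) (q : (G -> A) -> B)
    (H : hilbertType R) (pi : A -> H -> H) (U : G -> H -> H) : B -> H -> H :=
  xget (fun _ _ => 0) [set T : B -> H -> H |
    [/\ algebra_rep T, bounded_rep T
      & forall f, Cc f -> T (q f) = integrated_form pi U f]].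

Definition crossed_rep_map (B : cstarAlgType R) (q : (G -> A) -> B)
    (p : covpair) : cp_reps B :=
  existT (fun H : hilbertType R => B -> H -> H) (projT1 p)
    (crossed_rep q (projT2 p).1 (projT2 p).2).

Definition invariant_subspaces_cov (p : covpair) : set (set (projT1 p)) :=
  [set M | [/\ closed_subspace M,
    forall a x, M x -> M ((projT2 p).1 a x)
  & forall r x, M x -> M ((projT2 p).2 r x)]].

Definition invariant_subspaces_rep (B : cstarAlgType R) (p : cp_reps B) :
    set (set (projT1 p)) :=
  [set M | closed_subspace M /\ forall b x, M x -> M (projT2 p b x)].

Definition intertwiners_cov (p p' : covpair) :
    set (projT1 p -> projT1 p') :=
  [set F | [/\ bounded_op F,
    forall a x, F ((projT2 p).1 a x) = (projT2 p').1 a (F x)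
  & forall r x, F ((projT2 p).2 r x) = (projT2 p').2 r (F x)]].

Definition intertwiners_rep (B : cstarAlgType R) (p p' : cp_reps B) :
    set (projT1 p -> projT1 p') :=
  [set F | bounded_op F /\
    forall b x, F (projT2 p b x) = projT2 p' b (F x)].

End CrossedProduct.

Arguments involutive_rep_class {R} HH B p.
Arguments invariant_subspaces_cov {R A G} p.
Arguments invariant_subspaces_rep {R B} p.
Arguments intertwiners_cov {R A G} p p'.
Arguments intertwiners_rep {R B} p p'.

(* Main.v *)
Require Import Defs.
From HB Require Import structures.
From mathcomp Require Import all_boot all_order all_algebra.
From mathcomp Require Import finmap.
From mathcomp Require Import all_classical all_reals all_analysis.
From mathcomp Require Import complex measurable_realfun ring lra.

Set Implicit Arguments.
Unset Strict Implicit.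
Unset Printing Implicit Defensive.

Import Order.TTheory GRing.Theory Num.Theory.
Import numFieldNormedType.Exports.

Local Open Scope classical_set_scope.
Local Open Scope ring_scope.

(** The theorem is the dictionary between covariant pairs and representations
of the crossed product [B]. Passing from [(pi, U)] to a representation of [B]
is soft: [f |-> integrated_form mu pi U f] is an involutive homomorphism on
[Cc], it is dominated by the seminorm by the very definition of the latter,
and so it descends to the image of [q] and extends to [B] by density
([integrated_rep_ex]). The pair can be read off from the representation [T]
it gives, since [pi a (T (q f) x) = T (q (a f)) x] and
[U r (T (q f) x) = T (q (r . f)) x], where [a f] is the pointwise product
[lmul a f] and [r . f] is the function [translate alpha r f], and since the
vectors [T (q f) x] are dense. This gives injectivity, and also that closed
invariant subspaces and bounded intertwiners are the same on both sides.

For surjectivity one starts from a non-degenerate involutive representation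
[T] of [B] and uses these formulas to define [pi] and [U]. The vectors
[\sum_i T (q (f i)) (y i)] are dense, so all that is needed is the bound
[| \sum_i T (q (a f_i)) y_i | <= |a| | \sum_i T (q f_i) y_i |] and its
analogue for [U], which also shows that the definition is sound
([multiplier_ex]). For this one finds, for every [eps], a function [h] in
[Cc] with [|q h| <= 1 + eps] such that [h * f_i] is close to [f_i] for the
finitely many [f_i] at hand ([q_left_approx]): [h] is a member of a bounded
approximate left identity of [A] times a scalar bump of integral one
concentrated near the unit of [G]. As [(a h) * f = a (h * f)], the vector
[\sum_i T (q (a f_i)) y_i] is close to
[T (q (a h)) (\sum_i T (q f_i) y_i)], an operator of norm at most
[|a| (1 + eps)], as [|pi a| <= |a|] in every given covariant pair and as [T]
is contractive ([cstar_rep_contractive]). That the bounds of the approximate identities can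
be taken arbitrarily close to one is what makes [pi] contractive and every
[U r] an isometry.

All identities between operators on the new space are then checked in [B],
where they hold because they hold in the given representations, which
separate the points of [B]. The last one, that [T] is the integrated form of
[(pi, U)], rests on
[\int q (f s . (s . g)) ds = q f * q g], a norm-convergent integral in [B]
([conv_family_integral]), which [T] may be applied to.

The integrals involve only continuous functions with compact support. They
are limits of Riemann sums over fine Borel partitions of the support
([integral_riemann]); linearity, commutation with bounded operators, Fubini's
theorem ([fubini]) and the change of variables formulas of Haar measure
([integral_homeo], [integral_mod_inv]) all follow from that approximation. *)

Local Open Scope complex_scope.

(** * Real-valued norms *)

Section RealNorm.
Variables (R : realType) (X : normedModType R[i]).
Implicit Types x y z : X.

Lemma rnormE x : `|x| = (rnorm x)%:C.
Proof. by rewrite /rnorm RRe_real// normr_real. Qed.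

Lemma rnorm_ge0 x : 0 <= rnorm x.
Proof. by rewrite -ler0c -rnormE. Qed.

Lemma rnorm0 : rnorm (0 : X) = 0.
Proof. by rewrite /rnorm normr0. Qed.

Lemma rnormN x : rnorm (- x) = rnorm x.
Proof. by rewrite /rnorm normrN. Qed.

Lemma rnorm_distC x y : rnorm (x - y) = rnorm (y - x).
Proof. by rewrite -rnormN opprB. Qed.

Lemma rnormD x y : rnorm (x + y) <= rnorm x + rnorm y.
Proof. by rewrite -lecR rmorphD /= -!rnormE ler_normD. Qed.

Lemma rnorm_triangle y x z : rnorm (x - z) <= rnorm (x - y) + rnorm (y - z).
Proof. by apply: le_trans (rnormD _ _); rewrite addrA subrK. Qed.

Lemma rnormZ (c : R[i]) x : rnorm (c *: x) = complex.Re `|c| * rnorm x.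
Proof.
apply: complexI; rewrite rmorphM /= -rnormE normrZ (rnormE x).
by rewrite RRe_real ?normr_real.
Qed.

Lemma rnormZr (r : R) x : rnorm (r%:C *: x) = `|r| * rnorm x.
Proof.
by rewrite rnormZ normc_def /= expr0n /= addr0 sqrtr_sqr.
Qed.

Lemma rnorm_sum (I : Type) (s : seq I) (P : pred I) (F : I -> X) :
  rnorm (\sum_(i <- s | P i) F i) <= \sum_(i <- s | P i) rnorm (F i).
Proof.
elim/big_ind2 : _ => [|a b c d ab cd|//]; first by rewrite rnorm0.
by apply: le_trans (rnormD _ _) _; apply: lerD.
Qed.

Lemma rnorm_eq0 x : rnorm x = 0 -> x = 0.
Proof. by move=> x0; apply/eqP; rewrite -normr_eq0 rnormE x0. Qed.

Lemma rnorm_le_eq x y : (forall e : R, 0 < e -> rnorm (x - y) <= e) -> x = y.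
Proof.
move=> xy; apply/eqP; rewrite -subr_eq0; apply/eqP/rnorm_eq0/eqP.
rewrite eq_le rnorm_ge0 andbT; apply/ler_addgt0Pl => e e0.
by rewrite addr0 xy.
Qed.

Lemma ler_rnorm_dist x y : `|rnorm x - rnorm y| <= rnorm (x - y).
Proof.
rewrite ler_norml; apply/andP; split.
  by rewrite lerNl opprB lerBlDr (rnorm_distC x) -{1}(subrK x y) rnormD.
by rewrite lerBlDr -{1}(subrK y x) rnormD.
Qed.

Lemma nbhs_rnormP x (A : set X) :
  nbhs x A <-> exists2 e : R, 0 < e & forall y, rnorm (y - x) < e -> A y.
Proof.
split=> [/nbhs_normP[e /= e0 xeA]|[e e0 xeA]].
  move: e0; rewrite ltcE /= => /andP[/eqP Ime Ree0].
  exists (complex.Re e) => // y xy; apply: xeA => /=.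
  by rewrite rnormE ltcE /= Ime eqxx /= rnorm_distC.
apply/nbhs_normP; exists e%:C => /=; first by rewrite ltcR.
by move=> y /=; rewrite rnormE ltcR rnorm_distC; exact: xeA.
Qed.

Lemma cts_rnormP (T : topologicalType) (f : T -> X) (t : T) :
  {for t, continuous f} <->
  forall e : R, 0 < e -> \forall s \near t, rnorm (f s - f t) < e.
Proof.
split=> [ft e e0|ft].
  by apply: (ft [set y | rnorm (y - f t) < e]); apply/nbhs_rnormP; exists e.
by move=> A /nbhs_rnormP[e e0 eA]; apply: filterS (ft _ e0) => s; exact: eA.
Qed.

Lemma continuous_rnorm_sub (T : topologicalType) (f : T -> X) (c : X) :
  continuous f -> continuous (fun s => rnorm (f s - c)).
Proof.
move=> cf s; apply/cvgrPdist_lt => e e0.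
have /cts_rnormP/(_ e e0) := cf s; apply: filterS => t.
rewrite rnorm_distC; apply: le_lt_trans; apply: le_trans (ler_rnorm_dist _ _) _.
by rewrite opprB addrA subrK.
Qed.

Lemma closed_rnorm (A : set X) x : closed A ->
  (forall e : R, 0 < e -> exists2 a, A a & rnorm (a - x) < e) -> A x.
Proof.
move=> cA Ax; apply: cA => B /nbhs_rnormP[e /Ax[a Aa ax] eB].
by exists a; split=> //; exact: eB.
Qed.

Lemma dense_rnormP (S : set X) :
  dense S <->
  forall x (e : R), 0 < e -> exists2 y, S y & rnorm (y - x) < e.
Proof.
split=> [dS x e e0|dS O [x Ox] oO].
  have [||y [/= + Sy]] := dS [set y | rnorm (y - x) < e]°.
  - exists x; rewrite /interior /=; apply/nbhs_rnormP; exists e => //.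
  - exact: open_interior.
  - by move=> /interior_subset /= ?; exists y.
have /nbhs_rnormP[e e0 eO] : nbhs x O by apply: open_nbhs_nbhs.
by have [y Sy xy] := dS x e e0; exists y; split => //; exact: eO.
Qed.

End RealNorm.

Lemma rnorm_cvg_seq (R : realType) (X : completeNormedModType R[i])
    (u : nat -> X) :
  (forall e : R, 0 < e -> exists N, forall n m, (N <= n)%N -> (N <= m)%N ->
    rnorm (u n - u m) < e) ->
  exists l, forall e : R, 0 < e -> exists N, forall n, (N <= n)%N ->
    rnorm (u n - l) < e.
Proof.
move=> uC.
have /cauchy_cvgP ul : cauchy (u @ \oo).
  apply: cauchy_exP => e; rewrite ltcE /= => /andP[/eqP Ime /uC[N uN]].
  exists (u N), N => //= n /= Nn; rewrite -ball_normE /= rnormE ltcE /= Ime.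
  by rewrite eqxx /= uN.
exists (lim (u @ \oo)) => e e0.
have [N _ uN] : \forall n \near \oo, rnorm (u n - lim (u @ \oo)) < e.
  by apply: (ul [set y | rnorm (y - _) < e]); apply/nbhs_rnormP; exists e.
by exists N => n /uN.
Qed.

(** The form in which most equalities below are proved: both sides are within
a constant times [e] of a common approximation. *)
Lemma rnorm_le_eqM (R : realType) (X : normedModType R[i]) (x y : X) (C : R) :
  (forall e : R, 0 < e -> rnorm (x - y) <= C * e) -> x = y.
Proof.
move=> xy; apply: rnorm_le_eq => e e0.
have C0 : 0 < `|C| + 1 by rewrite ltr_pwDr.
apply: le_trans (xy (e / (`|C| + 1)) _) _; first exact: divr_gt0.
rewrite mulrCA -[leRHS]mulr1 ler_pM2l// ler_pdivrMr// mul1r.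
by apply: le_trans (ler_norm _) _; rewrite lerDl.
Qed.

Lemma ler_addgt0M (R : realType) (a b C : R) : (forall e, 0 < e -> a <= b + C * e) -> a <= b.
Proof.
move=> abC; apply/ler_addgt0Pl => e e0.
have C0 : 0 < `|C| + 1 by rewrite ltr_pwDr.
apply: le_trans (abC _ (divr_gt0 e0 C0)) _; rewrite addrC lerD2r.
rewrite mulrCA -[leRHS]mulr1 ler_pM2l// ler_pdivrMr// mul1r.
by apply: le_trans (ler_norm _) _; rewrite lerDl.
Qed.

(** * Borel sets and step functions *)

Section Borel.
Variables (R : realType) (G : topGroupType).

Lemma open_borel (O : set G) : open O -> measurable (O : set (borel G)).
Proof. by move=> oO; exact: sub_sigma_algebra. Qed.

Lemma closed_borel (F : set G) : closed F -> measurable (F : set (borel G)).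
Proof.
move=> cF; rewrite -(setCK F); apply: measurableC.
exact: (open_borel (closed_openC cF)).
Qed.

Lemma continuous_borel (f : G -> R) (D : set (borel G)) :
  continuous f -> measurable D -> measurable_fun D (f : borel G -> R).
Proof.
move=> cf mD; apply: (measurability _ (RGenOInfty.measurableE R)).
move=> _ [_ [x ->] <-] /=; apply: measurableI => //.
apply: open_borel; apply: open_comp => //.
Qed.

Lemma preimage_borel (h : G -> G) (E : set (borel G)) :
  continuous h -> measurable E -> measurable (h @^-1` E : set (borel G)).
Proof.
move=> ch mE; rewrite -(setTI (h @^-1` E)).
suff mh : measurable_fun setT (h : borel G -> borel G) by exact: mh.
apply: (@measurability _ _ (borel G) (borel G) setT h (@open G)) => // _ [U oU <-].
rewrite setTI; apply: open_borel; apply: open_comp => //.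
Qed.

End Borel.

Section SimpleFunctions.
Variables (R : realType) (G : topGroupType).
Variables (mu : {measure set (borel G) -> \bar R}) (X : normedModType R[i]).
Implicit Types (l : seq (set (borel G) * X)).

(** Repeated or overlapping sets are allowed, so concatenation of lists is
addition of step functions. *)
Definition step l (s : G) : X := \sum_(p <- l | s \in p.1) p.2.

Definition step_integral l : X := \sum_(p <- l) (fine (mu p.1))%:C *: p.2.

(** The measurability demanded by [bochner_integral] is that of a real
function; it is obtained without any measurable structure on [X] by cutting
the domain along the sets of the step function, on each of which the integrand
is continuous. *)
Lemma measurable_step (f : G -> X) l (D : set (borel G)) (c : X) :
  continuous f -> (forall p, p \in l -> measurable p.1) -> measurable D ->
  measurable_fun D (fun s : borel G => rnorm (f s - (c + step l s))).
Proof.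
move=> cf; elim: l D c => [|[E a] l IH] D c ml mD.
  under eq_fun do rewrite /step big_nil addr0.
  apply: continuous_borel => //; exact: continuous_rnorm_sub.
have mE : measurable E by apply: (ml (E, a)); rewrite inE eqxx.
have {}IH := IH _ _ (fun p pl => ml p (mem_behead (s := _ :: _) pl)).
rewrite (_ : D = D `&` E `|` D `\` E); last by rewrite setDE -setIUr setUCr setIT.
apply/measurable_funU; [exact: measurableI|exact: measurableD|split].
  apply: eq_measurable_fun (IH (D `&` E) (c + a) (measurableI _ _ mD mE)).
  by move=> s /[!inE] -[_ Es]; rewrite /step big_cons /= mem_set// addrA.
apply: eq_measurable_fun (IH (D `\` E) c (measurableD mD mE)).
by move=> s /[!inE] -[_ Es]; rewrite /step big_cons /= memNset.
Qed.

(** The triangle inequality for integrals of step functions whose sets may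
overlap: the induction cuts [D] along the first set and absorbs the first
value into the constant [c] on the inner piece. *)
Lemma step_integral_le_within l (D : set (borel G)) (c : X) :
  (forall p, p \in l -> measurable p.1) -> measurable D -> (mu D < +oo)%E ->
  ((rnorm ((fine (mu D))%:C *: c +
      \sum_(p <- l) (fine (mu (p.1 `&` D)))%:C *: p.2))%:E <=
    \int[mu]_(s in D) (rnorm (c + step l s))%:E)%E.
Proof.
have mst l' (D' : set (borel G)) c' : (forall p, p \in l' -> measurable p.1) -> measurable D' ->
    measurable_fun D' (fun s : borel G => (rnorm (c' + step l' s))%:E).
  move=> ml' mD'; apply/measurable_EFinP.
  apply: eq_measurable_fun
    (@measurable_step (fun=> 0) l' D' c' (fun=> cvg_cst _) ml' mD').
  by move=> s _; rewrite sub0r rnormN.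
elim: l D c => [|[E a] l IH] D c ml mD fD.
  rewrite big_nil addr0 rnormZr ger0_norm ?fine_ge0//.
  under eq_integral do rewrite /step big_nil addr0.
  rewrite integral_cst// muleC EFinM fineK// ge0_fin_numE//.
have mE : measurable E by apply: (ml (E, a)); rewrite inE eqxx.
have ml' p : p \in l -> measurable p.1.
  by move=> pl; apply: ml; rewrite inE pl orbT.
have DE : D = D `&` E `|` D `\` E by rewrite setDE -setIUr setUCr setIT.
have mDE := measurableI _ _ mD mE; have mDnE := measurableD mD mE.
have fin B : measurable B -> B `<=` D -> (mu B < +oo)%E.
  by move=> mB BD; apply: le_lt_trans fD; apply: le_measure; rewrite ?inE.
have fineD B : measurable B -> B `<=` D ->
    fine (mu B) = fine (mu (B `&` E)) + fine (mu (B `\` E)).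
  move=> mB BD; rewrite -fineD.
  - rewrite -measureU ?setDE -?setIUr ?setUCr ?setIT//.
    + exact: measurableI.
    + by apply: measurableD.
    + by rewrite setIACA setICr setI0.
  - rewrite ge0_fin_numE//; apply: fin; first exact: measurableI.
    by move=> s [/BD].
  - rewrite ge0_fin_numE//; apply: fin; first exact: measurableD.
    by move=> s [/BD].
have -> : (\int[mu]_(s in D) (rnorm (c + step ((E, a) :: l) s))%:E =
    \int[mu]_(s in D `&` E) (rnorm (c + a + step l s))%:E +
    \int[mu]_(s in D `\` E) (rnorm (c + step l s))%:E)%E.
  rewrite {1}DE ge0_integral_setU//=; first last.
  - by apply/disj_setPRL => s [_ Es] [].
  - by move=> s _; rewrite lee_fin rnorm_ge0.
  - by rewrite -DE; exact: mst.
  congr (_ + _)%E; apply: eq_integral => s /[!inE] -[_ Es].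
    by rewrite /step big_cons /= mem_set// addrA.
  by rewrite /step big_cons /= memNset.
apply: le_trans; last first.
  apply: leeD; apply: IH => //; apply: fin => // s [] //.
rewrite -EFinD lee_fin; apply: le_trans (rnormD _ _).
rewrite le_eqVlt; apply/orP; left; apply/eqP; congr rnorm.
rewrite big_cons /= setIC.
rewrite (fineD D)// rmorphD /= scalerDl scalerDr.
rewrite (_ : \sum_(p <- l) (fine (mu (p.1 `&` D)))%:C *: p.2 =
   \sum_(p <- l) (fine (mu (p.1 `&` (D `&` E))))%:C *: p.2 +
   \sum_(p <- l) (fine (mu (p.1 `&` (D `\` E))))%:C *: p.2); last first.
  rewrite -big_split /=; apply: eq_big_seq => p pl.
  rewrite (fineD (p.1 `&` D)) ?setIDA ?setIA ?rmorphD /= ?scalerDl//.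
  by apply: measurableI => //; exact: ml'.
by rewrite addrACA [X in _ + X]addrCA addrA.
Qed.

Lemma step_integral_le l :
  (forall p, p \in l -> measurable p.1 /\ (mu p.1 < +oo)%E) ->
  ((rnorm (step_integral l))%:E <= \int[mu]_s (rnorm (step l s))%:E)%E.
Proof.
move=> ml; pose D := \big[setU/set0]_(p <- l) p.1.
have mD : measurable D.
  by rewrite /D big_seq; apply: bigsetU_measurable => p /ml[].
have fD : (mu D < +oo)%E.
  apply: le_lt_trans (_ : \sum_(p <- l) mu p.1 < +oo)%E.
    rewrite /D; elim: l ml {D mD} => [|p l IH] ml.
      by rewrite !big_nil measure0.
    rewrite !big_cons; have [mp _] := ml p (mem_head _ _).
    have ml' q : q \in l -> measurable q.1 /\ (mu q.1 < +oo)%E.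
      by move=> ql; apply: ml; rewrite inE ql orbT.
    apply: le_trans (leeD2l _ (IH ml')); apply: measureU2 => //.
    by rewrite big_seq; apply: bigsetU_measurable => q /ml'[].
  by rewrite big_seq; apply: lte_sum_pinfty => p /ml[].
have ml1 p : p \in l -> measurable p.1 by move=> /ml[].
have := step_integral_le_within 0 ml1 mD fD; rewrite scaler0 add0r.
under eq_integral do rewrite add0r.
move=> H; apply: le_trans (le_trans H _).
  rewrite lee_fin le_eqVlt; apply/orP; left; apply/eqP; congr rnorm.
  apply: eq_big_seq => p pl; rewrite (_ : p.1 `&` D = p.1)//.
  apply/setIidl => s ps; rewrite /D -bigcup_seq /=; exists p => //=.
apply: ge0_subset_integral => //.
- apply/measurable_EFinP.
  apply: eq_measurable_fun
    (@measurable_step (fun=> 0) l setT 0 (fun=> cvg_cst _) ml1 measurableT).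
  by move=> s _; rewrite sub0r rnormN add0r.
- by move=> s _; rewrite lee_fin rnorm_ge0.
Qed.

End SimpleFunctions.

(** * Existence and approximation of Bochner integrals *)

Section FinePartitions.
Variable G : topGroupType.
Implicit Types (K D : set G) (V : G -> set G) (P : seq (set (borel G) * G)).

(** A partition of [K] into tagged Borel sets. Lists replace indexed families,
and disjointness and covering are expressed together by saying that exactly
one entry contains a given point. *)
Definition fine_partition K V P : Prop :=
  (forall p, p \in P -> [/\ measurable p.1, p.1 `<=` K `&` V p.2 & K p.2]) /\
  forall s, K s -> exists2 p, p \in P & [seq p <- P | s \in p.1] = [:: p].

(** Neighbourhoods are removed one after the other, each piece being what is
left of the interior of the current one. *)
Lemma fine_partition_seq K V (ts : seq G) (D : set (borel G)) :
  measurable D -> D `<=` K -> (forall t, t \in ts -> K t) ->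
  exists P, (forall p, p \in P ->
      [/\ measurable p.1, p.1 `<=` D `&` V p.2 & K p.2]) /\
    forall s, D s -> (exists2 t, t \in ts & (V t)° s) ->
      exists2 p, p \in P & [seq p <- P | s \in p.1] = [:: p].
Proof.
elim: ts D => [|t ts IH] D mD DK tsK.
  by exists [::]; split=> // s _ [].
have mW : measurable ((V t)° : set (borel G)) by apply: open_borel; exact: open_interior.
have [||P [PD Ps]] := IH (D `\` (V t)°) (measurableD mD mW).
- by move=> s [/DK].
- by move=> u uts; apply: tsK; rewrite inE uts orbT.
exists ((D `&` (V t)°, t) :: P); split.
  move=> p; rewrite inE => /orP[/eqP->/=|pP].
    split; [exact: measurableI| |by apply: tsK; rewrite inE eqxx].
    by move=> s [Ds /interior_subset].
  by have [mp pD Kp] := PD p pP; split=> // s /pD[[Ds _]].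
move=> s Ds [u uts us] /=; have [Ws|Ws] := pselect ((V t)° s).
  rewrite mem_set//; exists (D `&` (V t)°, t); first exact: mem_head.
  congr (_ :: _); apply/eqP; rewrite -[_ == _]negbK -has_filter; apply/hasPn.
  by move=> p /PD[_ pD _]; apply/negP => /set_mem /pD[[_]].
rewrite memNset; last by case.
have [||p pP ->] := Ps s.
- by split.
- exists u => //; move: uts; rewrite inE => /orP[/eqP ut|//].
  by move: Ws; rewrite -ut.
- by exists p; rewrite // inE pP orbT.
Qed.

Lemma fine_partition_ex K V : hausdorff_space G -> compact K ->
  (forall s, K s -> nbhs s (V s)) -> exists P, fine_partition K V P.
Proof.
move=> hG cK KV; have mK : measurable (K : set (borel G)).
  by apply: closed_borel; exact: compact_closed.
have : cover_compact K by rewrite -compact_cover.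
move=> /(_ G K (fun s => (V s)°)) [|s Ks|D DK KD].
- by move=> s _; exact: open_interior.
- by exists s => //; exact: KV.
have [||P [PK Ps]] := @fine_partition_seq K V (enum_fset D) K mK.
- by [].
- by move=> t /DK /set_mem.
exists P; split=> // s Ks; apply: Ps => //.
by have [t tD Vs] := KD s Ks; exists t.
Qed.

End FinePartitions.

Section BochnerApproximation.
Variables (R : realType) (G : topGroupType).
Variables (mu : {measure set (borel G) -> \bar R}).
Hypothesis hG : hausdorff_space G.
Hypothesis muK : forall K : set G, compact K -> (mu K < +oo)%E.

Definition mass (K : set G) : R := fine (mu K).

Lemma mass_ge0 K : 0 <= mass K.
Proof. exact: fine_ge0. Qed.

Lemma massE K : compact K -> (mass K)%:E = mu K.
Proof. by move=> cK; rewrite /mass fineK// ge0_fin_numE// muK. Qed.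

Lemma compact_borel (K : set G) : compact K -> measurable (K : set (borel G)).
Proof. by move=> cK; apply: closed_borel; exact: compact_closed. Qed.

Lemma mass_le (K : set G) (E : set (borel G)) :
  compact K -> measurable E -> E `<=` K -> (mu E < +oo)%E.
Proof.
move=> cK mE EK; apply: le_lt_trans (muK cK).
by apply: le_measure => //; apply/mem_set => //; exact: (compact_borel cK).
Qed.

Section Values.
Variable X : normedModType R[i].
Implicit Types (f : G -> X) (l : seq (set (borel G) * X)) (e : R).

Definition step_approx (K : set G) f l e : Prop :=
  (forall p, p \in l -> measurable p.1 /\ p.1 `<=` K) /\
  forall s, K s -> rnorm (f s - step l s) <= e.

Definition riemann_sum (P : seq (set (borel G) * G)) f : X :=
  \sum_(p <- P) (fine (mu p.1))%:C *: f p.2.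

Lemma step_cat l l' s : step (l ++ l') s = step l s + step l' s.
Proof. by rewrite /step big_cat. Qed.

Lemma step_integral_cat l l' :
  step_integral mu (l ++ l') = step_integral mu l + step_integral mu l'.
Proof. by rewrite /step_integral big_cat. Qed.

Definition opp_step l := [seq (p.1, - p.2) | p <- l].

Lemma step_opp l s : step (opp_step l) s = - step l s.
Proof. by rewrite /step big_map sumrN. Qed.

Lemma step_integral_opp l :
  step_integral mu (opp_step l) = - step_integral mu l.
Proof.
by rewrite /step_integral big_map -sumrN; apply: eq_bigr => p _; rewrite scalerN.
Qed.

Lemma step_off (K : set G) l s :
  (forall p, p \in l -> p.1 `<=` K) -> ~ K s -> step l s = 0.
Proof.
move=> lK Ks; rewrite /step big_seq_cond big1// => p /andP[/lK pK].
by move=> /set_mem /pK.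
Qed.

(** Two uniform approximations of a function on [K] are uniformly close to
each other there, and [step_integral_le_within] bounds their integrals. *)
Lemma step_approx_dist (K : set G) f l l' e e' : compact K ->
  step_approx K f l e -> step_approx K f l' e' ->
  rnorm (step_integral mu l - step_integral mu l') <= (e + e') * mass K.
Proof.
move=> cK [lK lf] [lK' lf'].
have mK := compact_borel cK.
pose l2 := l ++ opp_step l'.
have l2K p : p \in l2 -> measurable p.1 /\ p.1 `<=` K.
  rewrite mem_cat => /orP[/lK//|/mapP[r /lK' rK ->]]; exact: rK.
have l2m p : p \in l2 -> measurable p.1 by move=> /l2K[].
have mst : measurable_fun (K : set (borel G)) (fun s : borel G => (rnorm (step l2 s))%:E).
  apply/measurable_EFinP.
  apply: eq_measurable_fun
    (@measurable_step R G X (fun=> 0) l2 K 0 (fun=> cvg_cst _) l2m mK).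
  by move=> s _; rewrite sub0r rnormN add0r.
have := step_integral_le_within 0 l2m mK (muK cK).
rewrite scaler0 add0r; under eq_integral do rewrite add0r.
rewrite (_ : \sum_(p <- l2) _ = step_integral mu l - step_integral mu l'); last first.
  rewrite -step_integral_opp -step_integral_cat; apply: eq_big_seq => p pl.
  by rewrite (setIidl (l2K p pl).2).
move=> H; rewrite -lee_fin; apply: (le_trans H).
rewrite EFinM (massE cK) -integral_cst//; apply: ge0_le_integral => //.
- by move=> s _; rewrite lee_fin rnorm_ge0.
- move=> s Ks; rewrite lee_fin step_cat step_opp.
  apply: le_trans (rnorm_triangle (f s) _ _) _.
  by apply: lerD; [rewrite rnorm_distC lf | exact: lf'].
Qed.

Lemma fine_partition_approx (K : set G) V P f e : fine_partition K V P ->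
  (forall s t, K s -> K t -> V t s -> rnorm (f s - f t) <= e) ->
  step_approx K f [seq (p.1, f p.2) | p <- P] e.
Proof.
move=> [PK Ps] fV; split=> [p /mapP[r /PK[mr rKV Kr] ->]|s Ks].
  by split=> // s /rKV[].
have [p pP pE] := Ps s Ks; have [mp pKV Kp] := PK p pP.
rewrite /step big_map -big_filter pE big_seq1.
have ps : p.1 s.
  have : p \in [seq p <- P | s \in p.1] by rewrite pE mem_head.
  by rewrite mem_filter => /andP[/set_mem].
by apply: fV => //; have [] := pKV _ ps.
Qed.

Lemma step_integral_riemann P f :
  step_integral mu [seq (p.1, f p.2) | p <- P] = riemann_sum P f.
Proof. by rewrite /step_integral big_map. Qed.

Lemma nbhs_oscillation f e s : continuous f -> 0 < e ->
  nbhs s [set t | rnorm (f t - f s) < e].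
Proof. by move=> cf e0; have /cts_rnormP := cf s; exact. Qed.

Lemma step_approx_ex (K : set G) f e : compact K -> continuous f -> 0 < e ->
  exists l, step_approx K f l e.
Proof.
move=> cK cf e0.
have [P KP] := fine_partition_ex hG cK
  (fun s _ => @nbhs_oscillation f e s cf e0).
exists [seq (p.1, f p.2) | p <- P]; apply: fine_partition_approx KP _.
by move=> s t _ _ /ltW.
Qed.

End Values.

Section Complete.
Variable X : completeNormedModType R[i].
Implicit Types (f : G -> X) (l : seq (set (borel G) * X)) (e : R).

(** The definition of the integral asks for one good step function for each
[eps] and so does not fix the value by itself; two candidates are compared
through the integral of the norm of the difference of their step functions. *)
Lemma bochner_unique f v v' :
  bochner_integral mu f v -> bochner_integral mu f v' -> v = v'.
Proof.
move=> fv fv'; apply: (@rnorm_le_eqM _ _ _ _ 4) => e e0.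
have [n [E [c [Em md dlt vE]]]] := fv e e0.
have [n' [E' [c' [Em' md' dlt' vE']]]] := fv' e e0.
pose l := [seq (E i, c i) | i <- enum 'I_n].
pose l' := [seq (E' i, c' i) | i <- enum 'I_n'].
have lI : \sum_(i < n) (fine (mu (E i)))%:C *: c i = step_integral mu l.
  by rewrite /step_integral big_map big_enum.
have lI' : \sum_(i < n') (fine (mu (E' i)))%:C *: c' i = step_integral mu l'.
  by rewrite /step_integral big_map big_enum.
have lS s : \sum_(i < n | s \in E i) c i = step l s.
  by rewrite /step big_map big_enum_cond.
have lS' s : \sum_(i < n' | s \in E' i) c' i = step l' s.
  by rewrite /step big_map big_enum_cond.
rewrite lI in vE; rewrite lI' in vE'.
have ll : rnorm (step_integral mu l - step_integral mu l') <= 2 * e.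
  rewrite -step_integral_opp -step_integral_cat.
  have lm p : p \in l ++ opp_step l' ->
      measurable p.1 /\ (mu p.1 < +oo)%E.
    rewrite mem_cat => /orP[/mapP[i _ ->]|/mapP[r /mapP[i _ ->] ->]].
      exact: Em.
    exact: Em'.
  rewrite -lee_fin; apply: le_trans (step_integral_le lm) _.
  apply: le_trans (_ : \int[mu]_s ((rnorm (f s - step l s))%:E +
                        (rnorm (f s - step l' s))%:E) <= _)%E.
    apply: ge0_le_integral => //.
    - by move=> s _; rewrite lee_fin rnorm_ge0.
    - apply/measurable_EFinP.
      apply: eq_measurable_fun (@measurable_step R G X (fun=> 0)
        (l ++ opp_step l') setT 0 (fun=> cvg_cst _) _ measurableT).
        by move=> s _; rewrite sub0r rnormN add0r.
      by move=> p /lm[].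
    - apply: emeasurable_funD; apply/measurable_EFinP.
        by apply: eq_measurable_fun md => s _; rewrite lS.
      by apply: eq_measurable_fun md' => s _; rewrite lS'.
    - move=> s _; rewrite -EFinD lee_fin step_cat step_opp.
      rewrite (rnorm_distC (f s) (step l s)); exact: rnorm_triangle.
  rewrite ge0_integralD//=.
  - rewrite mulr_natl mulr2n EFinD; apply: leeD; apply: ltW.
      by under eq_integral do rewrite -lS.
    by under eq_integral do rewrite -lS'.
  - by move=> s _; rewrite lee_fin rnorm_ge0.
  - by apply/measurable_EFinP; apply: eq_measurable_fun md => s _; rewrite lS.
  - by move=> s _; rewrite lee_fin rnorm_ge0.
  - by apply/measurable_EFinP; apply: eq_measurable_fun md' => s _; rewrite lS'.
apply: le_trans (rnorm_triangle (step_integral mu l) _ _) _.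
apply: le_trans (lerD (ltW vE) (rnorm_triangle (step_integral mu l') _ _)) _.
rewrite (rnorm_distC _ v'); move: ll vE' => {vE lI lI'}; lra.
Qed.

(** A vector that is the limit of the integrals of uniform step approximations
supported in [K] satisfies the definition of the Bochner integral: off [K]
both functions vanish, so the integral of the distance is at most [e * mass
K]. *)
Lemma step_approx_bochner (K : set G) f v : compact K -> continuous f ->
  (forall s, ~ K s -> f s = 0) ->
  (forall l e, step_approx K f l e ->
    rnorm (step_integral mu l - v) <= e * mass K) ->
  bochner_integral mu f v.
Proof.
move=> cK cf fK fv eps eps0.
pose e := eps / (mass K + 1) / 2.
have m0 : 0 < mass K + 1 by rewrite ltr_wpDl ?mass_ge0.
have e0 : 0 < e by rewrite !divr_gt0.
have eK : e * mass K < eps.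
  rewrite mulrC /e mulrA mulrA ltr_pdivrMr// ltr_pdivrMr// -mulrA.
  by rewrite mulrC ltr_pM2l//; have := mass_ge0 K; lra.
have [l lf] := step_approx_ex cK cf e0.
have lE s : \sum_(i < size l | s \in (tnth (in_tuple l) i).1)
  (tnth (in_tuple l) i).2 = step l s by rewrite /step [RHS]big_tnth.
exists (size l), (fun i => (tnth (in_tuple l) i).1),
  (fun i => (tnth (in_tuple l) i).2) => d.
have dE : d = (fun s : borel G => rnorm (f s - (0 + step l s))).
  by apply/funext => s; rewrite /d lE add0r.
have [lK ls] := lf.
have lm p : p \in l -> measurable p.1 by move=> /lK[].
have md : measurable_fun setT d by rewrite dE; exact: measurable_step.
split => //.
- move=> i; have /lK[mi iK] := mem_tnth i (in_tuple l); split=> //.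
  exact: mass_le iK.
- have mK := compact_borel cK.
  apply: le_lt_trans (_ : \int[mu]_(s in (K : set (borel G))) e%:E < _)%E.
    rewrite (_ : (\int[mu]_s (d s)%:E = \int[mu]_(s in (K : set (borel G))) (d s)%:E)%E).
      apply: ge0_le_integral => //.
      - by move=> s _; rewrite lee_fin rnorm_ge0.
      - by apply/measurable_EFinP; apply: measurable_funS md.
      - by move=> s Ks; rewrite lee_fin dE add0r ls.
    rewrite [RHS]integral_mkcond; apply: eq_integral => s _.
    rewrite patchE; case: ifPn => // /negP nK.
    have Ks : ~ K s by move=> /mem_set.
    by rewrite dE fK// (step_off (K := K))// ?addr0 ?subrr ?rnorm0// => p /lK[].
  by rewrite integral_cst// -(massE cK) -EFinM lte_fin.
- rewrite rnorm_distC; apply: le_lt_trans eK; apply: le_trans (fv _ _ lf).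
  have -> // : step_integral mu l = \sum_(i < size l)
      (fine (mu (tnth (in_tuple l) i).1))%:C *: (tnth (in_tuple l) i).2.
  by rewrite /step_integral [LHS]big_tnth.
Qed.

Lemma step_integral_cvg (K : set G) f : compact K -> continuous f ->
  exists v, forall l e, step_approx K f l e ->
    rnorm (step_integral mu l - v) <= e * mass K.
Proof.
move=> cK cf.
have /choice[l lf] : forall n : nat, exists l, step_approx K f l (n.+1%:R^-1).
  by move=> n; apply: step_approx_ex.
have small (e : R) : 0 < e -> exists N, forall n, (N <= n)%N ->
    n.+1%:R^-1 * mass K < e.
  move=> e0; exists (Num.truncn (mass K / e)) => n Nn.
  rewrite mulrC ltr_pdivrMr ?ltr0n// -ltr_pdivrMl// mulrC.
  by apply: lt_le_trans (truncnS_gt _) _; rewrite ler_nat.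
have [v lv] : exists v, forall e, 0 < e -> exists N, forall n, (N <= n)%N ->
    rnorm (step_integral mu (l n) - v) < e.
  apply: rnorm_cvg_seq => e e0; have [N Ne] := small (e / 2) (divr_gt0 e0 (ltr0Sn _ 1)).
  exists N => n m /Ne en /Ne em.
  apply: le_lt_trans (step_approx_dist cK (lf n) (lf m)) _.
  by rewrite mulrDl (splitr e) ltrD.
exists v => l0 e0 l0f; apply/ler_addgt0Pl => e e_gt0.
have [N Ne] := small (e / 2) (divr_gt0 e_gt0 (ltr0Sn _ 1)).
have [M Me] := lv (e / 2) (divr_gt0 e_gt0 (ltr0Sn _ 1)).
have {}Ne := Ne (maxn N M) (leq_maxl _ _).
have {}Me := Me (maxn N M) (leq_maxr _ _).
apply: le_trans (rnorm_triangle (step_integral mu (l (maxn N M))) _ _) _.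
apply: le_trans (lerD (step_approx_dist cK l0f (lf _)) (ltW Me)) _.
rewrite mulrDl -addrA [leRHS]addrC lerD2l [leRHS]splitr; apply: lerD => //; exact: ltW.
Qed.

(** The working description of the integral: an error estimate valid for all
uniform step approximations, from which the value can be computed. *)
Lemma integral_approx (K : set G) f l e : compact K -> continuous f ->
  (forall s, ~ K s -> f s = 0) -> step_approx K f l e ->
  rnorm (step_integral mu l - integral_of mu f) <= e * mass K.
Proof.
move=> cK cf fK; have [v fv] := step_integral_cvg cK cf.
have bv := step_approx_bochner cK cf fK fv.
have -> : integral_of mu f = v.
  apply: (bochner_unique (f := f)) => //=; exact: (xgetPex 0 (ex_intro _ v bv)).
exact: fv.
Qed.

Lemma integral_riemann (K : set G) V P f e : compact K -> continuous f ->
  (forall s, ~ K s -> f s = 0) -> fine_partition K V P ->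
  (forall s t, K s -> K t -> V t s -> rnorm (f s - f t) <= e) ->
  rnorm (riemann_sum P f - integral_of mu f) <= e * mass K.
Proof.
move=> cK cf fK KP fV; rewrite -step_integral_riemann.
by apply: integral_approx => //; exact: fine_partition_approx KP fV.
Qed.

End Complete.

(** One partition that serves three integrands, possibly in different spaces.
It is what makes relations between integrals follow from the same relations
between Riemann sums. *)
Lemma riemann3 (X Y Z : completeNormedModType R[i]) (K : set G)
    (f : G -> X) (g : G -> Y) (h : G -> Z) (e : R) :
  compact K -> 0 < e ->
  [/\ continuous f, continuous g & continuous h] ->
  (forall s, ~ K s -> [/\ f s = 0, g s = 0 & h s = 0]) ->
  exists P : seq (set (borel G) * G), [/\
    forall p, p \in P -> [/\ measurable p.1, p.1 `<=` K & K p.2],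
    rnorm (riemann_sum P f - integral_of mu f) <= e * mass K,
    rnorm (riemann_sum P g - integral_of mu g) <= e * mass K &
    rnorm (riemann_sum P h - integral_of mu h) <= e * mass K].
Proof.
move=> cK e0 [cf cg ch] off.
pose V t := [set s | rnorm (f s - f t) < e] `&`
  ([set s | rnorm (g s - g t) < e] `&` [set s | rnorm (h s - h t) < e]).
have [|P KP] := @fine_partition_ex G K V hG cK.
  by move=> s _; apply: filterI; [|apply: filterI]; exact: nbhs_oscillation.
exists P; split.
- by move=> p /KP.1[mp pKV Kp]; split => // s /pKV[].
- apply: (integral_riemann cK cf _ KP) => [s /off[]//|s t _ _ [/ltW]//].
- apply: (integral_riemann cK cg _ KP) => [s /off[]//|s t _ _ [_ [/ltW]]//].
- apply: (integral_riemann cK ch _ KP) => [s /off[]//|s t _ _ [_ [_ /ltW]]//].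
Qed.

End BochnerApproximation.

(** * Inner products *)

Section Inner.
Variables (R : realType) (H : hilbertType R).
Implicit Types (x y z : H) (c : R[i]).

Lemma innerDl x y z : inner (x + y) z = inner x z + inner y z.
Proof. exact: linearDl. Qed.

Lemma innerZl c x y : inner (c *: x) y = c * inner x y.
Proof. exact: linearZl_LR. Qed.

Lemma innerDr z x y : inner z (x + y) = inner z x + inner z y.
Proof. exact: linearDr. Qed.

Lemma innerZr c x y : inner x (c *: y) = Num.conj c * inner x y.
Proof. exact: linearZr_LR. Qed.

Lemma inner0l x : inner 0 x = 0.
Proof. by rewrite -(scale0r (0 : H)) innerZl mul0r. Qed.

Lemma inner0r x : inner x 0 = 0.
Proof. by rewrite -(scale0r (0 : H)) innerZr rmorph0 mul0r. Qed.

Lemma innerNl x y : inner (- x) y = - inner x y.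
Proof. by rewrite -scaleN1r innerZl mulN1r. Qed.

Lemma innerNr x y : inner x (- y) = - inner x y.
Proof. by rewrite -scaleN1r innerZr rmorphN rmorph1 mulN1r. Qed.

Lemma innerBl x y z : inner (x - y) z = inner x z - inner y z.
Proof. by rewrite innerDl innerNl. Qed.

Lemma innerBr z x y : inner z (x - y) = inner z x - inner z y.
Proof. by rewrite innerDr innerNr. Qed.

Lemma innerC x y : inner x y = Num.conj (inner y x).
Proof. by have := hermC (@inner R H) x y; rewrite expr0 mul1r. Qed.

Lemma conjCr (r : R) : Num.conj (r%:C : R[i]) = r%:C.
Proof. by apply/CrealP; rewrite complex_real. Qed.

Lemma innerZrr (r : R) x y : inner x (r%:C *: y) = r%:C * inner x y.
Proof. by rewrite innerZr conjCr. Qed.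

Lemma inner_rnorm x : inner x x = (rnorm x ^+ 2)%:C.
Proof. by rewrite -inner_norm rnormE rmorphXn. Qed.

Lemma inner_ext x y : (forall z, inner x z = inner y z) -> x = y.
Proof.
move=> xy; apply/eqP; rewrite -subr_eq0; apply/eqP/rnorm_eq0/eqP.
rewrite -sqrf_eq0; apply/eqP/complexI.
by rewrite -inner_rnorm innerBl xy subrr.
Qed.

(** The norm squared of [|y|^2 x - <x, y> y] is nonnegative. *)
Lemma cauchy_schwarz x y : complex.Re `|inner x y| <= rnorm x * rnorm y.
Proof.
have [y0|y0] := eqVneq (rnorm y) 0.
  by rewrite (rnorm_eq0 y0) inner0r normr0 /= mulr_ge0 ?rnorm_ge0.
have y_gt0 : 0 < rnorm y by rewrite lt_neqAle eq_sym y0 rnorm_ge0.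
set c := inner x y; set b := complex.Re `|c|.
have b0 : 0 <= b by rewrite -ler0c RRe_real ?normr_real.
have cb : Num.conj c * c = (b ^+ 2)%:C.
  by rewrite mulrC -normCK rmorphXn /= RRe_real ?normr_real.
pose z := (rnorm y ^+ 2)%:C *: x - c *: y.
have : 0 <= inner z z by rewrite inner_rnorm ler0c sqr_ge0.
have -> : inner z z = (rnorm y ^+ 2 * (rnorm x ^+ 2 * rnorm y ^+ 2 - b ^+ 2))%:C.
  rewrite /z innerBl !innerBr !innerZl !innerZrr !innerZr !inner_rnorm.
  rewrite -/c (innerC y x) -/c.
  rewrite (mulrCA c) [c * (Num.conj c * _)]mulrA (mulrC c (Num.conj c)).
  rewrite [_%:C * (Num.conj c * c)]mulrC !cb -!rmorphM /= -!rmorphB /=.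
  congr (_%:C); ring.
rewrite ler0c pmulr_rge0 ?exprn_gt0// subr_ge0 -exprMn.
by rewrite ler_pXn2r// nnegrE mulr_ge0 ?rnorm_ge0.
Qed.

End Inner.

(** * Integrals of compactly supported continuous functions *)

(** The complex numbers as a Banach space, under a name of its own so that it
can carry a completeness instance. *)
Definition cscalar (R : realType) : Type := R[i]^o.
HB.instance Definition _ (R : realType) :=
  NormedModule.copy (cscalar R) R[i]^o.

Section ComplexComplete.
Variable R : realType.

Lemma cscalar_norm (x : cscalar R) : rnorm x = complex.Re `|x : R[i]|.
Proof. by []. Qed.

Lemma rnorm_cscalar (r : R) : rnorm (r%:C : cscalar R) = `|r|.
Proof. by rewrite cscalar_norm normc_def /= expr0n /= addr0 sqrtr_sqr. Qed.

Lemma cscalar_Re_le (x : cscalar R) : `|complex.Re x| <= rnorm x.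
Proof.
by rewrite -lecR -rnormE; apply: le_trans (normc_ge_Re _) _; rewrite lexx.
Qed.

Lemma cscalar_Im_le (x : cscalar R) : `|complex.Im x| <= rnorm x.
Proof.
rewrite -lecR -rnormE [leRHS]normc_def lecR -sqrtr_sqr ler_wsqrtr//.
by rewrite lerDr sqr_ge0.
Qed.

Lemma rnorm_cscalar_le (x : cscalar R) :
  rnorm x <= `|complex.Re x| + `|complex.Im x|.
Proof.
rewrite -lecR -rnormE [leLHS]normc_def lecR.
rewrite -[leRHS]ger0_norm ?addr_ge0// -sqrtr_sqr ler_wsqrtr//.
rewrite sqrrD !real_normK ?num_real// lerD2r lerDl mulrn_wge0// mulr_ge0//.
Qed.

Lemma cscalar_ReB (x y : cscalar R) :
  complex.Re x - complex.Re y = complex.Re (x - y : R[i]).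
Proof. by case: x; case: y. Qed.

Lemma cscalar_ImB (x y : cscalar R) :
  complex.Im x - complex.Im y = complex.Im (x - y : R[i]).
Proof. by case: x; case: y. Qed.

Lemma complex_cauchy_cvg (F : set_system (cscalar R)) :
  ProperFilter F -> cauchy F -> cvg F.
Proof.
move=> FF cF.
have FC (e : R) : 0 < e -> exists x : cscalar R, F [set y | rnorm (x - y) < e].
  move=> e0; have [|x Fx] := (cauchyP F).1 cF e%:C; first by rewrite ltcR.
  exists x; apply: filterS Fx => y; rewrite -ball_normE /=.
  by rewrite rnormE ltcR.
have part (p : cscalar R -> R^o) :
    (forall x y : cscalar R, `|p x - p y| <= rnorm (x - y)) ->
    exists l : R, forall e : R, 0 < e -> F [set y | `|p y - l| < e].
  move=> plip; have /cauchy_cvgP/cvg_ex[l Fl] : cauchy (p @ F).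
    apply: cauchy_exP => e e0.
    have [x Fx] := FC e e0; exists (p x).
    have xE : [set y | rnorm (x - y) < e] `<=` p @^-1` ball (p x) e.
      move=> y /= xy; rewrite -ball_normE /=.
      exact: le_lt_trans (plip x y) xy.
    exact: filterS xE Fx.
  exists l => e e0; have /cvgrPdist_lt/(_ e e0) := Fl.
  by apply: filterS => y; rewrite distrC.
have [a Fa] := part (@complex.Re R) (fun x y =>
  eq_ind_r (fun z => `|z| <= _) (cscalar_Re_le (x - y)) (cscalar_ReB x y)).
have [b Fb] := part (@complex.Im R) (fun x y =>
  eq_ind_r (fun z => `|z| <= _) (cscalar_Im_le (x - y)) (cscalar_ImB x y)).
apply/cvg_ex; exists ((a +i* b)%C : cscalar R) => A /nbhs_rnormP[e e0 eA].
have e2 : 0 < e / 2 by rewrite divr_gt0.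
apply: (filterS _ (filterI (Fa _ e2) (Fb _ e2))) => y [/= ya yb]; apply: eA.
apply: le_lt_trans (rnorm_cscalar_le _) _.
by rewrite -cscalar_ReB -cscalar_ImB (splitr e) ltrD.
Qed.

HB.instance Definition _ :=
  Uniform_isComplete.Build (cscalar R) complex_cauchy_cvg.

End ComplexComplete.

Lemma continuous_scaler (R : realType) (X : normedModType R[i]) (T : topologicalType)
    (c : T -> R) (f : T -> X) :
  continuous c -> continuous f -> continuous (fun s => (c s)%:C *: f s).
Proof.
move=> cc cf s; apply/cts_rnormP => e e0.
have N0 : 0 < rnorm (f s) + 1 by rewrite ltr_wpDl ?rnorm_ge0.
have M0 : 0 < `|c s| + 1 by rewrite ltr_wpDl.
have e1 : 0 < Num.min 1 (e / 2 / (rnorm (f s) + 1)).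
  by rewrite lt_min ltr01 !divr_gt0.
have e2 : 0 < e / 2 / (`|c s| + 1) by rewrite !divr_gt0.
have /cvgrPdist_lt/(_ _ e1) := cc s; have /cts_rnormP/(_ _ e2) := cf s.
apply: filterS2 => t ft; rewrite lt_min => /andP[ct1 ct2].
rewrite (_ : _ - _ = (c t)%:C *: (f t - f s) + (c t - c s)%:C *: f s); last first.
  by rewrite rmorphB /= scalerBr scalerBl addrA subrK.
apply: le_lt_trans (rnormD _ _) _; rewrite !rnormZr (splitr e).
apply: ltr_leD.
  apply: le_lt_trans (ler_wpM2r (rnorm_ge0 _) (_ : _ <= `|c s| + 1)) _.
    rewrite -lerBlDl; apply: le_trans (ltW ct1); rewrite distrC.
    exact: lerB_dist.
  by rewrite mulrC -ltr_pdivlMr.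
rewrite distrC; apply: le_trans (ler_wpM2l (normr_ge0 _) (_ : _ <= rnorm (f s) + 1)) _.
  by rewrite lerDl.
by rewrite -ler_pdivlMr// ltW.
Qed.

Section IntegralProperties.
Variables (R : realType) (G : topGroupType).
Variables (mu : {measure set (borel G) -> \bar R}).
Hypothesis hG : hausdorff_space G.
Hypothesis muK : forall K : set G, compact K -> (mu K < +oo)%E.
Local Notation mass := (mass mu).
Local Notation integral := (integral_of mu).

(** Functions that vanish off a given compact set. The set need not be the
topological support, which keeps it stable under the operations below. *)
Definition supported (X : normedModType R[i]) (K : set G) (f : G -> X) : Prop :=
  [/\ compact K, continuous f & forall s, ~ K s -> f s = 0].

Lemma riemann2 (X Y : completeNormedModType R[i]) (K : set G)
    (f : G -> X) (g : G -> Y) (e : R) :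
  supported K f -> supported K g -> 0 < e ->
  exists P : seq (set (borel G) * G), [/\
    forall p, p \in P -> [/\ measurable p.1, p.1 `<=` K & K p.2],
    rnorm (riemann_sum mu P f - integral f) <= e * mass K &
    rnorm (riemann_sum mu P g - integral g) <= e * mass K].
Proof.
move=> [cK cf fK] [_ cg gK] e0.
have [|s Ks|P [PK Pf Pg _]] := riemann3 (mu := mu) hG muK cK e0 (f := f) (g := g) (h := g).
- by split.
- by split; [exact: fK|exact: gK|exact: gK].
- by exists P; split.
Qed.

Section OneSpace.
Variable X : completeNormedModType R[i].
Implicit Types (f g : G -> X) (K : set G).

Lemma integral_bound K f (C : R) : supported K f ->
  (forall s, rnorm (f s) <= C) -> rnorm (integral f) <= C * mass K.
Proof.
move=> [cK cf fK] fC.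
have := @integral_approx R G mu hG muK X K f [::] C cK cf fK.
rewrite /step_integral big_nil sub0r rnormN; apply.
by split=> // s _; rewrite /step big_nil subr0.
Qed.

Lemma supported_lin K (c : R[i]) f g : supported K f -> supported K g ->
  supported K (fun s => c *: f s + g s).
Proof.
move=> [cK cf fK] [_ cg gK]; split=> [//| |s Ks]; last first.
  by rewrite fK// gK// scaler0 addr0.
move=> s; apply: cvgD; last exact: cg.
by apply: cvgZr; exact: cf.
Qed.

Lemma integral_lin K (c : R[i]) f g : supported K f -> supported K g ->
  integral (fun s => c *: f s + g s) = c *: integral f + integral g.
Proof.
move=> fK gK; have [cK ch hK] := supported_lin c fK gK.
have [_ cf foff] := fK; have [_ cg goff] := gK.
apply: (@rnorm_le_eqM _ _ _ _ ((1 + complex.Re `|c| + 1) * mass K)) => e e0.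
have [|s Ks|P [_ Pf Pg Ph]] := riemann3 (mu := mu) hG muK cK e0 (f := f)
  (g := g) (h := fun s => c *: f s + g s).
- by split.
- by split; [exact: foff|exact: goff|exact: hK].
have PE : riemann_sum mu P (fun s => c *: f s + g s) =
    c *: riemann_sum mu P f + riemann_sum mu P g.
  rewrite /riemann_sum scaler_sumr -big_split /=; apply: eq_bigr => p _.
  by rewrite scalerDr !scalerA (mulrC c).
apply: le_trans (rnorm_triangle (riemann_sum mu P (fun s => c *: f s + g s)) _ _) _.
rewrite rnorm_distC {2}PE opprD addrACA -scalerBr.
apply: le_trans (lerD Ph (le_trans (rnormD _ _) (lerD _ Pg))) _.
  by rewrite rnormZ; apply: ler_wpM2l Pf; rewrite -ler0c RRe_real ?normr_real.
by rewrite le_eqVlt; apply/orP; left; apply/eqP; ring.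
Qed.

Lemma integral_closed K f (M : set X) : supported K f -> closed M -> M 0 ->
  (forall x y, M x -> M y -> M (x + y)) ->
  (forall (r : R) x, M x -> M (r%:C *: x)) ->
  (forall s, M (f s)) -> M (integral f).
Proof.
move=> fK cM M0 MD MZ Mf; apply: closed_rnorm => // e e0.
have m0 : 0 < mass K + 1 by rewrite ltr_wpDl ?mass_ge0.
have [P [_ Pf _]] := riemann2 fK fK (divr_gt0 e0 m0).
exists (riemann_sum mu P f).
  by rewrite /riemann_sum; elim/big_ind : _ => // p _; exact: MZ.
apply: le_lt_trans Pf _; rewrite mulrAC ltr_pdivrMr// ltr_pM2l// ltrDl//.
Qed.

End OneSpace.

Lemma supported_op (X Y : completeNormedModType R[i]) (L : X -> Y) (M : R) K f :
  {morph L : x y / x + y} -> (forall x, rnorm (L x) <= M * rnorm x) ->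
  supported K f -> supported K (L \o f).
Proof.
move=> LD LM [cK cf fK]; have L0 : L 0 = 0.
  by apply: rnorm_eq0; apply/eqP; rewrite eq_le rnorm_ge0 andbT;
    have := LM 0; rewrite rnorm0 mulr0.
have LB x y : L (x - y) = L x - L y.
  by apply: (addIr (L y)); rewrite subrK -LD subrK.
split=> // [s|s /fK /= ->//]; apply/cts_rnormP => e e0.
have M0 : 0 < `|M| + 1 by rewrite ltr_pwDr.
have /cts_rnormP/(_ _ (divr_gt0 e0 M0)) := cf s; apply: filterS => t /= ft.
rewrite -LB; apply: le_lt_trans (LM _) _.
apply: le_lt_trans (ler_wpM2r (rnorm_ge0 _) (_ : _ <= `|M| + 1)) _.
  by apply: le_trans (ler_norm _) _; rewrite lerDl.
by rewrite mulrC -ltr_pdivlMr.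
Qed.

Lemma integral_op (X Y : completeNormedModType R[i]) (L : X -> Y) (M : R) K f :
  {morph L : x y / x + y} -> (forall (r : R) x, L (r%:C *: x) = r%:C *: L x) ->
  (forall x, rnorm (L x) <= M * rnorm x) ->
  supported K f -> L (integral f) = integral (L \o f).
Proof.
move=> LD LZ LM fK; have LfK := supported_op LD LM fK.
have LB x y : L (x - y) = L x - L y.
  by apply: (addIr (L y)); rewrite subrK -LD subrK.
apply: (@rnorm_le_eqM _ _ _ _ ((`|M| + 1) * mass K)) => e e0.
have [P [_ Pf PLf]] := riemann2 fK LfK e0.
have PE : L (riemann_sum mu P f) = riemann_sum mu P (L \o f).
  rewrite /riemann_sum (big_morph L LD (_ : _ = 0)).
    by apply: eq_bigr => p _; rewrite LZ.
  by have := LB 0 0; rewrite !subrr.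
apply: le_trans (rnorm_triangle (L (riemann_sum mu P f)) _ _) _.
rewrite {2}PE -LB.
have LM1 x : rnorm (L x) <= `|M| * rnorm x.
  by apply: le_trans (LM x) _; rewrite ler_wpM2r ?rnorm_ge0// ler_norm.
rewrite (_ : _ * e = `|M| * (e * mass K) + e * mass K); last by ring.
apply: lerD PLf; apply: le_trans (LM1 _) _.
by apply: ler_wpM2l => //; rewrite rnorm_distC.
Qed.

Lemma integral_scaler (X : completeNormedModType R[i]) K (f : G -> X) (r : R) :
  supported K f -> integral (fun s => r%:C *: f s) = r%:C *: integral f.
Proof.
move=> fK; rewrite -(@integral_op X X (fun x => r%:C *: x) `|r| K f)//.
- by move=> x y; rewrite scalerDr.
- by move=> a x; rewrite !scalerA mulrC.
- by move=> x; rewrite rnormZr.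
Qed.

(** The two integrals, possibly in different spaces, are compared through a
common Riemann sum. *)
Lemma integral_adjoint (H H' : hilbertType R) K (k : G -> H) (h : G -> H')
    (x : H') (y : H) :
  supported K k -> supported K h ->
  (forall s, inner (k s) y = inner x (h s)) ->
  inner (integral k) y = inner x (integral h).
Proof.
move=> kK hK kh.
apply: (@rnorm_le_eqM R (cscalar R) _ _ ((rnorm y + rnorm x) * mass K)) => e e0.
have [P [_ Pk Ph]] := riemann2 kK hK e0.
have PE : inner (riemann_sum mu P k) y = inner x (riemann_sum mu P h).
  rewrite /riemann_sum (big_morph (fun z => inner z y) (fun a b => innerDl a b y) (inner0l y)).
  rewrite (big_morph (inner x) (innerDr x) (inner0r x)).
  by apply: eq_bigr => p _; rewrite innerZl innerZrr kh.
rewrite (_ : _ - _ = (inner (integral k - riemann_sum mu P k) y : cscalar R) +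
    inner x (riemann_sum mu P h - integral h)); last first.
  by rewrite innerBl innerBr PE addrA subrK.
apply: le_trans (rnormD _ _) _; rewrite -mulrA mulrDl; apply: lerD.
  apply: le_trans (cauchy_schwarz _ _) _; rewrite mulrC ler_wpM2l ?rnorm_ge0//.
  by rewrite rnorm_distC mulrC.
apply: le_trans (cauchy_schwarz _ _) _; rewrite ler_wpM2l ?rnorm_ge0//.
by rewrite mulrC.
Qed.

Lemma supported_real K (h : G -> R) :
  compact K -> continuous h -> (forall s, ~ K s -> h s = 0) ->
  supported K (fun s => (h s)%:C : cscalar R).
Proof.
move=> cK ch hK; split=> // [s|s /hK ->//]; apply/cts_rnormP => e e0.
have /cvgrPdist_lt/(_ e e0) := ch s; apply: filterS => t.
by rewrite -rmorphB /= rnorm_cscalar distrC.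
Qed.

(** Integrals of real functions are taken in [cscalar], so that the
vector-valued theory covers them. *)
Definition real_integral (h : G -> R) : R :=
  complex.Re (integral (fun s => (h s)%:C : cscalar R)).

Lemma integral_le (X : completeNormedModType R[i]) K (f : G -> X) (h : G -> R) :
  supported K f -> continuous h -> (forall s, ~ K s -> h s = 0) ->
  (forall s, rnorm (f s) <= h s) -> rnorm (integral f) <= real_integral h.
Proof.
move=> fK ch hK fh; have cK : compact K by case: fK.
have hcK := supported_real cK ch hK.
apply: (@ler_addgt0M _ _ _ (2 * mass K)) => e e0.
have [P [PK Pf Ph]] := riemann2 fK hcK e0.
have Pfh : rnorm (riemann_sum mu P f) <=
    complex.Re (riemann_sum mu P (fun s => (h s)%:C : cscalar R)).
  rewrite /riemann_sum raddf_sum /=; apply: le_trans (rnorm_sum _ _ _) _.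
  apply: ler_sum => p _; rewrite rnormZr ger0_norm ?fine_ge0//.
  by rewrite /= mul0r subr0; apply: ler_wpM2l; rewrite ?fine_ge0.
have Pf' : rnorm (integral f) <= e * mass K + rnorm (riemann_sum mu P f).
  rewrite rnorm_distC in Pf; 
  apply: le_trans (_ : rnorm (integral f - riemann_sum mu P f) +
    rnorm (riemann_sum mu P f) <= _).
    by apply: le_trans (rnormD _ _); rewrite subrK.
  by rewrite lerD2r.
have Ph' := le_trans (cscalar_Re_le _) Ph.
rewrite -cscalar_ReB in Ph'; rewrite /real_integral.
have := le_trans (ler_norm _) Ph'; move: Pf' Pfh.
set a := complex.Re _; set b := complex.Re _; set c := rnorm (riemann_sum _ _ _).
rewrite -mulrA; lra.
Qed.

Lemma integral_real_scale (X : completeNormedModType R[i]) K (h : G -> R) (v : X) :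
  compact K -> continuous h -> (forall s, ~ K s -> h s = 0) ->
  integral (fun s => (h s)%:C *: v) = (real_integral h)%:C *: v.
Proof.
move=> cK ch hK; have hcK := supported_real cK ch hK.
rewrite /real_integral.
rewrite (@integral_op (cscalar R) X (fun z => (complex.Re z)%:C *: v) (rnorm v) K) //=.
- by move=> x y; rewrite raddfD rmorphD scalerDl.
- by move=> r [a b]; rewrite scalerA -rmorphM /= mul0r subr0.
- move=> x; rewrite rnormZr mulrC; apply: ler_wpM2l; first exact: rnorm_ge0.
  exact: cscalar_Re_le.
Qed.

(** The step function equal to [C + d] on [O] and to [C] on [K \ O] is within
[C] of [h] on [K], and its integral exceeds [C * mass K] by [d * mass O]. *)
Lemma real_integral_ge K (h : G -> R) (O : set G) (d C : R) :
  compact K -> continuous h -> (forall s, ~ K s -> h s = 0) ->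
  (forall s, 0 <= h s <= C) -> open O -> 0 <= d -> O `<=` K ->
  (forall s, O s -> d <= h s) -> d * mass O <= real_integral h.
Proof.
move=> cK ch hK hC oO d0 OK dh; have [_ hcc hcK] := supported_real cK ch hK.
have C0 : 0 <= C by have /andP[/le_trans h0 /h0] := hC 1%g.
(* The two sets overlap: the value is [C + d] on [O] and [C] on the rest of
[K]. *)
pose l : seq (set (borel G) * cscalar R) := [:: (O, d%:C); (K, C%:C)].
have lh : step_approx K (fun s => (h s)%:C : cscalar R) l C.
  split=> [p|s Ks].
    rewrite !inE => /orP[]/eqP-> /=; split => //; first exact: open_borel.
    exact: compact_borel.
  rewrite /step !big_cons big_nil /= (mem_set Ks) addr0.
  have /andP[h0 h1] := hC s.
  case: ifPn => [/set_mem/dh dhs|_]; rewrite -?rmorphD -rmorphB /= rnorm_cscalar;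
    rewrite ler_norml; lra.
have := integral_approx hG muK cK hcc hcK lh.
rewrite /step_integral !big_cons big_nil /= addr0 => H.
have := le_trans (ler_norm _) (le_trans (cscalar_Re_le _) H).
rewrite -cscalar_ReB raddfD /= !mul0r !subr0 /real_integral /mass.
set a := complex.Re _; set m := fine (mu K); set o := fine (mu O).
by rewrite (mulrC m) (mulrC o); lra.
Qed.

(** A homeomorphism that multiplies the measure by [c] turns fine partitions
into fine partitions and Riemann sums into [c] times Riemann sums. *)
Lemma integral_homeo (X : completeNormedModType R[i]) K (f : G -> X)
    (h k : G -> G) (c : R) :
  cancel h k -> cancel k h -> continuous h -> continuous k -> 0 <= c ->
  (forall E : set (borel G), measurable E ->
    mu (h @^-1` E) = (c%:E * mu E)%E) ->
  supported K f ->
  supported (k @` K) (f \o h) /\ integral (f \o h) = c%:C *: integral f.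
Proof.
move=> hk kh ch ck c0 muh [cK cf fK].
have fhK : supported (k @` K) (f \o h).
  split.
  - by apply: continuous_compact => //; exact: continuous_subspaceT.
  - by move=> s; apply: continuous_comp; [exact: ch|exact: cf].
  - by move=> s ks; apply: fK => Khs; apply: ks; exists (h s).
split => //; have [ckK cfh fhoff] := fhK.
apply: (@rnorm_le_eqM _ _ _ _ (mass (k @` K) + c * mass K)) => e e0.
pose V t := [set s | rnorm (f s - f t) < e].
have [|P KP] := @fine_partition_ex G K V hG cK.
  by move=> s _; exact: nbhs_oscillation.
pose P' := [seq (h @^-1` p.1 : set (borel G), k p.2) | p <- P].
have KP' : fine_partition (k @` K) (fun t => [set s | V (h t) (h s)]) P'.
  have [PK Ps] := KP; split=> [p' /mapP[p /PK[mp pKV Kp] ->]|s [t Kt <-]] /=.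
    split; [exact: preimage_borel| |by exists p.2].
    move=> s /= /pKV[Khs Vhs]; split; first by exists (h s).
    by rewrite /= kh.
  have [p pP pE] := Ps _ Kt.
  exists (h @^-1` p.1, k p.2); first by apply/mapP; exists p.
  rewrite filter_map -[RHS]/(map (fun p => (h @^-1` p.1 : set (borel G), k p.2)) [:: p]) -pE.
  congr map; apply: eq_filter => r /=.
  by apply/idP/idP => /set_mem /= H; apply/mem_set; move: H; rewrite /= kh.
have H1 := integral_riemann hG muK cK cf fK KP (fun s t _ _ => @ltW _ _ _ _).
have H2 := integral_riemann hG muK ckK cfh fhoff KP' (fun s t _ _ => @ltW _ _ _ _).
have PE : riemann_sum mu P' (f \o h) = c%:C *: riemann_sum mu P f.
  rewrite /riemann_sum big_map scaler_sumr; apply: eq_big_seq => p pP /=.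
  have [mp pKV _] := KP.1 p pP.
  rewrite kh scalerA -rmorphM /= muh// fineM// ge0_fin_numE//.
  by apply: (mass_le hG muK cK mp) => s /pKV[].
apply: le_trans (rnorm_triangle (riemann_sum mu P' (f \o h)) _ _) _.
rewrite rnorm_distC {2}PE -scalerBr rnormZr ger0_norm//.
rewrite mulrDl; apply: lerD; first by rewrite mulrC.
by rewrite -mulrA ler_wpM2l// mulrC.
Qed.

Lemma integral_dist (X : completeNormedModType R[i]) K (f g : G -> X) (C : R) :
  supported K f -> supported K g -> (forall s, K s -> rnorm (f s - g s) <= C) ->
  0 <= C -> rnorm (integral f - integral g) <= C * mass K.
Proof.
move=> fK gK fgC C0.
have -> : integral f - integral g = integral (fun s => (-1) *: g s + f s).
  by rewrite (integral_lin _ gK fK) scaleN1r addrC.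
apply: integral_bound; first exact: supported_lin.
move=> s; rewrite scaleN1r addrC; have [/fgC//|Ks] := pselect (K s).
by have [_ _ ->//] := fK; have [_ _ ->//] := gK; rewrite subrr rnorm0.
Qed.

Section ParametricIntegral.
Variables (T : topologicalType) (X : completeNormedModType R[i]).
Variables (F : T -> G -> X) (K : set G).
Hypothesis cF : continuous (fun p : T * G => F p.1 p.2).
Hypothesis cK : compact K.

Lemma section_supported z : (forall s, ~ K s -> F z s = 0) ->
  supported K (F z).
Proof.
move=> FK; split=> // s.
apply: (@continuous_comp _ _ _ (fun s : G => (z, s)) (fun p => F p.1 p.2)).
  by apply: cvg_pair => /=; [exact: cvg_cst|exact: cvg_id].
exact: cF.
Qed.

(** Joint continuity is uniform in the second variable on a compact set. *)
Lemma tube z e : 0 < e ->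
  \forall z' \near z, forall s, K s -> rnorm (F z' s - F z s) < e.
Proof.
move=> e0; have /compact_near_coveringP ncK := cK.
have := ncK T (nbhs z) (fun z' s => rnorm (F z' s - F z s) < e) _.
apply=> s Ks; have e2 : 0 < e / 2 by rewrite divr_gt0.
have /cts_rnormP/(_ _ e2) : {for (z, s), continuous (fun p : T * G => F p.1 p.2)}.
  exact: cF.
move=> [[A B] /= [zA sB] AB].
exists (B, A) => // -[s' z'] /= [Bs' Az'].
have h1 := AB (z', s') (conj Az' Bs').
have h2 := AB (z, s') (conj (nbhs_singleton zA) Bs').
apply: le_lt_trans (rnorm_triangle (F z s) _ _) _.
by rewrite /= in h1 h2; rewrite (splitr e) ltrD// rnorm_distC.
Qed.

Lemma integral_continuous_at z :
  (\forall z' \near z, forall s, ~ K s -> F z' s = 0) ->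
  {for z, continuous (fun z => integral (F z))}.
Proof.
move=> FK; apply/cts_rnormP => e e0.
have m0 : 0 < mass K + 1 by rewrite ltr_wpDl ?mass_ge0.
have e1 := divr_gt0 e0 m0.
have FKz := nbhs_singleton FK.
apply: filterS2 (tube z e1) FK => z' Fz Fz'.
apply: le_lt_trans (integral_dist (section_supported Fz')
  (section_supported FKz) (fun s Ks => ltW (Fz s Ks)) (ltW e1)) _.
by rewrite mulrAC ltr_pdivrMr// ltr_pM2l// ltrDl.
Qed.

Lemma integral_continuous : (forall z s, ~ K s -> F z s = 0) ->
  continuous (fun z => integral (F z)).
Proof. by move=> FK z; apply: integral_continuous_at; near=> z'; exact: FK.
Unshelve. all: by end_near. Qed.

End ParametricIntegral.

(** A Riemann sum over a partition of [K] commutes with the integral over [L],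
since the latter is linear; by the tube lemma the partition can be chosen fine
uniformly in the second variable. *)
Lemma fubini (X : completeNormedModType R[i]) (F : G -> G -> X) (K L : set G) :
  continuous (fun p : G * G => F p.1 p.2) -> compact K -> compact L ->
  (forall s t, ~ K s -> F s t = 0) -> (forall s t, ~ L t -> F s t = 0) ->
  integral (fun s => integral (fun t => F s t)) =
  integral (fun t => integral (fun s => F s t)).
Proof.
move=> cF cK cL FK FL.
have cF' : continuous (fun p : G * G => F p.2 p.1).
  move=> p; apply: (@continuous_comp _ _ _ (fun p : G * G => (p.2, p.1))
    (fun p => F p.1 p.2)); last exact: cF.
  by apply: cvg_pair => /=; [exact: cvg_snd|exact: cvg_fst].
have FLs s := section_supported cF cL (FL s).
have FKt t := section_supported (F := fun t s => F s t) cF' cK (FK^~ t).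
have i0 (f : G -> X) : (forall s, f s = 0) -> integral f = 0.
  move=> f0; apply: (@rnorm_le_eqM _ _ _ _ 0) => e _; rewrite mul0r subr0.
  rewrite -(mul0r (mass K)); apply: integral_bound => [|s]; last by rewrite f0 rnorm0.
  by split=> // s; rewrite (_ : f = fun=> 0); [exact: cvg_cst|apply/funext].
have sK : supported K (fun s => integral (F s)).
  split=> //; first exact: (integral_continuous cF cL FL).
  by move=> s Ks; apply: i0 => t; exact: FK.
have sL : supported L (fun t => integral (F^~ t)).
  split=> //; first exact: (integral_continuous cF' cK (fun t s => FK s t)).
  by move=> t Lt; apply: i0 => s; exact: FL.
apply: (@rnorm_le_eqM _ _ _ _ (2 * (mass K * mass L))) => e e0.
pose V s := [set s' | forall t, L t -> rnorm (F s' t - F s t) < e].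
have [|P KP] := @fine_partition_ex G K V hG cK.
  by move=> s _; exact: tube.
have H1 : rnorm (riemann_sum mu P (fun s => integral (F s)) -
    integral (fun s => integral (F s))) <= e * mass L * mass K.
  have [_ c1 c2] := sK; apply: (integral_riemann hG muK cK c1 c2 KP) => s s' _ _ Vs.
  by apply: integral_dist => //; [move=> t /Vs/ltW|exact: ltW].
have PE : riemann_sum mu P (fun s => integral (F s)) =
    integral (fun t => riemann_sum mu P (F^~ t)) /\
    supported L (fun t => riemann_sum mu P (F^~ t)).
  rewrite /riemann_sum; elim: P {KP H1} => [|p P [IH IHL]].
    under [X in integral X]eq_fun do rewrite big_nil.
    rewrite big_nil i0//; split=> //; split=> //.
    by under eq_fun do rewrite big_nil; move=> s; exact: cvg_cst.
    by move=> s _; rewrite big_nil.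
  under [X in integral X]eq_fun do rewrite big_cons.
  under [X in supported L X]eq_fun do rewrite big_cons.
  rewrite big_cons IH; split; first by rewrite -(integral_lin _ (FLs p.2) IHL).
  exact: supported_lin.
have H2 : rnorm (integral (fun t => riemann_sum mu P (F^~ t)) -
    integral (fun t => integral (F^~ t))) <= e * mass K * mass L.
  apply: integral_dist => //; first exact: PE.2.
    move=> t Lt; have [_ c1 c2] := FKt t.
    apply: (integral_riemann hG muK cK c1 c2 KP) => s s' _ _ Vs.
    exact/ltW/Vs.
  by rewrite mulr_ge0 ?mass_ge0// ltW.
apply: le_trans (rnorm_triangle (riemann_sum mu P (fun s => integral (F s))) _ _) _.
rewrite rnorm_distC; apply: le_trans (lerD H1 (_ : _ <= e * mass K * mass L)) _.
  by rewrite PE.1.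
by rewrite le_eqVlt; apply/orP; left; apply/eqP; ring.
Qed.

End IntegralProperties.

(** * Haar measure and the modular function *)

Section GroupTopology.
Variable G : topGroupType.

Lemma continuous_mul2 (T : topologicalType) (f g : T -> G) :
  continuous f -> continuous g -> continuous (fun z => (f z * g z)%g).
Proof.
move=> cf cg z; apply: (@continuous_comp _ _ _ (fun z => (f z, g z))
  (fun p : G * G => (p.1 * p.2)%g)); last exact: continuous_mulg.
by apply: cvg_pair => /=; [exact: cf|exact: cg].
Qed.

Lemma continuous_inv1 (T : topologicalType) (f : T -> G) :
  continuous f -> continuous (fun z => (f z)^-1%g).
Proof.
move=> cf z; apply: (@continuous_comp _ _ _ f (fun s : G => s^-1%g)).
  exact: cf.
exact: continuous_invg.
Qed.

Lemma continuous_lmulg r : continuous (fun s : G => (r * s)%g).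
Proof. by apply: continuous_mul2 => ?; [exact: cvg_cst|exact: cvg_id]. Qed.

Lemma compact_image2 (h : G -> G -> G) (K L : set G) :
  continuous (fun p : G * G => h p.1 p.2) -> compact K -> compact L ->
  compact [set x | exists s t, [/\ K s, L t & x = h s t]].
Proof.
move=> ch cK cL.
have -> : [set x | exists s t, [/\ K s, L t & x = h s t]] =
    (fun p : G * G => h p.1 p.2) @` (K `*` L).
  apply/seteqP; split=> [x [s [t [Ks Lt ->]]]|x [[s t] [/= Ks Lt] <-]].
    by exists (s, t).
  by exists s, t.
apply: continuous_compact; first exact: continuous_subspaceT.
exact: compact_setX.
Qed.

Lemma compact_nbhs (s : G) : locally_compact [set: G] ->
  exists2 C : set G, compact C & nbhs s C.
Proof.
move=> /(_ s I) [U /=]; rewrite withinET => Us [cU _].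
by exists U.
Qed.

End GroupTopology.

Section Haar.
Variables (R : realType) (G : topGroupType).
Variables (mu : {measure set (borel G) -> \bar R}) (Delta : G -> R).
Hypothesis lcG : locally_compact [set: G].
Hypothesis hG : hausdorff_space G.
Hypothesis hmu : left_haar_measure mu.
Hypothesis hDelta : modular_function mu Delta.
Local Notation integral := (integral_of mu).
Local Notation real_integral := (real_integral mu).

Lemma haar_compact (K : set G) : compact K -> (mu K < +oo)%E.
Proof. by case: hmu => + _ _ _ _ cK; exact. Qed.

Lemma integral_left (X : completeNormedModType R[i]) K (f : G -> X) (r : G) :
  supported K f -> integral (fun s => f (r * s)%g) = integral f.
Proof.
move=> fK; rewrite -[RHS]scale1r -(rmorph1 (@real_complex R)).
have [||||//||_ <-//] := integral_homeo hG haar_compact (h := fun s => (r * s)%g)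
  (k := fun s => (r^-1 * s)%g) (c := 1) _ _ _ _ _ _ fK.
- exact: mulKg.
- exact: mulVKg.
- by apply: continuous_mul2; [move=> ?; exact: cvg_cst|move=> ?; exact: cvg_id].
- by apply: continuous_mul2; [move=> ?; exact: cvg_cst|move=> ?; exact: cvg_id].
- move=> E mE; rewrite mul1e; case: hmu => _ _ _ /(_ r^-1%g E mE) <- _.
  congr (mu _); apply/seteqP; split=> [s /= Ers|_ [s Es <-]] /=.
    by exists (r * s)%g; rewrite ?mulKg.
  by rewrite mulVKg.
Qed.

Lemma integral_right (X : completeNormedModType R[i]) K (f : G -> X) (r : G) :
  supported K f ->
  integral (fun s => f (s * r)%g) = (Delta r^-1%g)%:C *: integral f.
Proof.
move=> fK.
have [||||||_ <-//] := integral_homeo hG haar_compact (h := fun s => (s * r)%g)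
  (k := fun s => (s * r^-1)%g) (c := Delta r^-1%g) _ _ _ _ _ _ fK.
- exact: mulgK.
- exact: mulgVK.
- by apply: continuous_mul2; [move=> ?; exact: cvg_id|move=> ?; exact: cvg_cst].
- by apply: continuous_mul2; [move=> ?; exact: cvg_id|move=> ?; exact: cvg_cst].
- by apply: ltW; case: hDelta.
- move=> E mE; case: hDelta => _ /(_ r^-1%g E mE) <-.
  congr (mu _); apply/seteqP; split=> [s /= Ers|_ [s Es <-]] /=.
    by exists (s * r)%g; rewrite ?mulgK.
  by rewrite mulgVK.
Qed.

(** Finitely many translates of a nonempty open set cover any given compact
set. If the open set were null, so would be every compact set and, by inner
regularity, the whole group. *)
Lemma haar_open_gt0 (O : set G) : open O -> O !=set0 -> (0 < mu O)%E.
Proof.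
move=> oO [x Ox]; rewrite lt0e measure_ge0 andbT; apply/eqP => O0.
have [_ _ inn inv nz] := hmu; apply: nz; rewrite inn; last exact: openT.
apply/eqP; rewrite eq_le; apply/andP; split; last first.
  apply: ereal_sup_ubound; exists set0; rewrite ?measure0//; split=> //.
  exact: compact0.
apply: ge_ereal_sup => _ [K [cK _] <-].
have : cover_compact K by rewrite -compact_cover.
move=> /(_ G setT (fun s => [set (s * x)%g | x in O])) [s _||D _ KD].
- rewrite (_ : [set _ | _ in O] = (fun t => (s^-1 * t)%g) @^-1` O).
    apply: open_comp => // t _; apply: continuous_mul2 => ?.
      exact: cvg_cst.
    exact: cvg_id.
  apply/seteqP; split=> [_ [t Ot <-]|t /= Ot]; first by rewrite /= mulKg.
  by exists (s^-1 * t)%g; rewrite ?mulVKg.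
- by move=> s _; exists (s * x^-1)%g => //; exists x; rewrite ?mulgVK.
have mO : measurable (O : set (borel G)) by exact: open_borel.
have mS s : measurable ([set (s * x)%g | x in O] : set (borel G)).
  rewrite (_ : [set _ | _ in O] = (fun t => (s^-1 * t)%g) @^-1` O).
    apply: (@preimage_borel G) => //; apply: continuous_mul2 => ?.
      exact: cvg_cst.
    exact: cvg_id.
  apply/seteqP; split=> [_ [t Ot <-]|t /= Ot]; first by rewrite /= mulKg.
  by exists (s^-1 * t)%g; rewrite ?mulVKg.
apply: le_trans (_ : \sum_(s <- enum_fset D) mu [set (s * x)%g | x in O] <= _)%E.
  apply: le_trans (_ : mu (\big[setU/set0]_(s <- enum_fset D) [set (s * x)%g | x in O]) <= _)%E.
    apply: le_measure.
    - by apply/mem_set; exact: compact_borel.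
    - by apply/mem_set; apply: bigsetU_measurable => s _; exact: mS.
    - by move=> s /KD[t tD tO]; rewrite -bigcup_seq; exists t.
  elim: (enum_fset D) => [|s D' IH]; first by rewrite !big_nil measure0.
  rewrite !big_cons; apply: le_trans (leeD2l _ IH); apply: measureU2 => //.
  by apply: bigsetU_measurable => t _; exact: mS.
by rewrite big1// => s _; rewrite inv.
Qed.

Definition bump_fun (V K : set G) (phi : G -> R) : Prop :=
  [/\ compact K, continuous phi & forall s, ~ K s -> phi s = 0] /\
  [/\ forall s, ~ V s -> phi s = 0, forall s, 0 <= phi s & real_integral phi = 1].

(** Uniform separation gives a continuous function that is positive at the
unit and vanishes off [V] and off a compact set; its integral is positive
because nonempty open sets have positive measure. *)
Lemma bump_fun_ex (V : set G) : nbhs 1%g V -> exists K phi, bump_fun V K phi.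
Proof.
move=> V1; have [C cC C1] := compact_nbhs 1%g lcG.
pose W := (V `&` C)°; have oW : open W by exact: open_interior.
have W1 : W 1%g by apply: filterI.
have crG := @locally_compact_completely_regular G R lcG hG.
have /(@uniform_separatorP _ R)[f [cf f01 f0 f1]] :=
  crG 1%g (~` W) (open_closedC oW) (fun H => H W1).
pose h s := 1 - f s.
have f1' s : ~ W s -> f s = 1 by move=> Ws; apply: f1; exists s.
have f0' : f 1%g = 0 by apply: f0; exists 1%g.
have ff s : 0 <= f s <= 1.
  by have := f01 (f s) (ex_intro2 _ _ s I erefl); rewrite /= in_itv.
have ch : continuous h.
  by move=> s; apply: cvgB; [exact: cvg_cst|exact: cf].
have hC s : ~ C s -> h s = 0.
  by move=> Cs; rewrite /h f1' ?subrr// => /interior_subset[].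
have hV s : ~ V s -> h s = 0.
  by move=> Cs; rewrite /h f1' ?subrr// => /interior_subset[].
pose O := h @^-1` [set x | 2^-1 < x].
have oO : open O by apply: open_comp => //; exact: open_gt.
have O1 : O 1%g by rewrite /O /h /= f0'; lra.
have OC : O `<=` C.
  by move=> s Os; apply: contrapT => /hC hs; move: Os; rewrite /O /= hs; lra.
have mO0 : 0 < mass mu O.
  rewrite /mass fine_gt0// haar_open_gt0//; last by exists 1%g.
  by apply: (mass_le hG haar_compact cC) => //; exact: open_borel.
have hO : 0 < real_integral h.
  have := real_integral_ge hG haar_compact (d := 2^-1) (C := 1) cC ch hC _ oO _ OC _.
  move=> H; apply: lt_le_trans (H _ _ _).
  - by rewrite mulr_gt0.
  - by move=> s; have /andP[] := ff s; rewrite /h; lra.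
  - by rewrite invr_ge0.
  - by move=> s; exact: ltW.
exists C, (fun s => (real_integral h)^-1 * h s); split; split => //.
- by move=> s; apply: cvgM; [exact: cvg_cst|exact: ch].
- by move=> s /hC ->; rewrite mulr0.
- by move=> s /hV ->; rewrite mulr0.
- move=> s; rewrite mulr_ge0 ?invr_ge0 ?(ltW hO)//.
  by rewrite /h subr_ge0; have /andP[] := ff s.
rewrite {1}/real_integral.
have H := integral_real_scale hG haar_compact
  (((real_integral h)^-1)%:C : cscalar R) cC ch hC.
rewrite (_ : (fun s => ((real_integral h)^-1 * h s)%:C : cscalar R) =
  fun s => (h s)%:C *: (((real_integral h)^-1)%:C : cscalar R)); last first.
  by apply/funext => s; rewrite mulrC rmorphM.
rewrite H -[_ *: _]/((real_integral h)%:C * ((real_integral h)^-1)%:C : R[i]).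
by rewrite -rmorphM /= divff// gt_eqF.
Qed.

(** A bump concentrated in [V] averages with total mass one, so averaging
values that are within [C] of [z] on [V] gives a vector within [C] of [z]. *)
Lemma bump_average (X : completeNormedModType R[i]) (V K : set G) (phi : G -> R)
    (y : G -> X) (z : X) (C : R) :
  bump_fun V K phi -> continuous y -> (forall s, V s -> rnorm (y s - z) <= C) ->
  rnorm (integral (fun s => (phi s)%:C *: y s) - z) <= C.
Proof.
move=> [[cK cphi phiK] [phiV phi0 phi1]] cy yz.
have sup (w : G -> X) : continuous w -> supported K (fun s => (phi s)%:C *: w s).
  move=> cw; split=> // [|s /phiK ->]; last by rewrite scale0r.
  exact: continuous_scaler.
have cz : continuous (fun _ : G => z) by move=> ?; exact: cvg_cst.
have cyz : continuous (fun s => (-1 : R)%:C *: z + y s).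
  by move=> s; apply: cvgD; [exact: cvg_cst|exact: cy].
have -> : integral (fun s => (phi s)%:C *: y s) - z =
    integral (fun s => (phi s)%:C *: ((-1 : R)%:C *: z + y s)).
  have zE : z = integral (fun s => (phi s)%:C *: z).
    by rewrite (integral_real_scale hG haar_compact z cK cphi phiK) phi1 scale1r.
  rewrite [X in _ - X]zE addrC -scaleN1r.
  rewrite -(integral_lin hG haar_compact (-1) (sup _ cz) (sup _ cy)).
  congr integral; apply/funext => s.
  by rewrite scalerDr !scalerA rmorphN rmorph1 mulrC.
apply: le_trans (integral_le hG haar_compact (h := fun s => C * phi s) (sup _ cyz) _ _ _) _.
- by move=> s; apply: cvgM; [exact: cvg_cst|exact: cphi].
- by move=> s /phiK ->; rewrite mulr0.
- move=> s; rewrite rnormZr ger0_norm// mulrC.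
  have [Vs|/phiV ->] := pselect (V s); last by rewrite !mulr0.
  by rewrite ler_wpM2r// rmorphN rmorph1 scaleN1r addrC yz.
rewrite le_eqVlt; apply/orP; left; apply/eqP.
rewrite /real_integral.
rewrite (_ : (fun s => (C * phi s)%:C : cscalar R) =
  fun s => C%:C *: ((phi s)%:C : cscalar R)); last by apply/funext => s; rewrite rmorphM.
rewrite (integral_scaler hG haar_compact C (supported_real cK cphi phiK)).
move: phi1; rewrite /real_integral; case: (integral _) => a b /= ->.
by rewrite mul0r subr0 mulr1.
Qed.

(** Integrating right translates of a bump of integral one recovers the
modular function, which makes its multiplicativity and continuity properties
of integrals. *)
Lemma modular_bump (phi : G -> R) (K : set G) (r : G) :
  [/\ compact K, continuous phi & forall s, ~ K s -> phi s = 0] ->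
  real_integral (fun s => phi (s * r)%g) = Delta r^-1%g * real_integral phi.
Proof.
move=> [cK cphi phiK]; have pK := supported_real cK cphi phiK.
rewrite /real_integral (integral_right r pK).
by case: (integral _) => a b /=; rewrite mul0r subr0.
Qed.

Lemma modular_gt0 s : 0 < Delta s.
Proof. by case: hDelta. Qed.

Lemma modularM s t : Delta (s * t)%g = Delta s * Delta t.
Proof.
have [K [phi [pK [_ _ p1]]]] := bump_fun_ex (@filterT _ (nbhs (1%g : G)) _).
have [cK cphi phiK] := pK.
have := modular_bump (s * t)^-1%g pK; rewrite p1 mulr1 invgK => <-.
pose g x := phi (x * s^-1)%g.
pose L := [set x | exists a b, [/\ K a, [set s] b & x = (a * b)%g]].
have gL : [/\ compact L, continuous g & forall x, ~ L x -> g x = 0].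
  split.
  - apply: compact_image2; [exact: continuous_mulg|exact: cK|exact: compact_set1].
  - move=> x; apply: (@continuous_comp _ _ _ (fun x => (x * s^-1)%g)).
      by apply: continuous_mul2 => ?; [exact: cvg_id|exact: cvg_cst].
    exact: cphi.
  - move=> x nx; apply: phiK => Kx; apply: nx; exists (x * s^-1)%g, s.
    by rewrite mulgVK.
have := modular_bump t^-1%g gL; rewrite invgK mulrC.
have := modular_bump s^-1%g pK; rewrite invgK p1 mulr1 -/g => -> <-.
congr (real_integral _); apply/funext => x.
by rewrite /g invgM mulgA.
Qed.

Lemma modular1 : Delta 1%g = 1.
Proof.
apply: (mulfI (lt0r_neq0 (modular_gt0 1%g))).
by rewrite -modularM mulg1 mulr1.
Qed.

Lemma modularV s : Delta s^-1%g = (Delta s)^-1.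
Proof.
apply: (mulfI (lt0r_neq0 (modular_gt0 s))).
by rewrite -modularM mulgV modular1 divff// gt_eqF// modular_gt0.
Qed.

Lemma modular_continuous : continuous Delta.
Proof.
have [K [phi [[cK cphi phiK] [_ _ p1]]]] := bump_fun_ex (@filterT _ (nbhs (1%g : G)) _).
move=> s; have [C cC Cs] := compact_nbhs s lcG.
pose L := [set x | exists a b, [/\ K a, C b & x = (a * b)%g]].
have cL : compact L by apply: compact_image2 => //; exact: continuous_mulg.
pose F z x : cscalar R := (phi (x * z^-1)%g)%:C.
have FL z x : C z -> ~ L x -> F z x = 0.
  move=> Cz Lx; rewrite /F phiK// => Kx; apply: Lx.
  by exists (x * z^-1)%g, z; rewrite mulgVK.
have DE z : Delta z = complex.Re (integral (F z)).
  have := @modular_bump phi K z^-1%g; rewrite invgK p1 mulr1 => <- //.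
have cF : continuous (fun p : G * G => F p.1 p.2).
  move=> p; apply/cts_rnormP => e e0.
  have cpp : continuous (fun p : G * G => phi (p.2 * p.1^-1)%g).
    move=> p'; apply: (@continuous_comp _ _ _ (fun p : G * G => (p.2 * p.1^-1)%g)).
      apply: continuous_mul2; first by move=> ?; exact: cvg_snd.
      by apply: continuous_inv1 => ?; exact: cvg_fst.
    exact: cphi.
  have /cvgrPdist_lt/(_ e e0) := cpp p; apply: filterS => t.
  by rewrite /F -rmorphB /= rnorm_cscalar distrC.
have FL' : \forall z' \near s, forall x, ~ L x -> F z' x = 0.
  by apply: filterS Cs => z Cz x; exact: FL.
have /cts_rnormP H := integral_continuous_at hG haar_compact cF cL FL'.
apply/cvgrPdist_lt => e /H; apply: filterS => t Ht.
rewrite distrC; apply: le_lt_trans Ht; rewrite !DE cscalar_ReB.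
exact: cscalar_Re_le.
Qed.

Definition mod_inv (X : normedModType R[i]) (f : G -> X) : G -> X :=
  fun s => (Delta s^-1%g)%:C *: f s^-1%g.

Lemma supported_mod_inv (X : normedModType R[i]) K (f : G -> X) :
  supported K f -> supported ((fun s : G => s^-1%g) @` K) (mod_inv f).
Proof.
move=> [cK cf fK]; split.
- by apply: continuous_compact => //; apply: continuous_subspaceT; exact: continuous_invg.
- apply: continuous_scaler => s.
    apply: (@continuous_comp _ _ _ (fun s : G => s^-1%g) Delta).
      exact: continuous_invg.
    exact: modular_continuous.
  apply: (@continuous_comp _ _ _ (fun s : G => s^-1%g) f).
    exact: continuous_invg.
  exact: cf.
- move=> s Ks; rewrite /mod_inv fK ?scaler0// => K's; apply: Ks.
  by exists s^-1%g; rewrite ?invgK.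
Qed.

(** Let [psi] be a bump of integral one. By left invariance, [\int f] is the
double integral of [psi (s t) f s]. Exchanging the order of integration and
substituting [s t^-1] for [s] gives the double integral of [psi s * Delta t^-1
* f (s t^-1)], whose inner integral over [t] is [psi s] times the integral of
[mod_inv f]. *)
Lemma integral_mod_inv (X : completeNormedModType R[i]) K (f : G -> X) :
  supported K f -> integral (mod_inv f) = integral f.
Proof.
move=> fK; have [cK cf foff] := fK; have fK' := supported_mod_inv fK.
have [S [psi [sS [_ psi0 p1]]]] := bump_fun_ex (@filterT _ (nbhs (1%g : G)) _).
have [cS cpsi psioff] := sS.
pose L := [set x | exists a b, [/\ K a, S b & x = (a^-1 * b)%g]].
have cL : compact L.
  apply: compact_image2 => //; apply: continuous_mul2.
    by apply: continuous_inv1 => ?; exact: cvg_fst.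
  by move=> ?; exact: cvg_snd.
pose F1 (s t : G) : X := (psi (s * t)%g)%:C *: f s.
pose F2 (s t : G) : X := (psi s)%:C *: ((Delta t^-1%g)%:C *: f (s * t^-1)%g).
have F1K s t : ~ K s -> F1 s t = 0 by move=> /foff; rewrite /F1 => ->; rewrite scaler0.
have F1L s t : ~ L t -> F1 s t = 0.
  move=> Lt; have [Ks|/F1K->//] := pselect (K s).
  rewrite /F1 psioff ?scale0r// => Sst; apply: Lt; exists s, (s * t)%g.
  by rewrite mulKg.
have F2S s t : ~ S s -> F2 s t = 0 by move=> /psioff; rewrite /F2 => ->; rewrite scale0r.
have F2L s t : ~ L t -> F2 s t = 0.
  move=> Lt; have [Ss|/F2S->//] := pselect (S s).
  rewrite /F2 foff ?scaler0// => Kst; apply: Lt; exists (s * t^-1)%g, s.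
  by rewrite invgM invgK mulgVK.
have cF1 : continuous (fun p : G * G => F1 p.1 p.2).
  apply: continuous_scaler => p.
    apply: (@continuous_comp _ _ _ (fun p : G * G => (p.1 * p.2)%g) psi).
      exact: continuous_mulg.
    exact: cpsi.
  by apply: (@continuous_comp _ _ _ (fun p : G * G => p.1) f); [exact: cvg_fst|exact: cf].
have cF2 : continuous (fun p : G * G => F2 p.1 p.2).
  apply: continuous_scaler => [p|].
    by apply: (@continuous_comp _ _ _ (fun p : G * G => p.1) psi); [exact: cvg_fst|exact: cpsi].
  apply: continuous_scaler => p.
    apply: (@continuous_comp _ _ _ (fun p : G * G => p.2^-1%g) Delta).
      by apply: continuous_inv1 => ?; exact: cvg_snd.
    exact: modular_continuous.
  apply: (@continuous_comp _ _ _ (fun p : G * G => (p.1 * p.2^-1)%g) f); last exact: cf.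
  apply: continuous_mul2; first by move=> ?; exact: cvg_fst.
  by apply: continuous_inv1 => ?; exact: cvg_snd.
have scaleS (v : X) : supported S (fun s => (psi s)%:C *: v).
  split=> [//||s /psioff ->]; last by rewrite scale0r.
  by apply: continuous_scaler => // ?; exact: cvg_cst.
have total v : integral (fun s => (psi s)%:C *: v) = v.
  by rewrite (integral_real_scale hG haar_compact v cS cpsi psioff) p1 scale1r.
have inner1 s : integral (F1 s) = f s.
  by rewrite -[RHS]total -(integral_left s (scaleS (f s))).
have gS t : supported S (fun s => (psi s)%:C *: f (s * t^-1)%g).
  split=> [//||s /psioff ->]; last by rewrite scale0r.
  apply: continuous_scaler => // s.
  apply: (@continuous_comp _ _ _ (fun s : G => (s * t^-1)%g) f); last exact: cf.
  by apply: continuous_mul2 => ?; [exact: cvg_id|exact: cvg_cst].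
have inner2 t : integral (F1^~ t) = integral (F2^~ t).
  have := integral_right t (gS t); rewrite -(integral_scaler hG haar_compact _ (gS t)).
  move=> H; rewrite (_ : F2^~ t = fun s => (Delta t^-1%g)%:C *: ((psi s)%:C *: f (s * t^-1)%g)).
    rewrite -H; congr integral; apply/funext => s.
    by rewrite /F1 mulgK.
  by apply/funext => s; rewrite /F2 !scalerA mulrC.
have inner3 s : integral (F2 s) = (psi s)%:C *: integral (mod_inv f).
  have trK := integral_right s^-1%g fK'; rewrite invgK in trK.
  have tr0 : supported [set x | exists a b,
      [/\ ((fun s : G => s^-1%g) @` K) a, [set s] b & x = (a * b)%g]]
      (fun t => mod_inv f (t * s^-1)%g).
    have [c1 c2 c3] := fK'; split.
    - apply: compact_image2; [exact: continuous_mulg|exact: c1|exact: compact_set1].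
    - move=> x; apply: (@continuous_comp _ _ _ (fun x => (x * s^-1)%g)).
        by apply: continuous_mul2 => ?; [exact: cvg_id|exact: cvg_cst].
      exact: c2.
    - move=> x nx; apply: c3 => Kx; apply: nx; exists (x * s^-1)%g, s.
      by rewrite mulgVK.
  rewrite (_ : F2 s = fun t => (psi s * Delta s^-1%g)%:C *: mod_inv f (t * s^-1)%g).
    rewrite (integral_scaler hG haar_compact _ tr0) trK scalerA -rmorphM /=.
    by rewrite modularV mulfVK// gt_eqF// modular_gt0.
  apply/funext => t; rewrite /F2 /mod_inv invgM invgK !scalerA -!rmorphM /=.
  congr (_%:C *: _); rewrite modularM -mulrA; congr (_ * _).
  by rewrite mulrA (modularV s) mulVf ?mul1r// gt_eqF// modular_gt0.
transitivity (integral (fun s => integral (F2 s))).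
  by rewrite (eq_fun inner3) total.
rewrite (fubini hG haar_compact cF2 cS cL F2S F2L).
under [X in integral X]eq_fun do rewrite -inner2.
rewrite -(fubini hG haar_compact cF1 cK cL F1K F1L).
by congr integral; apply/funext.
Qed.

End Haar.

(** * Bounded operators *)

Lemma rnorm_double (R : realType) (X : normedModType R[i]) (x : X) :
  rnorm (x + x) = rnorm x *+ 2.
Proof.
have -> : x + x = (2 : R)%:C *: x by rewrite -mulr2n -scaler_nat rmorph_nat.
by rewrite rnormZr ger0_norm// mulr_natl.
Qed.

Section LinearMaps.
Variables (R : realType) (X Y : lmodType R[i]) (T : X -> Y).
Hypothesis linT : linear T.

Lemma lin0 : T 0 = 0.
Proof. by have := linT (-1) 0 0; rewrite scaler0 addr0 scaleN1r addNr. Qed.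

Lemma linD x y : T (x + y) = T x + T y.
Proof. by have := linT 1 x y; rewrite !scale1r. Qed.

Lemma linZ c x : T (c *: x) = c *: T x.
Proof. by have := linT c x 0; rewrite !addr0 lin0 addr0. Qed.

Lemma linN x : T (- x) = - T x.
Proof. by rewrite -scaleN1r linZ scaleN1r. Qed.

Lemma linB x y : T (x - y) = T x - T y.
Proof. by rewrite linD linN. Qed.

Lemma lin_sum n (f : 'I_n -> X) : T (\sum_(i < n) f i) = \sum_(i < n) T (f i).
Proof. by rewrite (big_morph T linD lin0). Qed.

End LinearMaps.

Section OperatorNorm.
Variables (R : realType) (X Y : normedModType R[i]).
Implicit Types (T : X -> Y).

Lemma opnorm_has_sup T : bounded_op T ->
  has_sup [set rnorm (T x) | x in [set x | rnorm x <= 1]].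
Proof.
move=> [_ [M TM]]; split; first by exists (rnorm (T 0)), 0 => //=; rewrite rnorm0.
exists `|M| => _ [x /= x1 <-]; apply: le_trans (TM x) _.
apply: le_trans (ler_wpM2r (rnorm_ge0 x) (ler_norm M)) _.
by rewrite -[leRHS]mulr1 ler_wpM2l.
Qed.

Lemma opnorm_ub T x : bounded_op T -> rnorm (T x) <= opnorm T * rnorm x.
Proof.
move=> bT; have [hs lT] := (opnorm_has_sup bT, bT.1).
have [x0|x0] := eqVneq (rnorm x) 0.
  by rewrite (rnorm_eq0 x0) (lin0 lT) !rnorm0 mulr0.
have x_gt0 : 0 < rnorm x by rewrite lt_neqAle eq_sym x0 rnorm_ge0.
rewrite -ler_pdivrMr// mulrC.
have -> : (rnorm x)^-1 * rnorm (T x) = rnorm (T (((rnorm x)^-1)%:C *: x)).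
  by rewrite (linZ lT) rnormZr ger0_norm// invr_ge0 rnorm_ge0.
apply: (ub_le_sup hs.2); exists (((rnorm x)^-1)%:C *: x) => //=.
by rewrite rnormZr ger0_norm ?mulVf// invr_ge0 rnorm_ge0.
Qed.

Lemma opnorm_le T (C : R) : 0 <= C ->
  (forall x, rnorm (T x) <= C * rnorm x) -> opnorm T <= C.
Proof.
move=> C0 TC; apply: ge_sup => [|_ [x /= x1 <-]].
  by exists (rnorm (T 0)), 0 => //=; rewrite rnorm0.
by apply: le_trans (TC x) _; rewrite -[leRHS]mulr1 ler_wpM2l.
Qed.

End OperatorNorm.

Section GraphExtension.
Variables (R : realType) (V : normedModType R[i]) (W : completeNormedModType R[i]).
Variables (P : V -> W -> Prop) (M : R).
Hypothesis M0 : 0 <= M.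
Hypothesis Plin : forall c v w v' w', P v w -> P v' w' ->
  P (c *: v + v') (c *: w + w').
Hypothesis Pbound : forall v w, P v w -> rnorm w <= M * rnorm v.
Hypothesis Pdense : forall v (e : R), 0 < e ->
  exists v' w', P v' w' /\ rnorm (v' - v) < e.

Let Q v w := forall e : R, 0 < e ->
  exists v' w', [/\ P v' w', rnorm (v' - v) < e & rnorm (w' - w) < e].

Let PB v w v' w' : P v w -> P v' w' -> P (v - v') (w - w').
Proof. by move=> p p'; have := Plin (-1) p' p; rewrite !scaleN1r ![- _ + _]addrC. Qed.

Let Qlin c v w v' w' : Q v w -> Q v' w' -> Q (c *: v + v') (c *: w + w').
Proof.
move=> Qv Qv' e e0; pose a := complex.Re `|c|.
have a0 : 0 <= a by rewrite /a -ler0c RRe_real ?normr_real.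
have d0 : 0 < e / (a + 1) / 2 by rewrite !divr_gt0// ltr_wpDl.
have e2 : 0 < e / 2 by rewrite divr_gt0.
have [v1 [w1 [p1 pv1 pw1]]] := Qv _ d0; have [v2 [w2 [p2 pv2 pw2]]] := Qv' _ e2.
have small (X : normedModType R[i]) (x1 x2 x x' : X) :
    rnorm (x1 - x) < e / (a + 1) / 2 -> rnorm (x2 - x') < e / 2 ->
    rnorm (c *: x1 + x2 - (c *: x + x')) < e.
  move=> h1 h2; rewrite opprD addrACA -scalerBr.
  apply: le_lt_trans (rnormD _ _) _; rewrite rnormZ -/a (splitr e).
  apply: ler_ltD => //; apply: le_trans (ler_wpM2l a0 (ltW h1)) _.
  rewrite mulrA ler_wpM2r ?invr_ge0// mulrCA -[leRHS]mulr1.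
  apply: ler_wpM2l; first exact: ltW.
  by rewrite ler_pdivrMr ?mul1r ?lerDl// ltr_wpDl.
by exists (c *: v1 + v2), (c *: w1 + w2); split; [exact: Plin|exact: small|exact: small].
Qed.

Let Qbound v w : Q v w -> rnorm w <= M * rnorm v.
Proof.
move=> Qv; apply: (@ler_addgt0M _ _ _ (M + 1)) => e e0.
have [v' [w' [p pv pw]]] := Qv e e0.
have h1 : rnorm w <= rnorm w' + e.
  rewrite rnorm_distC in pw; apply: le_trans (_ : rnorm (w - w') + rnorm w' <= _).
    by apply: le_trans (rnormD _ _); rewrite subrK.
  by rewrite addrC lerD2l ltW.
have h2 : rnorm v' <= rnorm v + e.
  apply: le_trans (_ : rnorm (v' - v) + rnorm v <= _).
    by apply: le_trans (rnormD _ _); rewrite subrK.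
  by rewrite addrC lerD2l ltW.
apply: (le_trans h1); rewrite [(M + 1) * e]mulrDl mul1r addrA lerD2r.
by apply: le_trans (Pbound p) _; rewrite -mulrDr ler_wpM2l.
Qed.

Let Qfun v w w' : Q v w -> Q v w' -> w = w'.
Proof.
move=> q q'; have := Qbound (Qlin (-1) q' q).
rewrite !scaleN1r ![- _ + _]addrC subrr rnorm0 mulr0 => h.
by apply: rnorm_le_eq => e /ltW; exact: le_trans.
Qed.

Let Qtotal v : exists w, Q v w.
Proof.
have inv0 n : 0 < n.+1%:R^-1 :> R by rewrite invr_gt0 ltr0n.
have /choice[p Pp] : forall n : nat, exists p : V * W,
    P p.1 p.2 /\ rnorm (p.1 - v) < n.+1%:R^-1.
  by move=> n; have [v' [w' H]] := Pdense v (inv0 n); exists (v', w').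
have small (e : R) : 0 < e -> exists N, forall n, (N <= n)%N -> n.+1%:R^-1 < e.
  move=> e0; exists (Num.truncn e^-1) => n Nn.
  rewrite -[e]invrK ltf_pV2 ?posrE ?invr_gt0 ?ltr0n//.
  by apply: lt_le_trans (truncnS_gt _) _; rewrite ler_nat.
have [w pw] : exists w, forall e : R, 0 < e -> exists N, forall n, (N <= n)%N ->
    rnorm ((p n).2 - w) < e.
  apply: rnorm_cvg_seq => e e0.
  have M1 : 0 < M + 1 by rewrite ltr_wpDl.
  have [N Ne] := small (e / (M + 1) / 2) ltac:(by rewrite !divr_gt0).
  exists N => n m /Ne en /Ne em.
  apply: le_lt_trans (Pbound (PB (Pp n).1 (Pp m).1)) _.
  have h : rnorm ((p n).1 - (p m).1) < e / (M + 1).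
    apply: le_lt_trans (rnorm_triangle v _ _) _; rewrite [ltRHS]splitr.
    by apply: ltrD (lt_trans (Pp n).2 en) _; rewrite rnorm_distC (lt_trans (Pp m).2 em).
  apply: le_lt_trans (ler_wpM2r (rnorm_ge0 _) (_ : M <= M + 1)) _.
    by rewrite lerDl.
  by rewrite mulrC -ltr_pdivlMr.
exists w => e e0; have [N Ne] := small e e0; have [N' Ne'] := pw e e0.
exists (p (maxn N N')).1, (p (maxn N N')).2; split.
- exact: (Pp _).1.
- by apply: lt_trans (Pp _).2 _; apply: Ne; exact: leq_maxl.
- by apply: Ne'; exact: leq_maxr.
Qed.

(** A linear relation with [|w| <= M |v|] on its graph is single valued, hence
a bounded operator; if its domain is dense its closure is defined everywhere.
Working with relations avoids checking separately that a formula on generators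
is well defined. *)
Lemma graph_extension : exists F : V -> W,
  [/\ linear F, forall v, rnorm (F v) <= M * rnorm v & forall v w, P v w -> F v = w].
Proof.
have /choice[F FQ] := Qtotal; exists F; split.
- by move=> c x y; apply: (Qfun (FQ _)); exact: Qlin.
- by move=> v; exact: Qbound.
- move=> v w Pvw; apply: (Qfun (FQ v)) => e e0.
  by exists v, w; rewrite !subrr !rnorm0.
Qed.

End GraphExtension.

Section UniformBoundedness.
Variables (R : realType) (V : completeNormedModType R[i]) (W : normedModType R[i]).
Variables (I : Type) (T : I -> V -> W).
Hypothesis bT : forall i, bounded_op (T i).

Let unbounded := forall M : R, exists i x, M * rnorm x < rnorm (T i x).

Let shrink (n : nat) (x : V) (r : R) : unbounded -> 0 < r ->
  exists p : V * R, [/\ 0 < p.2, p.2 <= n.+1%:R^-1,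
    forall z, rnorm (z - p.1) <= p.2 -> rnorm (z - x) <= r &
    exists i, forall z, rnorm (z - p.1) <= p.2 -> n%:R < rnorm (T i z)].
Proof.
move=> unb r0; have r2 : 0 < r / 2 by rewrite divr_gt0.
have [i [y Ty]] := unb (n.+1%:R / (r / 2)).
have [lT [M0 TM0]] := bT i; pose M := `|M0|.
have M_ge0 : 0 <= M by exact: normr_ge0.
have TM x' : rnorm (T i x') <= M * rnorm x'.
  by apply: le_trans (TM0 x') _; rewrite ler_wpM2r ?rnorm_ge0 ?ler_norm.
have y0 : 0 < rnorm y.
  rewrite lt_neqAle rnorm_ge0 andbT eq_sym; apply/eqP => y0; move: Ty.
  by rewrite (rnorm_eq0 y0) (lin0 lT) !rnorm0 mulr0 ltxx.
pose xi := (r / 2 / rnorm y)%:C *: y.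
have xiE : rnorm xi = r / 2.
  by rewrite rnormZr ger0_norm ?mulfVK ?gt_eqF// divr_ge0 ?ltW.
have Txi : n.+1%:R < rnorm (T i xi).
  rewrite (linZ lT) rnormZr ger0_norm; last by rewrite divr_ge0 ?ltW.
  rewrite mulrAC ltr_pdivlMr// -(ltr_pdivrMl _ _ r2) mulrA.
  by rewrite [(r / 2)^-1 * _]mulrC.
have [x' [xx' Tx']] : exists x', rnorm (x' - x) <= r / 2 /\ n.+1%:R < rnorm (T i x').
  have [h|h] := ltP n.+1%:R (rnorm (T i (x + xi))).
    by exists (x + xi); rewrite addrC addKr xiE.
  exists (x - xi); rewrite addrC addKr rnormN xiE; split=> //.
  have : rnorm (T i xi) *+ 2 <= rnorm (T i (x + xi)) + rnorm (T i (x - xi)).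
    rewrite -[rnorm (T i (x - xi))]rnormN; apply: le_trans (rnormD _ _).
    rewrite -(linN lT) -(linD lT) opprB [xi - x]addrC addrACA subrr add0r.
    by rewrite (linD lT) rnorm_double.
  rewrite mulr2n; lra.
have d0 : 0 < Num.min (r / 2) (Num.min (M + 1)^-1 n.+1%:R^-1).
  by rewrite !lt_min r2 !invr_gt0 ltr0n ltr_wpDl.
exists (x', Num.min (r / 2) (Num.min (M + 1)^-1 n.+1%:R^-1)); split => //=.
- by rewrite !ge_min lexx !orbT.
- move=> z; rewrite !le_min => /andP[zx' _].
  by apply: le_trans (rnorm_triangle x' _ _) _; rewrite (splitr r) lerD.
exists i => z; rewrite !le_min => /and3P[_ zM _].
have Tz : rnorm (T i (z - x')) <= 1.
  apply: le_trans (TM _) _; apply: le_trans (ler_wpM2l M_ge0 zM) _.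
  by rewrite ler_pdivrMr ?mul1r ?lerDl// ltr_wpDl.
have : rnorm (T i x') <= rnorm (T i (z - x')) + rnorm (T i z).
  rewrite -[rnorm (T i (z - x'))]rnormN -(linN lT) opprB.
  by apply: le_trans (rnormD _ _); rewrite -(linD lT) subrK.
rewrite -addn1 natrD in Tx'; lra.
Qed.

(** The gliding hump argument: if the norms are unbounded, there are nested
balls, of radii tending to zero, on the [n]th of which some operator exceeds
[n]; the point common to all of them contradicts pointwise boundedness. *)
Lemma uniform_boundedness :
  (forall x, exists C : R, forall i, rnorm (T i x) <= C) ->
  exists2 M : R, 0 <= M & forall i x, rnorm (T i x) <= M * rnorm x.
Proof.
move=> pw; apply: contrapT => nb.
have unb : unbounded.
  move=> M; apply: contrapT => h; apply: nb; exists `|M| => // i x.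
  apply: le_trans (_ : M * rnorm x <= _); last first.
    by rewrite ler_wpM2r ?rnorm_ge0 ?ler_norm.
  by rewrite leNgt; apply/negP => Tx; apply: h; exists i, x.
have /choice[next nextP] : forall a : nat * (V * R), exists p : V * R,
    0 < a.2.2 -> [/\ 0 < p.2, p.2 <= a.1.+1%:R^-1,
    forall z, rnorm (z - p.1) <= p.2 -> rnorm (z - a.2.1) <= a.2.2 &
    exists i, forall z, rnorm (z - p.1) <= p.2 -> a.1%:R < rnorm (T i z)].
  move=> [n [x r]] /=; have [r0|r0] := ltP 0 r; last by exists (x, r).
  by have [p pP] := shrink n x unb r0; exists p.
(* The centre and the radius of the [n]th ball. *)
pose u := fix u (n : nat) : V * R := if n is m.+1 then next (m, u m) else (0, 1).
have u0 n : 0 < (u n).2 by elim: n => [|n IH] //=; have [] := nextP (n, u n) IH.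
have uS n := nextP (n, u n) (u0 n).
have nested n k z : rnorm (z - (u (n + k)%N).1) <= (u (n + k)%N).2 ->
    rnorm (z - (u n).1) <= (u n).2.
  elim: k => [|k IH]; first by rewrite addn0.
  by rewrite addnS => h; apply: IH; have [_ _ + _] := uS (n + k)%N; exact.
have inball n m : (n <= m)%N -> rnorm ((u m).1 - (u n).1) <= (u n).2.
  move=> nm; apply: (nested n (m - n)%N); rewrite subnKC// subrr rnorm0.
  by rewrite ltW.
have [l ul] : exists l, forall e : R, 0 < e -> exists N, forall n, (N <= n)%N ->
    rnorm ((u n).1 - l) < e.
  apply: rnorm_cvg_seq => e e0.
  exists (Num.truncn (e / 2)^-1).+1 => n m Nn Nm.
  have r2 : (u (Num.truncn (e / 2)^-1).+1).2 < e / 2.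
    have [_ h _ _] := uS (Num.truncn (e / 2)^-1).
    apply: le_lt_trans h _; rewrite -[ltRHS]invrK ltf_pV2 ?posrE ?invr_gt0 ?ltr0n ?divr_gt0//.
    exact: truncnS_gt.
  apply: le_lt_trans (rnorm_triangle (u (Num.truncn (e / 2)^-1).+1).1 _ _) _.
  rewrite [ltRHS]splitr ltrD//; first exact: le_lt_trans (inball _ _ Nn) r2.
  by rewrite rnorm_distC; exact: le_lt_trans (inball _ _ Nm) r2.
have lin n : rnorm (l - (u n).1) <= (u n).2.
  apply/ler_addgt0Pl => e /ul[N Nl].
  apply: le_trans (rnorm_triangle (u (maxn n N)).1 _ _) _; apply: lerD.
    by rewrite rnorm_distC ltW// Nl// leq_maxr.
  by apply: inball; exact: leq_maxl.
have [C TC] := pw l.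
have [_ _ _ [i Ti]] := uS (Num.truncn C).+1.
have := Ti l (lin (Num.truncn C).+2).
by move=> /lt_le_trans/(_ (TC i)); apply/negP; rewrite -leNgt ltW// truncnS_gt.
Qed.

End UniformBoundedness.

(** * Banach algebras and representations of C*-algebras *)

Section BanachAlgebraLemmas.
Variables (R : realType) (A : banachAlgType R).
Implicit Types a b c : A.

Lemma bmulDl a b c : bmul (a + b) c = bmul a c + bmul b c.
Proof. exact: linD (bmul_linearl c) a b. Qed.

Lemma bmulBl a b c : bmul (a - b) c = bmul a c - bmul b c.
Proof. exact: linB (bmul_linearl c) a b. Qed.

Lemma bmulZl (k : R[i]) a c : bmul (k *: a) c = k *: bmul a c.
Proof. exact: linZ (bmul_linearl c) k a. Qed.

Lemma bmul0l c : bmul 0 c = 0.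
Proof. exact: lin0 (bmul_linearl c). Qed.

Lemma bmulBr a b c : bmul c (a - b) = bmul c a - bmul c b.
Proof. exact: linB (bmul_linearr c) a b. Qed.

Lemma bmul0r c : bmul c 0 = 0.
Proof. exact: lin0 (bmul_linearr c). Qed.

Lemma bmul_rnorm a b : rnorm (bmul a b) <= rnorm a * rnorm b.
Proof. by rewrite -lecR rmorphM /= -!rnormE bmul_norm. Qed.

End BanachAlgebraLemmas.

Section BanachStarAlgebraLemmas.
Variables (R : realType) (A : banachStarAlgType R).
Implicit Types a b c : A.

Lemma bstar_rnorm : exists2 M : R, 0 <= M & forall a, rnorm (bstar a) <= M * rnorm a.
Proof.
have [[m1 m2] mP] := @bstar_bounded R A; exists `|m1| => // a.
have := mP a; rewrite !rnormE lecE => /andP[_ /=]; rewrite mulr0 subr0 => h.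
by apply: le_trans h _; rewrite ler_wpM2r ?rnorm_ge0 ?ler_norm.
Qed.

Lemma bstarB a b : bstar (a - b) = bstar a - bstar b.
Proof. by apply: (addIr (bstar b)); rewrite -bstarD !subrK. Qed.

Lemma bstar0 : bstar (0 : A) = 0.
Proof. by have := bstarB 0 0; rewrite !subrr. Qed.

Lemma bstarZr (r : R) a : bstar (r%:C *: a) = r%:C *: bstar a.
Proof. by rewrite bstarZ conjCr. Qed.

(** In a unital algebra [1 - c] would be a square root of [1 - b]. The map [c
|-> (b + c c) / 2] contracts the ball of radius [|b| < 1] and commutes with
the involution, so its fixed point is self-adjoint. *)
Lemma selfadjoint_quasi_sqrt b : bstar b = b -> rnorm b < 1 ->
  exists2 c, bstar c = c & c + c - bmul c c = b.
Proof.
move=> sb b1; pose be := rnorm b; have be0 : 0 <= be by exact: rnorm_ge0.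
have h0 : 0 <= 2^-1 :> R by rewrite invr_ge0.
pose step_ (c : A) := (2^-1 : R)%:C *: (b + bmul c c).
pose u n := iter n step_ 0.
have u_norm n : rnorm (u n) <= be.
  elim: n => [|n IH] /=; first by rewrite rnorm0.
  rewrite rnormZr ger0_norm// ler_pdivrMl//.
  apply: le_trans (rnormD _ _) _; apply: le_trans (lerD (lexx _) (bmul_rnorm _ _)) _.
  rewrite mulr_natl mulr2n lerD// -[leRHS]mulr1.
  by apply: ler_pM; rewrite ?rnorm_ge0//; apply: le_trans IH _; exact: ltW.
have u_star n : bstar (u n) = u n.
  by elim: n => [|n IH] /=; rewrite ?bstar0// bstarZr bstarD bstarM sb IH.
have sq_dist c d : rnorm c <= be -> rnorm d <= be ->
    rnorm (step_ c - step_ d) <= be * rnorm (c - d).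
  move=> hc hd; rewrite /step_ -scalerBr opprD addrACA subrr add0r.
  rewrite (_ : bmul c c - bmul d d = bmul c (c - d) + bmul (c - d) d); last first.
    by rewrite bmulBr bmulBl addrA subrK.
  rewrite rnormZr ger0_norm// ler_pdivrMl//.
  apply: le_trans (rnormD _ _) _; rewrite mulr_natl mulr2n; apply: lerD.
    by apply: le_trans (bmul_rnorm _ _) _; rewrite ler_wpM2r ?rnorm_ge0.
  by apply: le_trans (bmul_rnorm _ _) _; rewrite mulrC ler_wpM2r ?rnorm_ge0.
have u_dist n k : rnorm (u (n + k)%N - u n) <= be ^+ n * be.
  elim: n => [|n IH]; first by rewrite expr0 mul1r subr0 u_norm.
  rewrite addSn /=; apply: le_trans (sq_dist _ _ (u_norm _) (u_norm _)) _.
  by rewrite exprS -mulrA ler_wpM2l.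
have [c uc] : exists c, forall e : R, 0 < e -> exists N, forall n, (N <= n)%N ->
    rnorm (u n - c) < e.
  apply: rnorm_cvg_seq => e e0.
  have [N bN] : exists N, be ^+ N < e / 2.
    have [N _ /(_ N (leqnn N)) bN] : \forall n \near \oo, `|0 - be ^+ n| < e / 2.
      apply: (@cvgr_dist_lt _ R^o); last by rewrite divr_gt0.
      by apply: cvg_expr; rewrite ger0_norm.
    by exists N; rewrite sub0r normrN ger0_norm ?exprn_ge0 in bN.
  have near n : (N <= n)%N -> rnorm (u n - u N) < e / 2.
    move=> Nn; rewrite -(subnKC Nn); apply: le_lt_trans (u_dist _ _) _.
    by apply: le_lt_trans bN; rewrite -[leRHS]mulr1 ler_wpM2l ?exprn_ge0// ltW.
  exists N => n m Nn Nm; apply: le_lt_trans (rnorm_triangle (u N) _ _) _.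
  by rewrite [ltRHS]splitr ltrD ?near// rnorm_distC near.
have c_norm : rnorm c <= be.
  apply/ler_addgt0Pl => e /uc[N /(_ N (leqnn N)) uN].
  apply: le_trans (_ : rnorm (c - u N) + rnorm (u N) <= _).
    by apply: le_trans (rnormD _ _); rewrite subrK.
  by rewrite lerD// rnorm_distC ltW.
have fixc : step_ c = c.
  apply: (@rnorm_le_eqM _ _ _ _ 2) => e e0; have [N uN] := uc e e0.
  apply: le_trans (rnorm_triangle (u N.+1) _ _) _.
  rewrite mulr_natl mulr2n; apply: lerD; last by rewrite ltW// uN.
  apply: le_trans (sq_dist _ _ c_norm (u_norm N)) _.
  apply: le_trans (_ : rnorm (c - u N) <= _); last by rewrite rnorm_distC ltW// uN.
  by rewrite -[leRHS]mul1r ler_wpM2r ?rnorm_ge0// ltW.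
exists c.
  have [M M0 sM] := bstar_rnorm.
  apply: (@rnorm_le_eqM _ _ _ _ (M + 1)) => e e0; have [N /(_ N (leqnn N)) uN] := uc e e0.
  apply: le_trans (rnorm_triangle (u N) _ _) _; rewrite mulrDl mul1r.
  rewrite -{1}(u_star N) -bstarB; apply: lerD; last exact: ltW.
  by apply: le_trans (sM _) _; rewrite ler_wpM2l// rnorm_distC ltW.
have : (2 : R)%:C *: step_ c = (2 : R)%:C *: c by rewrite fixc.
rewrite /step_ scalerA -rmorphM /= mulfV// scale1r.
rewrite (_ : (2 : R)%:C *: c = c + c); last by rewrite rmorph_nat scaler_nat mulr2n.
by move=> <-; rewrite addrK.
Qed.

End BanachStarAlgebraLemmas.

Section CstarRepresentations.
Variables (R : realType) (B : cstarAlgType R) (H : hilbertType R).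
Variable T : B -> H -> H.
Hypothesis repT : algebra_rep T.
Hypothesis invT : involutive_rep T.

Lemma cstar_rnorm (b : B) : rnorm (bmul (bstar b) b) = rnorm b ^+ 2.
Proof. by apply: complexI; rewrite -rnormE cstar_norm rnormE rmorphXn. Qed.

Lemma repD a b x : T (a + b) x = T a x + T b x.
Proof. by case: repT => _ + _ => /(_ 1 a b x); rewrite !scale1r. Qed.

Lemma rep0 x : T 0 x = 0.
Proof. by apply: (addrI (T 0 x)); rewrite -repD !addr0. Qed.

Lemma repZ c a x : T (c *: a) x = c *: T a x.
Proof. by case: repT => _ + _ => /(_ c a 0 x); rewrite !addr0 rep0 addr0. Qed.

Lemma repB a b x : T (a - b) x = T a x - T b x.
Proof. by rewrite -scaleN1r repD repZ scaleN1r. Qed.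

Lemma repM a b x : T (bmul a b) x = T a (T b x).
Proof. by case: repT. Qed.

(** With [b = 2 c - c^2], the difference of the two sides is the squared norm
of [x - T c x]. *)
Lemma rep_selfadjoint_le b x : bstar b = b -> rnorm b < 1 ->
  inner x (T b x) <= inner x x.
Proof.
move=> sb b1; have [c sc cb] := selfadjoint_quasi_sqrt sb b1.
rewrite -subr_ge0 (_ : _ - _ = inner (x - T c x) (x - T c x)).
  by rewrite inner_rnorm ler0c sqr_ge0.
rewrite innerBl !innerBr -{1}cb repB repD repM innerBr innerDr.
rewrite !invT sc !opprB opprD addrA; ring.
Qed.

(** Applied to [b^* b] scaled to norm below one, the previous inequality
bounds [|T b x|^2]. *)
Lemma cstar_rep_contractive b x : rnorm (T b x) <= rnorm b * rnorm x.
Proof.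
apply: (@ler_addgt0M _ _ _ (rnorm x)) => e e0.
have t0 : 0 < rnorm b + e by rewrite ltr_wpDl ?rnorm_ge0.
pose t := (rnorm b + e)^-1; have tp : 0 < t by rewrite invr_gt0.
pose b' := t%:C *: b.
have b'1 : rnorm b' < 1.
  by rewrite rnormZr gtr0_norm// mulrC ltr_pdivrMr// mul1r ltrDl.
have d1 : rnorm (bmul (bstar b') b') < 1.
  by rewrite cstar_rnorm exprn_ilt1 ?rnorm_ge0.
have sd : bstar (bmul (bstar b') b') = bmul (bstar b') b'.
  by rewrite bstarM bstarK.
have := rep_selfadjoint_le x sd d1; rewrite repM -invT !inner_rnorm lecR.
rewrite ler_pXn2r ?nnegrE ?rnorm_ge0// /b' repZ rnormZr gtr0_norm//.
by rewrite /t ler_pdivrMl// mulrDl [rnorm x * e]mulrC.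
Qed.

End CstarRepresentations.

(** * Functions with compact support on the group *)

(** Strong continuity together with a local bound gives joint continuity. *)
Lemma continuous_family_at (R : realType) (Z : topologicalType)
    (X Y : normedModType R[i]) (T : Z -> X -> Y) (f : Z -> X) (z0 : Z) (M : R) :
  (forall z, linear (T z)) ->
  (\forall z \near z0, forall x, rnorm (T z x) <= M * rnorm x) ->
  {for z0, continuous f} -> {for z0, continuous (fun z => T z (f z0))} ->
  {for z0, continuous (fun z => T z (f z))}.
Proof.
move=> lT TM /cts_rnormP cf /cts_rnormP cT; apply/cts_rnormP => e e0.
have M0 : 0 < `|M| + 1 by rewrite ltr_wpDl.
have e2 : 0 < e / 2 by rewrite divr_gt0.
apply: filterS3 TM (cf _ (divr_gt0 e2 M0)) (cT _ e2) => z Tz fz Tf.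
apply: le_lt_trans (rnorm_triangle (T z (f z0)) _ _) _.
rewrite [ltRHS]splitr; apply: ltrD => //; rewrite -(linB (lT z)).
apply: le_lt_trans (Tz _) _.
apply: le_lt_trans (ler_wpM2r (rnorm_ge0 _) (_ : M <= `|M| + 1)) _.
  by apply: le_trans (ler_norm _) _; rewrite lerDl.
by rewrite mulrC -ltr_pdivlMr.
Qed.

Lemma near_rnorm_bounded (R : realType) (Z : topologicalType)
    (X : normedModType R[i]) (f : Z -> X) (z0 : Z) :
  {for z0, continuous f} -> \forall z \near z0, rnorm (f z) <= rnorm (f z0) + 1.
Proof.
move=> /cts_rnormP/(_ _ ltr01); apply: filterS => z fz.
rewrite addrC -lerBlDr; apply: le_trans (ltW fz).
exact: le_trans (ler_norm _) (ler_rnorm_dist _ _).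
Qed.

Lemma compact_rnorm_bounded (R : realType) (Z : topologicalType)
    (X : normedModType R[i]) (f : Z -> X) (K : set Z) :
  compact K -> continuous f ->
  exists2 M : R, 0 <= M & forall z, K z -> rnorm (f z) <= M.
Proof.
move=> /compact_near_coveringP ncK cf.
have [M KM] : exists M : R, K `<=` (fun z => rnorm (f z) <= M).
  suff h : (pinfty_nbhs R) (fun M => K `<=` (fun z => rnorm (f z) <= M)).
    exact: (filter_ex h).
  apply: (ncK R (pinfty_nbhs R) (fun M z => rnorm (f z) <= M) _) => z Kz.
  exists ([set z' | rnorm (f z') <= rnorm (f z) + 1], [set M | rnorm (f z) + 1 < M]).
    split=> /=; first by apply: near_rnorm_bounded; exact: cf.
    by exists (rnorm (f z) + 1); split=> //; exact: num_real.
  by move=> [z' M] /= [h1 h2]; apply: le_trans h1 _; exact: ltW.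
by exists `|M| => // z /KM h; apply: le_trans h (ler_norm _).
Qed.

Section Dynamics.
Variables (R : realType) (A : banachStarAlgType R) (G : topGroupType).
Variables (alpha : G -> A -> A).
Hypothesis halpha : dynamical_system alpha.

Lemma dyn_locally_compact : locally_compact [set: G].
Proof. by case: halpha => -[]. Qed.

Lemma dyn_hausdorff : hausdorff_space G.
Proof. by case: halpha => -[]. Qed.

Lemma alpha_op s : bounded_op (alpha s).
Proof. by case: halpha => _ /(_ s) [[]]. Qed.

Lemma alpha_linear s : linear (alpha s).
Proof. by case: (alpha_op s). Qed.

Lemma alphaM s a b : alpha s (bmul a b) = bmul (alpha s a) (alpha s b).
Proof. by case: halpha => _ /(_ s) [_ h] _ _; exact: h. Qed.

Lemma alpha_comp s t a : alpha (s * t)%g a = alpha s (alpha t a).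
Proof. by case: halpha. Qed.

Lemma alpha1 a : alpha 1%g a = a.
Proof.
have [_ /(_ 1%g) [[_ [S [_ aS _]]] _] _ _] := halpha.
by apply: (can_inj aS); rewrite -alpha_comp mulg1.
Qed.

Lemma alpha_continuous a : continuous (fun s => alpha s a).
Proof. by case: halpha => _ _ _; exact. Qed.

(** Each orbit map is continuous, hence bounded on a compact neighbourhood,
and the uniform boundedness principle applies. *)
Lemma alpha_near_bounded (s0 : G) :
  exists M : R, \forall s \near s0, forall a, rnorm (alpha s a) <= M * rnorm a.
Proof.
have [C cC Cs] := compact_nbhs s0 dyn_locally_compact.
have [|M M0 CM] := @uniform_boundedness R A A {s | C s} (fun s a => alpha (sval s) a)
  (fun s => alpha_op (sval s)).
  move=> a; have [M _ CM] := compact_rnorm_bounded cC (@alpha_continuous a).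
  by exists M => -[s Cs'] /=; exact: CM.
exists M; apply: filterS Cs => s Cs' a.
exact: (CM (exist _ s Cs')).
Qed.

Lemma continuous_alpha2 (Z : topologicalType) (h : Z -> G) (f : Z -> A) :
  continuous h -> continuous f -> continuous (fun z => alpha (h z) (f z)).
Proof.
move=> ch cf z0; have [M aM] := alpha_near_bounded (h z0).
apply: (@continuous_family_at _ _ _ _ (fun z => alpha (h z)) f z0 M) => //.
- by move=> z; exact: alpha_linear.
- exact: (ch z0 _ aM).
- exact: cf.
- apply: (@continuous_comp _ _ _ h (fun s => alpha s (f z0))); first exact: ch.
  exact: alpha_continuous.
Qed.

Lemma continuous_bmul2 (B : banachAlgType R) (Z : topologicalType) (f g : Z -> B) :
  continuous f -> continuous g -> continuous (fun z => bmul (f z) (g z)).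
Proof.
move=> cf cg z0.
apply: (@continuous_family_at _ _ _ _ (fun z => bmul (f z)) g z0 (rnorm (f z0) + 1)) => //.
- by move=> z; exact: bmul_linearr.
- apply: filterS (near_rnorm_bounded (cf z0)) => z fz x.
  by apply: le_trans (bmul_rnorm _ _) _; rewrite ler_wpM2r ?rnorm_ge0.
- exact: cg.
- apply: (@continuous_family_at _ _ _ _ (fun _ => (@bmul _ _)^~ (g z0)) f z0 (rnorm (g z0))) => //.
  + by move=> _; exact: bmul_linearl.
  + by apply: nearW => z x; rewrite mulrC bmul_rnorm.
  + exact: cf.
  + exact: cvg_cst.
Qed.

Lemma continuous_bstar (Z : topologicalType) (f : Z -> A) :
  continuous f -> continuous (fun z => bstar (f z)).
Proof.
move=> cf z; have [M M0 sM] := @bstar_rnorm R A.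
apply/cts_rnormP => e e0; have M1 : 0 < M + 1 by rewrite ltr_wpDl.
have /cts_rnormP/(_ _ (divr_gt0 e0 M1)) := cf z; apply: filterS => t ft.
rewrite -bstarB; apply: le_lt_trans (sM _) _.
apply: le_lt_trans (ler_wpM2r (rnorm_ge0 _) (_ : M <= M + 1)) _.
  by rewrite lerDl.
by rewrite mulrC -ltr_pdivlMr.
Qed.

Lemma Cc_supported (f : G -> A) : Cc f -> supported (closure [set s | f s != 0]) f.
Proof.
move=> [cf cK]; split=> // s ns; apply/eqP; apply: contrapT => /negP fs.
by apply: ns; exact: subset_closure.
Qed.

Lemma supported_Cc K (f : G -> A) : supported K f -> Cc f.
Proof.
move=> [cK cf fK]; split=> //.
apply: (subclosed_compact (@closed_closure _ _) cK).
rewrite [X in _ `<=` X](_ : K = closure K); last first.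
  by apply/closure_id; exact: (compact_closed dyn_hausdorff cK).
apply: closureS => s /= fs; apply: contrapT => /fK f0.
by rewrite f0 eqxx in fs.
Qed.

Lemma supportedU (X : normedModType R[i]) (K L : set G) (f : G -> X) :
  compact L -> supported K f -> supported (K `|` L) f.
Proof.
move=> cL [cK cf fK]; split=> //; first exact: compactU.
by move=> s KLs; apply: fK => Ks; apply: KLs; left.
Qed.

Lemma supportedUr (X : normedModType R[i]) (K L : set G) (f : G -> X) :
  compact K -> supported L f -> supported (K `|` L) f.
Proof. by rewrite setUC; exact: supportedU. Qed.

Lemma Cc_lin (c : R[i]) (f g : G -> A) : Cc f -> Cc g -> Cc (fun s => c *: f s + g s).
Proof.
move=> /Cc_supported fK /Cc_supported gK.
have [cK _ _] := fK; have [cL _ _] := gK.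
by apply: supported_Cc (supported_lin c (supportedU cL fK) (supportedUr cK gK)).
Qed.

Lemma supported_lmul K a (f : G -> A) : supported K f -> supported K (fun s => bmul a (f s)).
Proof.
move=> [cK cf fK]; split=> // [|s /fK ->]; last by rewrite bmul0r.
by apply: continuous_bmul2 => // ?; exact: cvg_cst.
Qed.

Definition lmul (a : A) (f : G -> A) : G -> A := fun s => bmul a (f s).

Lemma Cc_lmul a f : Cc f -> Cc (lmul a f).
Proof. by move=> /Cc_supported/(supported_lmul a)/supported_Cc. Qed.

Definition translate (r : G) (f : G -> A) : G -> A :=
  fun s => alpha r (f (r^-1 * s)%g).

Lemma supported_translate r K f : supported K f ->
  supported [set x | exists a b, [/\ [set r] a, K b & x = (a * b)%g]] (translate r f).
Proof.
move=> [cK cf fK]; split.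
- by apply: compact_image2; [exact: continuous_mulg|exact: compact_set1|].
- apply: continuous_alpha2; first by move=> ?; exact: cvg_cst.
  move=> s; apply: (@continuous_comp _ _ _ (fun s => r^-1 * s)%g f).
    exact: continuous_lmulg.
  exact: cf.
- move=> s ns; rewrite /translate fK ?(lin0 (alpha_linear r))// => Ks.
  by apply: ns; exists r, (r^-1 * s)%g; rewrite mulVKg.
Qed.

Lemma Cc_translate r f : Cc f -> Cc (translate r f).
Proof. by move=> /Cc_supported/(supported_translate r)/supported_Cc. Qed.

Lemma supported_tensor K (phi : G -> R) (u : A) :
  [/\ compact K, continuous phi & forall s, ~ K s -> phi s = 0] ->
  supported K (fun s => (phi s)%:C *: u).
Proof.
move=> [cK cphi phiK]; split=> // [|s /phiK ->]; last by rewrite scale0r.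
by apply: continuous_scaler => // ?; exact: cvg_cst.
Qed.

Section HaarMeasure.
Variables (mu : {measure set (borel G) -> \bar R}) (Delta : G -> R).
Hypothesis hmu : left_haar_measure mu.
Hypothesis hDelta : modular_function mu Delta.
Let hG := dyn_hausdorff.
Let lcG := dyn_locally_compact.
Let muK := haar_compact hmu.

(** The integrand of [convolution], named so that its joint continuity and
support can be stated. *)
Definition conv_integrand (f g : G -> A) (s r : G) : A :=
  bmul (f r) (alpha r (g (r^-1 * s)%g)).

Lemma conv_integrand_continuous f g : continuous f -> continuous g ->
  continuous (fun p : G * G => conv_integrand f g p.1 p.2).
Proof.
move=> cf cg; apply: continuous_bmul2.
  by move=> p; apply: (@continuous_comp _ _ _ (fun p : G * G => p.2) f);
    [exact: cvg_snd|exact: cf].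
apply: continuous_alpha2; first by move=> ?; exact: cvg_snd.
move=> p; apply: (@continuous_comp _ _ _ (fun p : G * G => (p.2^-1 * p.1)%g) g); last exact: cg.
apply: continuous_mul2; last by move=> ?; exact: cvg_fst.
by apply: continuous_inv1 => ?; exact: cvg_snd.
Qed.

Definition prod_set (K L : set G) : set G :=
  [set x | exists a b, [/\ K a, L b & x = (a * b)%g]].

Lemma compact_prod_set K L : compact K -> compact L -> compact (prod_set K L).
Proof. by apply: compact_image2; exact: continuous_mulg. Qed.

Lemma conv_integrand_offl K f g s r : supported K f -> ~ K r -> conv_integrand f g s r = 0.
Proof. by move=> [_ _ fK] /fK h; rewrite /conv_integrand h bmul0l. Qed.

Lemma conv_integrand_offr K L f g s r : supported K f -> supported L g ->
  ~ prod_set K L s -> conv_integrand f g s r = 0.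
Proof.
move=> fK gL ns; have [Kr|/(conv_integrand_offl g s fK)//] := pselect (K r).
have [_ _ gL'] := gL.
rewrite /conv_integrand gL' ?(lin0 (alpha_linear r)) ?bmul0r// => Lrs.
by apply: ns; exists r, (r^-1 * s)%g; rewrite mulVKg.
Qed.

Lemma supported_conv K L f g : supported K f -> supported L g ->
  supported (prod_set K L) (convolution alpha mu f g).
Proof.
move=> fK gL; have [cK cf fK'] := fK; have [cL cg gL'] := gL.
have cI := conv_integrand_continuous cf cg.
split; first exact: compact_prod_set.
  apply: (integral_continuous hG muK cI cK) => s r; exact: conv_integrand_offl fK.
move=> s ns; rewrite /convolution.
have := @integral_bound R G mu hG muK A K (conv_integrand f g s) 0.
rewrite mul0r => h; apply: rnorm_eq0; apply/eqP; rewrite eq_le rnorm_ge0 andbT.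
apply: h; first by apply: (section_supported cI cK) => r; exact: conv_integrand_offl fK.
by move=> r; rewrite (conv_integrand_offr r fK gL ns) rnorm0.
Qed.

Lemma Cc_conv f g : Cc f -> Cc g -> Cc (convolution alpha mu f g).
Proof.
move=> /Cc_supported fK /Cc_supported gL; exact: supported_Cc (supported_conv fK gL).
Qed.

Lemma supported_star K f : supported K f ->
  supported ((fun s : G => s^-1%g) @` K) (Cc_star alpha Delta f).
Proof.
move=> fK; have [cK cf fK'] := fK.
have [M M0 sM] := @bstar_rnorm R A.
have [c1 c2 c3] := supported_mod_inv lcG hG hmu hDelta fK.
split=> //; last first.
  move=> s /c3; rewrite /mod_inv /Cc_star => h.
  rewrite -(linZ (alpha_linear s)) -bstarZr h bstar0.
  exact: lin0 (alpha_linear s).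
rewrite (_ : Cc_star alpha Delta f = fun s => alpha s (bstar (mod_inv Delta f s))).
  by apply: continuous_alpha2; [move=> ?; exact: cvg_id|exact: continuous_bstar].
by apply/funext => s; rewrite /Cc_star /mod_inv bstarZr (linZ (alpha_linear s)).
Qed.

Lemma Cc_Cc_star f : Cc f -> Cc (Cc_star alpha Delta f).
Proof. by move=> /Cc_supported/supported_star/supported_Cc. Qed.

End HaarMeasure.

End Dynamics.

(** * Integrated forms of covariant representations *)

Section Net.
Variables (I : Type) (le : I -> I -> Prop).
Hypothesis inhI : inhabited I.
Hypothesis le_refl : forall i, le i i.
Hypothesis le_trans' : forall i j k, le i j -> le j k -> le i k.
Hypothesis le_dir : forall i j, exists k, le i k /\ le j k.

Definition tails : set_system I := [set S | exists i0, forall i, le i0 i -> S i].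

Lemma tails_filter : ProperFilter tails.
Proof.
split; first by move=> [i /(_ i (le_refl i))].
split.
- by case: inhI => i; exists i.
- move=> S S' [i Si] [j Sj]; have [k [ik jk]] := le_dir i j.
  exists k => l kl; split; [apply: Si|apply: Sj]; exact: le_trans' kl.
- by move=> S S' SS' [i Si]; exists i => j /Si; exact: SS'.
Qed.

End Net.

(** Nets are traded for filters, for which finitely many conditions can be met
at once. *)
Lemma left_approx_id_filter (R : realType) (A : banachAlgType R) (M : R) :
  bounded_left_approx_id A M ->
  exists (I : Type) (F : set_system I) (u : I -> A), [/\ ProperFilter F,
    forall i, rnorm (u i) <= M &
    forall a (e : R), 0 < e -> \forall i \near F, rnorm (bmul (u i) a - a) < e].
Proof.
move=> [I [le [u [inh [rf tr dir] uM ua]]]].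
by exists I, (tails le), u; split => //; exact: tails_filter.
Qed.

Section CovariantRepresentation.
Variables (R : realType) (A : banachStarAlgType R) (G : topGroupType).
Variables (alpha : G -> A -> A) (mu : {measure set (borel G) -> \bar R}) (Delta : G -> R).
Hypothesis halpha : dynamical_system alpha.
Hypothesis hA : forall eps : R, 0 < eps -> bounded_left_approx_id A (1 + eps).
Hypothesis hmu : left_haar_measure mu.
Hypothesis hDelta : modular_function mu Delta.
Let hG := dyn_hausdorff halpha.
Let lcG := dyn_locally_compact halpha.
Let muK := haar_compact hmu.
Local Notation integral := (integral_of mu).

Variables (HH : hilbertType R -> Prop) (H : hilbertType R).
Variables (pi : A -> H -> H) (U : G -> H -> H).
Hypothesis hp : covariant_class alpha HH (existT _ H (pi, U)).

Lemma cov_algebra_rep : algebra_rep pi.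
Proof. by case: hp => _ [[]]. Qed.

Lemma pi_op a : bounded_op (pi a).
Proof. by case: cov_algebra_rep. Qed.

Lemma pi_linear a : linear (pi a).
Proof. by case: (pi_op a). Qed.

Lemma pi_rnorm a x : rnorm (pi a x) <= rnorm a * rnorm x.
Proof.
apply: le_trans (opnorm_ub _ (pi_op a)) _; rewrite ler_wpM2r ?rnorm_ge0//.
by case: hp => _ _ _ [+ _] _; exact.
Qed.

Lemma pi_linearl x : linear (pi^~ x).
Proof. by move=> c a b; case: cov_algebra_rep => _ + _; exact. Qed.

Lemma piM a b x : pi (bmul a b) x = pi a (pi b x).
Proof. by case: cov_algebra_rep. Qed.

Lemma pi_star a x y : inner (pi a x) y = inner x (pi (bstar a) y).
Proof. by case: hp => _ _ _ [_ +] _; exact. Qed.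

Lemma U_op r : invertible_op (U r).
Proof. by case: hp => _ [[_ [+ _] _] _ _] _ _ _; exact. Qed.

Lemma U_linear r : linear (U r).
Proof. by case: (U_op r) => -[]. Qed.

Lemma U_comp r s x : U (r * s)%g x = U r (U s x).
Proof. by case: hp => _ [[_ [_ +] _] _ _] _ _ _; exact. Qed.

Lemma U1 x : U 1%g x = x.
Proof.
have [_ [S [_ US _]]] := U_op 1%g.
by apply: (can_inj US); rewrite -U_comp mulg1.
Qed.

Lemma UK r x : U r^-1%g (U r x) = x.
Proof. by rewrite -U_comp mulVg U1. Qed.

Lemma U_inner r x y : inner (U r x) (U r y) = inner x y.
Proof. by case: hp => _ _ _ _ /(_ r) [_ +]; exact. Qed.

Lemma U_adj r x y : inner (U r x) y = inner x (U r^-1%g y).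
Proof. by rewrite -(U_inner r^-1%g) UK. Qed.

Lemma U_rnorm r x : rnorm (U r x) = rnorm x.
Proof.
apply/eqP; rewrite -(eqrXn2 (n := 2)) ?rnorm_ge0//; apply/eqP/complexI.
by rewrite -!inner_rnorm U_inner.
Qed.

Lemma U_continuous x : continuous (fun r => U r x).
Proof. by case: hp => _ [_ _ +] _ _ _; exact. Qed.

Lemma covariance a s x : pi (alpha s a) x = U s (pi a (U s^-1%g x)).
Proof. by case: hp => _ [[_ _ +] _ _] _ _ _; exact. Qed.

Lemma continuous_pi2 (Z : topologicalType) (f : Z -> A) (g : Z -> H) :
  continuous f -> continuous g -> continuous (fun z => pi (f z) (g z)).
Proof.
move=> cf cg z0.
apply: (@continuous_family_at _ _ _ _ (fun z => pi (f z)) g z0 (rnorm (f z0) + 1)).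
- by move=> z; exact: pi_linear.
- have cfz : {for z0, continuous f} by exact: cf.
  apply: filterS (near_rnorm_bounded cfz) => z fz x.
  by apply: le_trans (pi_rnorm _ _) _; rewrite ler_wpM2r ?rnorm_ge0.
- exact: cg.
- apply: (@continuous_family_at _ _ _ _ (fun _ => pi^~ (g z0)) f z0 (rnorm (g z0))).
  + by move=> _; exact: pi_linearl.
  + by apply: nearW => z x; rewrite mulrC pi_rnorm.
  + exact: cf.
  + exact: cvg_cst.
Qed.

Lemma continuous_U2 (Z : topologicalType) (h : Z -> G) (g : Z -> H) :
  continuous h -> continuous g -> continuous (fun z => U (h z) (g z)).
Proof.
move=> ch cg z0.
apply: (@continuous_family_at _ _ _ _ (fun z => U (h z)) g z0 1).
- by move=> z; exact: U_linear.
- by apply: nearW => z x; rewrite U_rnorm mul1r.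
- exact: cg.
- apply: (@continuous_comp _ _ _ h (fun s => U s (g z0))); first exact: ch.
  exact: U_continuous.
Qed.

Local Notation IF := (integrated_form mu pi U).

Lemma supported_IF K f x : supported K f -> supported K (fun s => pi (f s) (U s x)).
Proof.
move=> [cK cf fK]; split=> //; last by move=> s /fK ->; exact: (lin0 (pi_linearl _)).
by apply: continuous_pi2 => //; exact: U_continuous.
Qed.

Lemma IF_bound K f (C : R) x : supported K f -> (forall s, rnorm (f s) <= C) ->
  rnorm (IF f x) <= C * mass mu K * rnorm x.
Proof.
move=> fK fC; rewrite mulrAC; apply: (integral_bound hG muK (supported_IF x fK)).
move=> s; apply: le_trans (pi_rnorm _ _) _; rewrite U_rnorm.
by rewrite ler_wpM2r ?rnorm_ge0.
Qed.

Lemma IF_linear f : Cc f -> linear (IF f).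
Proof.
move=> /(Cc_supported) fK c x y; rewrite /integrated_form.
rewrite -(integral_lin hG muK c (supported_IF x fK) (supported_IF y fK)).
congr integral; apply/funext => s.
by rewrite (linD (U_linear s)) (linZ (U_linear s)) (linD (pi_linear _)) (linZ (pi_linear _)).
Qed.

Lemma IF_lin c f g x : Cc f -> Cc g ->
  IF (fun s => c *: f s + g s) x = c *: IF f x + IF g x.
Proof.
move=> /Cc_supported fK /Cc_supported gK.
have [cK _ _] := fK; have [cL _ _] := gK.
rewrite /integrated_form.
rewrite -(integral_lin hG muK c (supportedU cL (supported_IF x fK))
  (supportedUr cK (supported_IF x gK))).
congr integral; apply/funext => s.
exact: (pi_linearl _).
Qed.

Lemma IF_lmul a f x : Cc f -> IF (lmul a f) x = pi a (IF f x).
Proof.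
move=> /Cc_supported fK; rewrite /integrated_form.
rewrite (integral_op hG muK (L := pi a) (M := rnorm a) _ _ _ (supported_IF x fK)).
- by congr integral; apply/funext => s; rewrite /lmul piM.
- exact: linD (pi_linear a).
- by move=> r y; exact: linZ (pi_linear a) _ _.
- exact: pi_rnorm.
Qed.

Lemma U_integral r K (h : G -> H) : supported K h ->
  U r (integral h) = integral (fun s => U r (h s)).
Proof.
move=> hK; rewrite (integral_op hG muK (L := U r) (M := 1) _ _ _ hK)//.
- exact: linD (U_linear r).
- by move=> c y; exact: linZ (U_linear r) _ _.
- by move=> y; rewrite U_rnorm mul1r.
Qed.

Lemma IF_translate r f x : Cc f -> IF (translate alpha r f) x = U r (IF f x).
Proof.
move=> /Cc_supported fK; rewrite /integrated_form.
rewrite (U_integral r (supported_IF x fK)).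
have hK : supported (closure [set s | f s != 0]) (fun s => U r (pi (f s) (U s x))).
  apply: (@supported_op _ _ H H (U r) 1 _ (fun s => pi (f s) (U s x))).
  - exact: linD (U_linear r).
  - by move=> y; rewrite U_rnorm mul1r.
  - exact: supported_IF fK.
rewrite -(integral_left hG hmu r^-1%g hK).
congr integral; apply/funext => s.
by rewrite /translate covariance -U_comp.
Qed.

(** After Fubini and a left translation in the inner integral, the covariance
relation turns the integrand into that of the iterated operator. *)
Lemma IF_conv f g x : Cc f -> Cc g ->
  IF (convolution alpha mu f g) x = IF f (IF g x).
Proof.
move=> /Cc_supported fK /Cc_supported gL.
set K := closure _ in fK; set L := closure _ in gL.
have [cK cf fK'] := fK; have [cL cg gL'] := gL.
pose h s := pi (g s) (U s x).
have hL : supported L h := supported_IF x gL.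
pose F s r := pi (f r) (U r (h (r^-1 * s)%g)).
have cF : continuous (fun p : G * G => F p.1 p.2).
  apply: continuous_pi2.
    by move=> p; apply: (@continuous_comp _ _ _ (fun p : G * G => p.2) f);
      [exact: cvg_snd|exact: cf].
  apply: continuous_U2; first by move=> ?; exact: cvg_snd.
  move=> p; apply: (@continuous_comp _ _ _ (fun p : G * G => (p.2^-1 * p.1)%g) h).
    apply: continuous_mul2; last by move=> ?; exact: cvg_fst.
    by apply: continuous_inv1 => ?; exact: cvg_snd.
  by case: hL => _ + _; exact.
have FK s r : ~ K r -> F s r = 0.
  by move=> /fK' fr; rewrite /F fr (lin0 (pi_linearl _)).
have FKL s r : ~ prod_set K L s -> F s r = 0.
  move=> ns; have [Kr|/FK//] := pselect (K r).
  case: hL => _ _ hL'; rewrite /F hL' ?(lin0 (U_linear r)) ?(lin0 (pi_linear _))// => Lrs.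
  by apply: ns; exists r, (r^-1 * s)%g; rewrite mulVKg.
have cKL := compact_prod_set cK cL.
transitivity (integral (fun s => integral (F s))).
  congr integral; apply/funext => s; rewrite /convolution.
  have fgK : supported K (conv_integrand alpha f g s).
    apply: (section_supported (conv_integrand_continuous halpha cf cg) cK) => r.
    exact: conv_integrand_offl fK.
  rewrite (integral_op hG muK (L := pi^~ (U s x)) (M := rnorm (U s x)) _ _ _ fgK).
  - congr integral; apply/funext => r.
    by rewrite /= /conv_integrand piM covariance -U_comp.
  - exact: linD (pi_linearl _).
  - by move=> c y; exact: linZ (pi_linearl _) _ _.
  - by move=> a; rewrite mulrC pi_rnorm.
rewrite (fubini hG muK cF cKL cK FKL FK) /integrated_form.
congr integral; apply/funext => r; rewrite /F.
rewrite -(integral_left hG hmu r^-1%g hL).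
have hrL : supported (prod_set [set r] L) (fun s => h (r^-1 * s)%g).
  case: hL => _ ch hL'; split.
  - by apply: compact_prod_set => //; exact: compact_set1.
  - move=> s; apply: (@continuous_comp _ _ _ (fun s => r^-1 * s)%g h).
      by apply: continuous_lmulg.
    exact: ch.
  - move=> s ns; apply: hL' => Ls; apply: ns.
    by exists r, (r^-1 * s)%g; rewrite mulVKg.
rewrite (U_integral r hrL).
rewrite (integral_op hG muK (L := pi (f r)) (M := rnorm (f r)) (K := prod_set [set r] L)) //.
- exact: linD (pi_linear _).
- by move=> c y; exact: linZ (pi_linear _) _ _.
- exact: pi_rnorm.
- apply: (@supported_op _ _ H H (U r) 1 _ (fun s => h (r^-1 * s)%g)) => //.
    exact: linD (U_linear r).
  by move=> y; rewrite U_rnorm mul1r.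
Qed.

(** The factor [Delta s^-1] in the definition of the involution on [Cc] is the
one that appears in [integral_mod_inv]; the rest is the adjoint of [pi] and of
[U]. *)
Lemma IF_star f x y : Cc f ->
  inner (IF (Cc_star alpha Delta f) x) y = inner x (IF f y).
Proof.
move=> /Cc_supported fK; have hK := supported_IF y fK.
rewrite {2}/integrated_form -(integral_mod_inv lcG hG hmu hDelta hK).
apply: (integral_adjoint hG muK (K := (fun s : G => s^-1%g) @` closure [set s | f s != 0])).
- exact/supported_IF/(supported_star halpha hmu hDelta).
- exact: (supported_mod_inv lcG hG hmu hDelta hK).
move=> s; rewrite /Cc_star /mod_inv (linZ (pi_linearl _)) innerZl innerZrr.
by rewrite covariance UK U_adj pi_star bstarK.
Qed.

(** Non-degeneracy makes a bounded left approximate identity act as an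
approximate unit on the space; the bound two is an arbitrary choice. *)
Lemma pi_approx x (e : R) : 0 < e -> exists u, rnorm (pi u x - x) < e.
Proof.
move=> e0; have [I [F [u [FF u2 ua]]]] := left_approx_id_filter (hA ltr01).
have nd : Defs.nondegenerate pi by case: hp.
have e4 : 0 < e / 4 by rewrite divr_gt0.
have [y [n [c [v [vS ->]]]] xy] := (dense_rnormP _).1 nd x _ e4.
have /choice[p vE] : forall i, exists p : A * H, v i = pi p.1 p.2.
  by move=> i; have [a [z ->]] := vS i; exists (a, z).
pose w := \sum_(i < n) c i *: v i.
(* One [u i] that nearly fixes the finitely many algebra elements in [w]. *)
have [i hi] : exists i, rnorm (pi (u i) w - w) <= e / 4.
  pose C := \sum_(j < n) complex.Re `|c j| * rnorm (p j).2.
  have c0 j : 0 <= complex.Re `|c j| by rewrite -ler0c RRe_real ?normr_real.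
  have C0 : 0 <= C by apply: sumr_ge0 => j _; rewrite mulr_ge0 ?rnorm_ge0.
  have C1 : 0 < C + 1 by rewrite ltr_wpDl.
  have d0 := divr_gt0 e4 C1.
  have [i ui] : exists i, forall j, rnorm (bmul (u i) (p j).1 - (p j).1) < e / 4 / (C + 1).
    apply: (@filter_ex _ F FF); apply: filter_forall => j; exact: ua.
  exists i; rewrite /w (lin_sum (pi_linear _)) -sumrB.
  apply: le_trans (rnorm_sum _ _ _) _.
  apply: le_trans (_ : \sum_(j < n) (complex.Re `|c j| * rnorm (p j).2) * (e / 4 / (C + 1)) <= _).
    apply: ler_sum => j _; rewrite (linZ (pi_linear _)) -scalerBr rnormZ -mulrA.
    rewrite ler_wpM2l// vE -piM -(linB (pi_linearl _)).
    by apply: le_trans (pi_rnorm _ _) _; rewrite mulrC ler_wpM2l ?rnorm_ge0// ltW// ui.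
  rewrite -mulr_suml -/C mulrCA -[leRHS]mulr1.
  apply: ler_wpM2l; first exact: ltW.
  by rewrite ler_pdivrMr// mul1r lerDl.
exists (u i).
have -> : pi (u i) x - x = pi (u i) (x - w) + (pi (u i) w - w) + (w - x).
  by rewrite (linB (pi_linear _)) !addrA !subrK.
apply: le_lt_trans (rnormD _ _) _.
have h1 : rnorm (pi (u i) (x - w)) <= (1 + 1) * (e / 4).
  apply: le_trans (pi_rnorm _ _) _; apply: ler_pM; rewrite ?rnorm_ge0 ?u2//.
  by rewrite rnorm_distC ltW.
have h2 := rnormD (pi (u i) (x - w)) (pi (u i) w - w).
rewrite -/w in xy; lra.
Qed.

(** Approximate units of the convolution algebra are built from functions of
this shape. *)
Definition tensor (phi : G -> R) (u : A) : G -> A := fun s => (phi s)%:C *: u.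

Lemma IF_tensor_dist V K phi u x z C : bump_fun mu V K phi ->
  (forall s, V s -> rnorm (pi u (U s x) - z) <= C) ->
  rnorm (IF (tensor phi u) x - z) <= C.
Proof.
move=> bphi uz; rewrite /integrated_form /tensor.
rewrite (_ : (fun s => _) = fun s => (phi s)%:C *: pi u (U s x)); last first.
  by apply/funext => s; rewrite (linZ (pi_linearl _)).
apply: (bump_average hG hmu bphi) => //.
by apply: continuous_pi2; [move=> ?; exact: cvg_cst|exact: U_continuous].
Qed.

Lemma IF_approx x (e : R) : 0 < e ->
  exists f, Cc f /\ rnorm (IF f x - x) < e.
Proof.
move=> e0; have e2 : 0 < e / 2 by rewrite divr_gt0.
have [u ux] := pi_approx x e2.
have cu : continuous (fun s => pi u (U s x)).
  by apply: continuous_pi2; [move=> ?; exact: cvg_cst|exact: U_continuous].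
have /cts_rnormP/(_ _ e2) uV : {for 1%g, continuous (fun s => pi u (U s x))}.
  exact: cu.
have [K [phi bphi]] := bump_fun_ex lcG hG hmu uV.
exists (tensor phi u); split.
  exact: (supported_Cc halpha (supported_tensor u bphi.1)).
apply: le_lt_trans (rnorm_triangle (pi u x) _ _) _.
rewrite [ltRHS]splitr; apply: ler_ltD => //.
by apply: (IF_tensor_dist bphi) => s /=; rewrite U1 => /ltW.
Qed.

End CovariantRepresentation.

(** * The crossed product and its representations *)

(** Hilbert spaces have no decidable equality, so the injectivity of [existT]
in its second component is derived from proof irrelevance. *)
Lemma existT_inj (I : Type) (F : I -> Type) (i : I) (x y : F i) :
  existT F i x = existT F i y -> x = y.
Proof.
by move=> e; have := projT2_eq e; rewrite (Prop_irrelevance (projT1_eq e) erefl).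
Qed.

Section CrossedProduct.
Variables (R : realType) (A : banachStarAlgType R) (G : topGroupType).
Variables (alpha : G -> A -> A) (mu : {measure set (borel G) -> \bar R}) (Delta : G -> R).
Hypothesis halpha : dynamical_system alpha.
Hypothesis hA : forall eps : R, 0 < eps -> bounded_left_approx_id A (1 + eps).
Hypothesis hmu : left_haar_measure mu.
Hypothesis hDelta : modular_function mu Delta.
Variables (HH : hilbertType R -> Prop).
Hypothesis hR : exists p, covariant_class alpha HH p.
Variables (B : cstarAlgType R) (q : (G -> A) -> B).
Hypothesis hB : is_crossed_product alpha mu Delta (covariant_class alpha HH) q.
Let hG := dyn_hausdorff halpha.
Let lcG := dyn_locally_compact halpha.
Let muK := haar_compact hmu.
Local Notation integral := (integral_of mu).
Local Notation IF := (integrated_form mu).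
Local Notation conv := (convolution alpha mu).
Local Notation crossed := (crossed_rep mu q).
Implicit Types (f g : G -> A).

Definition cov (H : hilbertType R) (pi : A -> H -> H) (U : G -> H -> H) : Prop :=
  covariant_class alpha HH (existT _ H (pi, U)).

Lemma q_lin c f g : Cc f -> Cc g -> q (fun s => c *: f s + g s) = c *: q f + q g.
Proof. by case: hB => + _ _ _ _; exact. Qed.

Lemma q_conv f g : Cc f -> Cc g -> q (conv f g) = bmul (q f) (q g).
Proof. by case: hB => _ + _ _ _; exact. Qed.

Lemma q_star f : Cc f -> q (Cc_star alpha Delta f) = bstar (q f).
Proof. by case: hB => _ _ + _ _; exact. Qed.

Lemma q_dense b (e : R) : 0 < e -> exists2 f, Cc f & rnorm (q f - b) < e.
Proof.
case: hB => _ _ _ _ /dense_rnormP qd e0.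
by have [_ [f cf <-] fb] := qd b e e0; exists f.
Qed.

Definition Cc_sub f g : G -> A := fun s => (-1) *: g s + f s.

Lemma Cc_Cc_sub f g : Cc f -> Cc g -> Cc (Cc_sub f g).
Proof. by move=> cf cg; exact: (Cc_lin halpha). Qed.

Lemma q_sub f g : Cc f -> Cc g -> q (Cc_sub f g) = q f - q g.
Proof. by move=> cf cg; rewrite q_lin// scaleN1r addrC. Qed.

Lemma IF_sub H pi U f g x : @cov H pi U -> Cc f -> Cc g ->
  IF pi U (Cc_sub f g) x = IF pi U f x - IF pi U g x.
Proof. by move=> hp cf cg; rewrite (IF_lin halpha hmu hp)// scaleN1r addrC. Qed.

Lemma Cc_bounded f : Cc f -> exists2 C : R, 0 <= C & forall s, rnorm (f s) <= C.
Proof.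
move=> /Cc_supported [cK cf fK]; have [C C0 KC] := compact_rnorm_bounded cK cf.
exists C => // s; have [/KC//|/fK->] := pselect (closure [set s | f s != 0] s).
by rewrite rnorm0.
Qed.

Lemma IF_op H pi U f : @cov H pi U -> Cc f -> bounded_op (IF pi U f).
Proof.
move=> hp cf; split; first exact: (IF_linear halpha hmu hp).
have [C C0 fC] := Cc_bounded cf.
exists (C * mass mu (closure [set s | f s != 0])) => x.
exact: (IF_bound halpha hmu hp x (Cc_supported cf)).
Qed.

Lemma IF_le_q H pi U f x : @cov H pi U -> Cc f ->
  rnorm (IF pi U f x) <= rnorm (q f) * rnorm x.
Proof.
move=> hp cf; apply: le_trans (opnorm_ub _ (IF_op hp cf)) _.
rewrite ler_wpM2r ?rnorm_ge0//; case: hB => _ _ _ -> // _.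
apply: ub_le_sup; last by exists (existT _ H (pi, U)).
have [C C0 fC] := Cc_bounded cf.
exists (C * mass mu (closure [set s | f s != 0])) => _ [[H' [pi' U']] [hp' ->]] /=.
apply: opnorm_le => [|y]; first by rewrite mulr_ge0 ?mass_ge0.
exact: (IF_bound halpha hmu hp' y (Cc_supported cf)).
Qed.

(** The supremum of a set of reals is its least upper bound only if the set is
non-empty: the existence of a covariant pair enters here. *)
Lemma q_le f (C : R) : Cc f -> 0 <= C ->
  (forall H pi U, @cov H pi U -> forall x, rnorm (IF pi U f x) <= C * rnorm x) ->
  rnorm (q f) <= C.
Proof.
move=> cf C0 fC; case: hB => _ _ _ -> // _; apply: ge_sup.
  by have [p hp] := hR; exists (opnorm (IF (projT2 p).1 (projT2 p).2 f)), p.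
move=> _ [[H [pi U]] [hp ->]] /=; apply: opnorm_le => //; exact: fC.
Qed.

Lemma q_dist f g (C : R) : Cc f -> Cc g -> 0 <= C ->
  (forall H pi U, @cov H pi U -> forall x,
    rnorm (IF pi U f x - IF pi U g x) <= C * rnorm x) ->
  rnorm (q f - q g) <= C.
Proof.
move=> cf cg C0 fC; rewrite -q_sub//; apply: q_le => //; first exact: Cc_Cc_sub.
by move=> H pi U hp x; rewrite (IF_sub x hp)//; exact: fC.
Qed.

Lemma IF_dist H pi U f g x : @cov H pi U -> Cc f -> Cc g ->
  rnorm (IF pi U f x - IF pi U g x) <= rnorm (q f - q g) * rnorm x.
Proof.
move=> hp cf cg; rewrite -(IF_sub x hp)// -q_sub//.
by apply: IF_le_q => //; exact: Cc_Cc_sub.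
Qed.

(** The integrated forms separate the points of the image of [q]. Identities
in [B] between images of functions are obtained from it throughout. *)
Lemma q_eq f g : Cc f -> Cc g ->
  (forall H pi U, @cov H pi U -> forall x, IF pi U f x = IF pi U g x) -> q f = q g.
Proof.
move=> cf cg fg; apply: rnorm_le_eq => e e0; apply: le_trans (ltW e0).
by apply: q_dist => // H pi U hp x; rewrite (fg _ _ _ hp) subrr rnorm0 mul0r.
Qed.

(** Uniformly small functions with support in a fixed compact set are small in
[B], so [q] is continuous for the inductive limit topology. *)
Lemma q_bound K f (C : R) : supported K f -> (forall s, rnorm (f s) <= C) ->
  rnorm (q f) <= C * mass mu K.
Proof.
move=> fK fC; have C0 : 0 <= C := le_trans (rnorm_ge0 _) (fC 1%g).
apply: q_le; [exact: (supported_Cc halpha) fK|by rewrite mulr_ge0 ?mass_ge0|].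
by move=> H pi U hp x; exact: (IF_bound halpha hmu hp x fK).
Qed.

Lemma q_lmul_le a f : Cc f -> rnorm (q (lmul a f)) <= rnorm a * rnorm (q f).
Proof.
move=> cf; apply: q_le; [exact: (Cc_lmul halpha)|by rewrite mulr_ge0 ?rnorm_ge0|].
move=> H pi U hp x; rewrite (IF_lmul halpha hmu hp)// -mulrA.
apply: le_trans (pi_rnorm hp _ _) _.
by rewrite ler_wpM2l ?rnorm_ge0//; exact: IF_le_q.
Qed.

Lemma q_lmul_dist a f g : Cc f -> Cc g ->
  rnorm (q (lmul a f) - q (lmul a g)) <= rnorm a * rnorm (q f - q g).
Proof.
move=> cf cg; apply: q_dist; [exact: (Cc_lmul halpha)|exact: (Cc_lmul halpha)|
  by rewrite mulr_ge0 ?rnorm_ge0|].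
move=> H pi U hp x; rewrite !(IF_lmul halpha hmu hp)// -(linB (pi_linear hp a)) -mulrA.
apply: le_trans (pi_rnorm hp _ _) _.
by rewrite ler_wpM2l ?rnorm_ge0//; exact: IF_dist.
Qed.

Lemma q_translate_dist r f g : Cc f -> Cc g ->
  rnorm (q (translate alpha r f) - q (translate alpha r g)) <= rnorm (q f - q g).
Proof.
move=> cf cg; apply: q_dist; [exact: (Cc_translate halpha)|exact: (Cc_translate halpha)|
  by rewrite rnorm_ge0|].
move=> H pi U hp x; rewrite !(IF_translate halpha hmu hp)// -(linB (U_linear hp r)).
by rewrite (U_rnorm hp); exact: IF_dist.
Qed.

Lemma lmulDl c a b f : lmul (c *: a + b) f = (fun s => c *: lmul a f s + lmul b f s).
Proof. by apply/funext => s; rewrite /lmul bmulDl bmulZl. Qed.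

Lemma q_lmul_lin c a b f : Cc f ->
  q (lmul (c *: a + b) f) = c *: q (lmul a f) + q (lmul b f).
Proof. by move=> cf; rewrite lmulDl q_lin//; exact: (Cc_lmul halpha). Qed.

Lemma lmulM a b f : lmul (bmul a b) f = lmul a (lmul b f).
Proof. by apply/funext => s; rewrite /lmul bmulA. Qed.

Lemma translateM r s f : translate alpha (r * s)%g f = translate alpha r (translate alpha s f).
Proof.
by apply/funext => t; rewrite /translate invgM (alpha_comp halpha) mulgA.
Qed.

Lemma translate1 f : translate alpha 1%g f = f.
Proof. by apply/funext => t; rewrite /translate invg1 mul1g (alpha1 halpha). Qed.

Lemma translate_lmul r a f :
  translate alpha r (lmul a f) = lmul (alpha r a) (translate alpha r f).
Proof. by apply/funext => t; rewrite /translate /lmul (alphaM halpha). Qed.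

Lemma q_translate_near1 f (e : R) : Cc f -> 0 < e ->
  \forall r \near (1%g : G), rnorm (q (translate alpha r f) - q f) <= e.
Proof.
move=> cf e0; have fK := Cc_supported cf; set K := closure _ in fK.
have [cK ctf foff] := fK.
have [C cC C1] := compact_nbhs (1%g : G) lcG.
pose L := prod_set C K `|` K.
have cPK : compact (prod_set C K) by exact: compact_prod_set.
have cL : compact L by exact: compactU.
pose F (r s : G) := alpha r (f (r^-1 * s)%g).
have cF : continuous (fun p : G * G => F p.1 p.2).
  apply: (continuous_alpha2 halpha); first by move=> ?; exact: cvg_fst.
  move=> p; apply: (@continuous_comp _ _ _ (fun p : G * G => (p.1^-1 * p.2)%g) f); last exact: ctf.
  apply: continuous_mul2; last by move=> ?; exact: cvg_snd.
  by apply: continuous_inv1 => ?; exact: cvg_fst.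
have m0 : 0 < mass mu L + 1 by rewrite ltr_wpDl ?mass_ge0.
have e1 : 0 < e / (mass mu L + 1) by rewrite divr_gt0.
apply: filterS2 C1 (tube cF cL 1%g e1) => r Cr Fr.
have cr : Cc (translate alpha r f) by exact: (Cc_translate halpha).
have F1 s : F 1%g s = f s by rewrite /F invg1 mul1g (alpha1 halpha).
have dL : supported L (Cc_sub (translate alpha r f) f).
  have [_ c2 _] := Cc_supported (Cc_Cc_sub cr cf).
  split=> // s Ls; rewrite /Cc_sub foff; last by move=> Ks; apply: Ls; right.
  rewrite scaler0 add0r /translate foff ?(lin0 (alpha_linear halpha r))// => Krs.
  by apply: Ls; left; exists r, (r^-1 * s)%g; rewrite mulVKg.
rewrite -q_sub//; apply: le_trans (q_bound (C := e / (mass mu L + 1)) dL _) _.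
  move=> s; have [Ls|Ls] := pselect (L s); last first.
    by have [_ _ ->//] := dL; rewrite rnorm0 ltW.
  by rewrite /Cc_sub scaleN1r addrC -F1; exact/ltW/Fr.
by rewrite mulrAC ler_pdivrMr// ler_wpM2l ?lerDl// ltW.
Qed.

Lemma q_lmul_near (I : Type) (F : set_system I) (u : I -> A) (M : R) f (e : R) :
  Filter F -> (forall i, rnorm (u i) <= M) ->
  (forall a (e : R), 0 < e -> \forall i \near F, rnorm (bmul (u i) a - a) < e) ->
  Cc f -> 0 < e -> \forall i \near F, rnorm (q (lmul (u i) f) - q f) <= e.
Proof.
move=> FF uM ua cf e0; have fK := Cc_supported cf; set K := closure _ in fK.
have [cK ctf foff] := fK.
have m0 : 0 < mass mu K + 1 by rewrite ltr_wpDl ?mass_ge0.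
pose d := e / (mass mu K + 1); have d0 : 0 < d by rewrite divr_gt0.
have /compact_near_coveringP ncK := cK.
have : \forall i \near F, K `<=` (fun s => rnorm (bmul (u i) (f s) - f s) <= d).
  apply: (ncK I F (fun i s => rnorm (bmul (u i) (f s) - f s) <= d) FF) => s Ks.
  have M2 : 0 < `|M| + 1 by rewrite ltr_wpDl.
  have d1 : 0 < d / 2 / (`|M| + 1 + 1) by rewrite !divr_gt0// ltr_wpDl// ltW.
  have d2 : 0 < d / 2 by rewrite divr_gt0.
  have /cts_rnormP/(_ _ d1) fs : {for s, continuous f} by exact: ctf.
  exists ([set s' | rnorm (f s' - f s) < d / 2 / (`|M| + 1 + 1)],
          [set i | rnorm (bmul (u i) (f s) - f s) < d / 2]).
    by split => //=; exact: ua.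
  move=> [s' i] /= [h1 h2].
  have -> : bmul (u i) (f s') - f s' = bmul (u i) (f s' - f s) +
     (f s - f s') + (bmul (u i) (f s) - f s).
    by rewrite bmulBr [RHS]addrAC !addrA !subrK.
  apply: le_trans (rnormD _ _) _; rewrite [leRHS]splitr; apply: lerD; last exact: ltW.
  apply: le_trans (rnormD _ _) _; rewrite (rnorm_distC (f s)).
  apply: le_trans (lerD (bmul_rnorm _ _) (lexx _)) _.
  rewrite -{2}[rnorm (f s' - f s)]mul1r -mulrDl.
  apply: le_trans (ler_wpM2r (rnorm_ge0 _) (_ : _ <= `|M| + 1 + 1)) _.
    rewrite lerD2r; apply: le_trans (uM i) _; apply: le_trans (ler_norm _) _.
    by rewrite lerDl.
  by rewrite mulrC -ler_pdivlMr ?ltW// ltr_wpDl// ltW.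
apply: filterS => i Ki; have cl : Cc (lmul (u i) f) by exact: (Cc_lmul halpha).
have dK : supported K (Cc_sub (lmul (u i) f) f).
  have [_ c2 _] := Cc_supported (Cc_Cc_sub cl cf).
  split=> // s /foff fs; by rewrite /Cc_sub /lmul fs bmul0r scaler0 addr0.
rewrite -q_sub//; apply: le_trans (q_bound (C := d) dK _) _.
  move=> s; have [Ks|Ks] := pselect (K s); last first.
    by have [_ _ ->//] := dK; rewrite rnorm0 ltW.
  by rewrite /Cc_sub scaleN1r addrC; exact: Ki.
by rewrite /d mulrAC ler_pdivrMr// ler_wpM2l ?lerDl// ltW.
Qed.

(** Such an [h] is an approximate left unit for finitely many functions at
once. Its norm is bounded through the representations: each integrated form
averages operators [pi u * U s] of norm at most [1 + eps] against a
probability density. *)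
Lemma q_left_approx n (f : 'I_n -> G -> A) (eps d : R) :
  (forall i, Cc (f i)) -> 0 < eps -> 0 < d ->
  exists h, [/\ Cc h, rnorm (q h) <= 1 + eps &
    forall i, rnorm (q (conv h (f i)) - q (f i)) <= d].
Proof.
move=> cf eps0 d0.
have [I [F [u [FF uM ua]]]] := left_approx_id_filter (hA eps0).
have d2 : 0 < d / 2 by rewrite divr_gt0.
have [i ui] : exists i, forall j, rnorm (q (lmul (u i) (f j)) - q (f j)) <= d / 2.
  apply: (@filter_ex _ F FF); apply: filter_forall => j; exact: (q_lmul_near _ uM ua).
have e1 : 0 < 1 + eps by rewrite ltr_wpDl.
have V1 : \forall r \near (1%g : G), forall j,
    rnorm (q (translate alpha r (f j)) - q (f j)) <= d / 2 / (1 + eps).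
  by apply: filter_forall => j; apply: q_translate_near1 => //; rewrite divr_gt0.
have [K [phi bphi]] := bump_fun_ex lcG hG hmu V1.
have ch : Cc (tensor phi (u i)) := supported_Cc halpha (supported_tensor (u i) bphi.1).
exists (tensor phi (u i)); split=> //.
  apply: le_trans (_ : rnorm (u i) <= _) => //.
  apply: q_le => //; first exact: rnorm_ge0.
  move=> H pi U hp x; rewrite -[IF _ _ _ _]subr0.
  apply: (IF_tensor_dist halpha hmu hp bphi) => s _.
  by rewrite subr0; apply: le_trans (pi_rnorm hp _ _) _; rewrite (U_rnorm hp).
move=> j; have cc : Cc (conv (tensor phi (u i)) (f j)) by exact: (Cc_conv halpha hmu).
apply: q_dist => // [|H pi U hp x]; first exact: ltW.
rewrite (IF_conv halpha hmu hp)//; set y := IF pi U (f j) x.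
apply: (IF_tensor_dist halpha hmu hp bphi) => r /(_ j) Vr.
have -> : pi (u i) (U r y) - y = pi (u i) (U r y - y) + (pi (u i) y - y).
  by rewrite (linB (pi_linear hp _)) addrA subrK.
apply: le_trans (rnormD _ _) _; rewrite (splitr d) mulrDl; apply: lerD.
  apply: le_trans (pi_rnorm hp _ _) _.
  rewrite /y -(IF_translate halpha hmu hp)//.
  apply: le_trans (ler_pM (rnorm_ge0 _) (rnorm_ge0 _) (uM i) (IF_dist x hp _ _)) _ => //.
    exact: (Cc_translate halpha).
  rewrite mulrA ler_wpM2r ?rnorm_ge0// mulrC -ler_pdivlMr//.
rewrite /y -(IF_lmul halpha hmu hp)//.
apply: le_trans (IF_dist x hp (Cc_lmul halpha (u i) (cf j)) (cf j)) _.
by rewrite ler_wpM2r ?rnorm_ge0.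
Qed.

Lemma q_dense_eq (X : normedModType R[i]) (F F' : B -> X) (M M' : R) :
  (forall b b', rnorm (F b - F b') <= M * rnorm (b - b')) ->
  (forall b b', rnorm (F' b - F' b') <= M' * rnorm (b - b')) ->
  (forall f, Cc f -> F (q f) = F' (q f)) -> forall b, F b = F' b.
Proof.
move=> FM FM' FF' b; apply: (@rnorm_le_eqM _ _ _ _ (`|M| + `|M'|)) => e e0.
have [f cf fb] := q_dense b e0.
apply: le_trans (rnorm_triangle (F (q f)) _ _) _; rewrite mulrDl.
have small N : N * rnorm (q f - b) <= `|N| * e.
  apply: le_trans (_ : `|N| * rnorm (q f - b) <= _).
    by rewrite ler_wpM2r ?rnorm_ge0// ler_norm.
  by rewrite ler_wpM2l// ltW.
apply: lerD.
  by rewrite rnorm_distC; apply: le_trans (FM _ _) (small _).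
by rewrite FF'//; apply: le_trans (FM' _ _) (small _).
Qed.

Definition integrated_rep (H : hilbertType R) (pi : A -> H -> H) (U : G -> H -> H)
  (T : B -> H -> H) :=
  [/\ algebra_rep T, bounded_rep T & forall f, Cc f -> T (q f) = IF pi U f].

Lemma bounded_rep_rnorm (H : hilbertType R) (T : B -> H -> H) :
  algebra_rep T -> bounded_rep T ->
  exists2 M : R, 0 <= M & forall b x, rnorm (T b x) <= M * rnorm b * rnorm x.
Proof.
move=> [oT _ _] [M TM]; exists `|M| => // b x.
apply: le_trans (opnorm_ub _ (oT b)) _; rewrite ler_wpM2r ?rnorm_ge0//.
by apply: le_trans (TM b) _; rewrite ler_wpM2r ?rnorm_ge0// ler_norm.
Qed.

Lemma rep_dist (H : hilbertType R) (T : B -> H -> H) (M : R) x b b' :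
  algebra_rep T -> (forall b x, rnorm (T b x) <= M * rnorm b * rnorm x) ->
  rnorm (T b x - T b' x) <= M * rnorm x * rnorm (b - b').
Proof. by move=> rT TM; rewrite -(repB rT) mulrAC. Qed.

Lemma rep_dist_op (X Y : normedModType R[i]) (L : X -> Y) (M : R) x y :
  linear L -> (forall x, rnorm (L x) <= M * rnorm x) ->
  rnorm (L x - L y) <= M * rnorm (x - y).
Proof. by move=> lL LM; rewrite -(linB lL). Qed.

(** Representations that agree on the dense image of [q] agree on [B] because
they are continuous. *)
Lemma integrated_rep_unique (H : hilbertType R) (pi : A -> H -> H) (U : G -> H -> H)
  (T T' : B -> H -> H) :
  integrated_rep pi U T -> integrated_rep pi U T' -> T = T'.
Proof.
move=> [rT bT TE] [rT' bT' TE'].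
have [M _ TM] := bounded_rep_rnorm rT bT; have [M' _ TM'] := bounded_rep_rnorm rT' bT'.
apply/funext => b; apply/funext => x.
apply: (@q_dense_eq H (T^~ x) (T'^~ x) (M * rnorm x) (M' * rnorm x)).
- by move=> ? ?; exact: rep_dist.
- by move=> ? ?; exact: rep_dist.
- by move=> f cf; rewrite TE// TE'.
Qed.

(** For a fixed vector [x], the map [q f |-> IF f x] is well defined and
bounded by [|x|], so [graph_extension] extends it to [B]; linearity in [x] and
multiplicativity are inherited by density. *)
Lemma integrated_rep_ex (H : hilbertType R) (pi : A -> H -> H) (U : G -> H -> H) : @cov H pi U ->
  exists2 T, integrated_rep pi U T & forall b x, rnorm (T b x) <= rnorm b * rnorm x.
Proof.
move=> hp.
have /choice[F FP] : forall x, exists F : B -> H, [/\ linear F,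
    forall b, rnorm (F b) <= rnorm x * rnorm b & forall f, Cc f -> F (q f) = IF pi U f x].
  move=> x; pose P b y := exists f, [/\ Cc f, b = q f & y = IF pi U f x].
  have [|c v w v' w' [f [cf -> ->]] [g [cg -> ->]]|v w [f [cf -> ->]]|v e e0|F [lF FM FP]] :=
    @graph_extension R B H P (rnorm x).
  - exact: rnorm_ge0.
  - exists (fun s => c *: f s + g s); split; [exact: (Cc_lin halpha)|by rewrite q_lin|].
    by rewrite (IF_lin halpha hmu hp).
  - by rewrite mulrC; exact: IF_le_q.
  - by have [f cf fv] := q_dense v e0; exists (q f), (IF pi U f x); split=> //; exists f.
  - by exists F; split=> // f cf; apply: FP; exists f.
pose T b x := F x b.
have Tle b x : rnorm (T b x) <= rnorm b * rnorm x.
  by have [_ + _] := FP x; rewrite mulrC; exact.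
have Tq f x : Cc f -> T (q f) x = IF pi U f x by have [_ _] := FP x; exact.
have Tlin x : linear (T^~ x) by have [+ _ _] := FP x.
have TlinB x b b' : T (b - b') x = T b x - T b' x by exact: (linB (Tlin x)).
have TLip x b b' : rnorm (T b x - T b' x) <= rnorm x * rnorm (b - b').
  by rewrite -TlinB mulrC.
have TL b : linear (T b).
  move=> c x y.
  apply: (@q_dense_eq H (T^~ (c *: x + y)) (fun b => c *: T b x + T b y)
     (rnorm (c *: x + y)) (complex.Re `|c| * rnorm x + rnorm y)).
  - by move=> ? ?; exact: TLip.
  - move=> b1 b2; rewrite opprD addrACA -scalerBr.
    apply: le_trans (rnormD _ _) _; rewrite rnormZ mulrDl -mulrA.
    by apply: lerD => //; rewrite ler_wpM2l// -ler0c RRe_real ?normr_real.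
  - by move=> f cf; rewrite !Tq//; exact: (IF_linear halpha hmu hp).
have bT b : bounded_op (T b) by split=> //; exists (rnorm b) => x; exact: Tle.
have TM b b' x : T (bmul b b') x = T b (T b' x).
  apply: (@q_dense_eq H (fun b => T (bmul b b') x) (T^~ (T b' x))
     (rnorm b' * rnorm x) (rnorm (T b' x))).
  - move=> b1 b2; rewrite -TlinB -bmulBl; apply: le_trans (Tle _ _) _.
    rewrite [leRHS]mulrC mulrA ler_wpM2r ?rnorm_ge0//; exact: bmul_rnorm.
  - by move=> ? ?; exact: TLip.
  move=> f cf.
  apply: (@q_dense_eq H (fun b' => T (bmul (q f) b') x) (fun b' => T (q f) (T b' x))
     (rnorm (q f) * rnorm x) (rnorm (q f) * rnorm x)).
  - move=> b1 b2; rewrite -TlinB -bmulBr; apply: le_trans (Tle _ _) _.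
    rewrite mulrAC ler_wpM2r ?rnorm_ge0//; exact: bmul_rnorm.
  - move=> b1 b2; rewrite -(linB (TL (q f))) -TlinB; apply: le_trans (Tle _ _) _.
    by rewrite -mulrA ler_wpM2l ?rnorm_ge0// mulrC.
  move=> g cg; rewrite -q_conv// Tq; last exact: (Cc_conv halpha hmu).
  rewrite (Tq f _ cf) (Tq g _ cg); exact: (IF_conv halpha hmu hp x cf cg).
exists T => //; split.
- by split=> // c b b' x; exact: Tlin.
- by exists 1 => b; rewrite mul1r; apply: opnorm_le => [|x]; [exact: rnorm_ge0|exact: Tle].
- by move=> f cf; apply/funext => x; exact: Tq.
Qed.

Lemma crossed_repP (H : hilbertType R) (pi : A -> H -> H) (U : G -> H -> H) :
  @cov H pi U -> integrated_rep pi U (crossed pi U).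
Proof.
move=> hp; have [T hT _] := integrated_rep_ex hp.
exact: (xgetPex (fun _ _ => 0) (ex_intro _ T hT)).
Qed.

Lemma crossed_repE (H : hilbertType R) (pi : A -> H -> H) (U : G -> H -> H)
  (T : B -> H -> H) : @cov H pi U -> integrated_rep pi U T ->
  crossed pi U = T.
Proof. by move=> hp hT; apply: integrated_rep_unique hT; exact: crossed_repP. Qed.

Section Forward.
Variables (H : hilbertType R) (pi : A -> H -> H) (U : G -> H -> H).
Hypothesis hp : cov pi U.
Local Notation T := (crossed pi U).

Lemma crossed_rep_rep : algebra_rep T.
Proof. by case: (crossed_repP hp). Qed.

Lemma crossed_rep_q f x : Cc f -> T (q f) x = IF pi U f x.
Proof. by case: (crossed_repP hp) => _ _ TE cf; rewrite TE. Qed.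

Lemma crossed_rep_le b x : rnorm (T b x) <= rnorm b * rnorm x.
Proof. by have [T' hT' T'le] := integrated_rep_ex hp; rewrite (crossed_repE hp hT'). Qed.

Lemma crossed_rep_dist x b b' : rnorm (T b x - T b' x) <= rnorm x * rnorm (b - b').
Proof. by rewrite -(repB crossed_rep_rep) mulrC crossed_rep_le. Qed.

Lemma crossed_rep_approx x (e : R) : 0 < e ->
  exists2 f, Cc f & rnorm (T (q f) x - x) < e.
Proof.
move=> e0; have [f [cf fx]] := IF_approx halpha hA hmu hp x e0.
by exists f => //; rewrite crossed_rep_q.
Qed.

Lemma crossed_rep_involutive : involutive_rep T.
Proof.
move=> b x y; have [M M0 sM] := @bstar_rnorm R B.
apply: (@q_dense_eq (cscalar R) (fun b => inner (T b x) y)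
  (fun b => inner x (T (bstar b) y)) (rnorm x * rnorm y) (rnorm x * rnorm y * M)).
- move=> b1 b2; rewrite -[_ - _]/(inner (T b1 x) y - inner (T b2 x) y : R[i]) -innerBl.
  apply: le_trans (cauchy_schwarz _ _) _; rewrite mulrAC.
  by rewrite ler_wpM2r ?rnorm_ge0// crossed_rep_dist.
- move=> b1 b2.
  rewrite -[_ - _]/(inner x (T (bstar b1) y) - inner x (T (bstar b2) y) : R[i]) -innerBr.
  apply: le_trans (cauchy_schwarz _ _) _; rewrite -!mulrA ler_wpM2l ?rnorm_ge0//.
  apply: le_trans (crossed_rep_dist _ _ _) _; rewrite ler_wpM2l ?rnorm_ge0//.
  by rewrite -bstarB; exact: sM.
- move=> f cf; rewrite -q_star// !crossed_rep_q//; last exact: (Cc_Cc_star halpha hmu hDelta).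
  rewrite innerC -(IF_star halpha hmu hDelta hp)// -innerC //.
Qed.

Lemma crossed_rep_nondegenerate : Defs.nondegenerate T.
Proof.
apply/dense_rnormP => x e e0; have [f cf fx] := crossed_rep_approx x e0.
exists (T (q f) x) => //; exists 1%N, (fun=> 1), (fun=> T (q f) x).
by split; [move=> _; exists (q f), x|rewrite big_ord1 scale1r].
Qed.

Lemma crossed_rep_pi a f x : Cc f -> pi a (T (q f) x) = T (q (lmul a f)) x.
Proof.
by move=> cf; rewrite !crossed_rep_q ?(IF_lmul halpha hmu hp)//; exact: (Cc_lmul halpha).
Qed.

Lemma crossed_rep_U r f x : Cc f -> U r (T (q f) x) = T (q (translate alpha r f)) x.
Proof.
by move=> cf; rewrite !crossed_rep_q ?(IF_translate halpha hmu hp)//; exact: (Cc_translate halpha).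
Qed.

Lemma crossed_rep_approx_op (L : H -> H) (M : R) x (e : R) : linear L ->
  (forall x, rnorm (L x) <= M * rnorm x) -> 0 < e ->
  exists2 f, Cc f & rnorm (L (T (q f) x) - L x) < e.
Proof.
move=> lL LM e0; have M0 : 0 < `|M| + 1 by rewrite ltr_wpDl.
have [f cf fx] := crossed_rep_approx x (divr_gt0 e0 M0); exists f => //.
apply: le_lt_trans (rep_dist_op _ _ lL LM) _.
apply: le_lt_trans (ler_wpM2r (rnorm_ge0 _) (_ : M <= `|M| + 1)) _.
  by apply: le_trans (ler_norm _) _; rewrite lerDl.
by rewrite mulrC -ltr_pdivlMr.
Qed.

(** A closed subspace stable under [pi] and [U] contains the integrals of the
vectors [pi (f s) (U s x)]. Conversely [pi a x] and [U r x] are limits of the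
vectors [T (q (a f)) x] and [T (q (r . f)) x]. *)
Lemma invariant_subspaces_eq (M : set H) : closed_subspace M ->
  (forall a x, M x -> M (pi a x)) /\ (forall r x, M x -> M (U r x)) <->
  forall b x, M x -> M (T b x).
Proof.
move=> [M0 Mlin cM]; split=> [[Mpi MU] b x Mx|MT].
  apply: closed_rnorm => // e e0.
  have x0 : 0 < rnorm x + 1 by rewrite ltr_wpDl ?rnorm_ge0.
  have [f cf fb] := q_dense b (divr_gt0 e0 x0).
  exists (T (q f) x).
    rewrite crossed_rep_q//.
    apply: (integral_closed hG muK (supported_IF hp x (Cc_supported cf))) => //.
    - by move=> y z My Mz; have := Mlin 1 y z My Mz; rewrite scale1r.
    - by move=> r y My; have := Mlin r%:C y 0 My M0; rewrite addr0.
    - by move=> s; apply/Mpi/MU.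
  apply: le_lt_trans (crossed_rep_dist _ _ _) _.
  apply: le_lt_trans (ler_wpM2r (rnorm_ge0 _) (_ : rnorm x <= rnorm x + 1)) _.
    by rewrite lerDl.
  by rewrite mulrC -ltr_pdivlMr.
split=> [a x Mx|r x Mx]; apply: closed_rnorm => // e e0.
  have [f cf fx] := crossed_rep_approx_op x (pi_linear hp a) (pi_rnorm hp a) e0.
  by exists (pi a (T (q f) x)) => //; rewrite crossed_rep_pi//; exact: MT.
have U1' y : rnorm (U r y) <= 1 * rnorm y by rewrite (U_rnorm hp) mul1r.
have [f cf fx] := crossed_rep_approx_op x (U_linear hp r) U1' e0.
by exists (U r (T (q f) x)) => //; rewrite crossed_rep_U//; exact: MT.
Qed.

End Forward.

(** The operator passes through the integral in one direction; in the other it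
is checked on the dense set of vectors [T (q f) x]. *)
Lemma intertwiners_eq (H H' : hilbertType R) (pi : A -> H -> H) (U : G -> H -> H)
  (pi' : A -> H' -> H') (U' : G -> H' -> H') (F : H -> H') :
  @cov H pi U -> @cov H' pi' U' -> bounded_op F ->
  (forall a x, F (pi a x) = pi' a (F x)) /\ (forall r x, F (U r x) = U' r (F x)) <->
  forall b x, F (crossed pi U b x) = crossed pi' U' b (F x).
Proof.
move=> hp hp' [lF [M FM]]; split=> [[Fpi FU] b x|FT].
  apply: (@q_dense_eq H' (fun b => F (crossed pi U b x))
    (fun b => crossed pi' U' b (F x)) (`|M| * rnorm x) (rnorm (F x))).
  - move=> b1 b2; apply: le_trans (rep_dist_op _ _ lF FM) _.
    apply: le_trans (ler_wpM2r (rnorm_ge0 _) (ler_norm M)) _.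
    by rewrite -mulrA ler_wpM2l//; exact: crossed_rep_dist.
  - by move=> b1 b2; exact: crossed_rep_dist.
  - move=> f cf; rewrite !crossed_rep_q// /integrated_form.
    rewrite (integral_op hG muK (L := F) _ _ FM (supported_IF hp x (Cc_supported cf))).
    + by congr integral; apply/funext => s; rewrite /= Fpi FU.
    + exact: linD lF.
    + by move=> r y; exact: linZ lF _ _.
have step (L : H -> H) (L' : H' -> H') (N : R) x : linear L -> linear L' ->
    (forall x, rnorm (L x) <= N * rnorm x) -> (forall x, rnorm (L' x) <= N * rnorm x) ->
    (forall f y, Cc f -> F (L (crossed pi U (q f) y)) =
       L' (crossed pi' U' (q f) (F y))) -> F (L x) = L' (F x).
  move=> lL lL' LN LN' FL.
  apply: (@rnorm_le_eqM _ _ _ _ (`|M| * `|N| + `|N| * `|M|)) => e e0.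
  have [f cf fx] := crossed_rep_approx hp x e0.
  have abs (X Y : normedModType R[i]) (K : X -> Y) (k : R) :
      (forall x, rnorm (K x) <= k * rnorm x) ->
      forall x, rnorm (K x) <= `|k| * rnorm x.
    by move=> Kk y; apply: le_trans (Kk y) _; rewrite ler_wpM2r ?rnorm_ge0 ?ler_norm.
  apply: le_trans (rnorm_triangle (F (L (crossed pi U (q f) x))) _ _) _.
  rewrite mulrDl; apply: lerD.
    rewrite rnorm_distC; apply: le_trans (rep_dist_op _ _ lF (abs _ _ _ _ FM)) _.
    rewrite -mulrA ler_wpM2l//; apply: le_trans (rep_dist_op _ _ lL (abs _ _ _ _ LN)) _.
    by rewrite ler_wpM2l// ltW.
  rewrite FL// -FT; apply: le_trans (rep_dist_op _ _ lL' (abs _ _ _ _ LN')) _.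
  rewrite -mulrA ler_wpM2l//; apply: le_trans (rep_dist_op _ _ lF (abs _ _ _ _ FM)) _.
  by rewrite ler_wpM2l// ltW.
split=> [a x|r x].
  apply: (step (pi a) (pi' a) (rnorm a)).
  - exact: (pi_linear hp).
  - exact: (pi_linear hp').
  - exact: (pi_rnorm hp).
  - exact: (pi_rnorm hp').
  - by move=> f y cf; rewrite crossed_rep_pi// FT crossed_rep_pi.
apply: (step (U r) (U' r) 1).
- exact: (U_linear hp).
- exact: (U_linear hp').
- by move=> y; rewrite (U_rnorm hp) mul1r.
- by move=> y; rewrite (U_rnorm hp') mul1r.
- by move=> f y cf; rewrite crossed_rep_U// FT crossed_rep_U.
Qed.

(** The identity intertwines the representation with itself, hence intertwines
the two pairs. *)
Lemma crossed_rep_inj (H : hilbertType R) (pi pi' : A -> H -> H) (U U' : G -> H -> H) :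
  @cov H pi U -> @cov H pi' U' ->
  crossed pi U = crossed pi' U' -> pi = pi' /\ U = U'.
Proof.
move=> hp hp' TT'.
have bid : bounded_op (@idfun H).
  by split=> [c x y//|]; exists 1 => x; rewrite mul1r.
have [_ h] := intertwiners_eq hp hp' bid.
have [|h1 h2] := h; first by move=> b x; rewrite TT'.
by split; apply/funext => a; apply/funext => x; [exact: h1|exact: h2].
Qed.

(** By density, from the fact that the norm of [q f] is the supremum of the
norms of the integrated forms. *)
Lemma crossed_reps_faithful b :
  (forall H pi U, @cov H pi U -> forall x, crossed pi U b x = 0) -> b = 0.
Proof.
move=> b0; apply: (@rnorm_le_eqM _ _ _ _ 2) => e e0; rewrite subr0.
have [f cf fb] := q_dense b e0.
apply: le_trans (_ : rnorm (b - q f) + rnorm (q f) <= _).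
  by apply: le_trans (rnormD _ _); rewrite subrK.
rewrite mulr2n mulrDl mul1r; apply: lerD; first by rewrite rnorm_distC ltW.
apply: q_le => //; first exact: ltW.
move=> H pi U hp x; rewrite -(crossed_rep_q hp)// -[crossed_rep _ _ _ _ _ _]subr0.
rewrite -(b0 _ _ _ hp x).
by apply: le_trans (crossed_rep_dist hp _ _ _) _; rewrite mulrC ler_wpM2r ?rnorm_ge0// ltW.
Qed.

(** The integrand of a [B]-valued integral representing [q f * q g]. *)
Definition conv_family f g (s : G) : B := q (lmul (f s) (translate alpha s g)).

Lemma q_translate_le r f : Cc f -> rnorm (q (translate alpha r f)) <= rnorm (q f).
Proof.
move=> cf; apply: q_le; [exact: (Cc_translate halpha)|exact: rnorm_ge0|].
move=> H pi U hp x; rewrite (IF_translate halpha hmu hp)// (U_rnorm hp).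
exact: IF_le_q.
Qed.

Lemma q_translate_continuous f : Cc f -> continuous (fun r => q (translate alpha r f)).
Proof.
move=> cf r; apply/cts_rnormP => e e0; have e2 : 0 < e / 2 by rewrite divr_gt0.
have ct s : Cc (translate alpha s f) by exact: (Cc_translate halpha).
have cl : continuous (fun s : G => (r^-1 * s)%g) by exact: continuous_lmulg.
have h1 : nbhs (r^-1 * r)%g
    [set t | rnorm (q (translate alpha t f) - q f) <= e / 2].
  by rewrite mulVg; exact: q_translate_near1.
have : \forall s \near r, rnorm (q (translate alpha (r^-1 * s)%g f) - q f) <= e / 2.
  exact: (cl r _ h1).
apply: filterS => s sf.
have -> : s = (r * (r^-1 * s))%g by rewrite mulVKg.
rewrite translateM; apply: le_lt_trans (q_translate_dist r (ct _) cf) _.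
by apply: le_lt_trans sf _; rewrite ltr_pdivrMr// mulr2n mulrDr mulr1 ltrDl.
Qed.

Lemma supported_conv_family f g : Cc f -> Cc g ->
  supported (closure [set s | f s != 0]) (conv_family f g).
Proof.
move=> cf cg; have [cK ctf fK] := Cc_supported cf.
have ct s : Cc (translate alpha s g) by exact: (Cc_translate halpha).
have lin s : linear (fun a => q (lmul a (translate alpha s g))).
  by move=> c a b; exact: q_lmul_lin.
split=> // [s0|s /fK fs]; last by rewrite /conv_family fs; exact: (lin0 (lin s)).
apply: (@continuous_family_at _ _ _ _ (fun s a => q (lmul a (translate alpha s g))) f s0
  (rnorm (q g))) => //.
- apply: nearW => s a; apply: le_trans (q_lmul_le _ (ct s)) _.
  by rewrite mulrC ler_wpM2r ?rnorm_ge0// q_translate_le.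
- exact: ctf.
- apply/cts_rnormP => e e0.
  have a0 : 0 < rnorm (f s0) + 1 by rewrite ltr_wpDl ?rnorm_ge0.
  have /cts_rnormP/(_ _ (divr_gt0 e0 a0)) :
    {for s0, continuous (fun r => q (translate alpha r g))}.
    exact: q_translate_continuous.
  apply: filterS => s gs; apply: le_lt_trans (q_lmul_dist _ (ct _) (ct _)) _.
  apply: le_lt_trans (ler_wpM2r (rnorm_ge0 _) (_ : _ <= rnorm (f s0) + 1)) _.
    by rewrite lerDl.
  by rewrite mulrC -ltr_pdivlMr.
Qed.

(** Both sides have the same image under every representation coming from a
covariant pair, and these separate the points of [B]. *)
Lemma conv_family_integral f g : Cc f -> Cc g ->
  integral (conv_family f g) = bmul (q f) (q g).
Proof.
move=> cf cg; apply/eqP; rewrite -subr_eq0; apply/eqP/crossed_reps_faithful.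
move=> H pi U hp x; have repT := crossed_rep_rep hp.
rewrite (repB repT) (repM repT); apply/eqP; rewrite subr_eq0; apply/eqP.
rewrite (integral_op hG muK (L := (crossed pi U)^~ x) (M := rnorm x) _ _ _
  (supported_conv_family cf cg)).
- rewrite (crossed_rep_q hp _ cf) (crossed_rep_q hp _ cg) /integrated_form -/(IF pi U g).
  congr integral; apply/funext => s /=.
  have ct : Cc (translate alpha s g) by exact: (Cc_translate halpha).
  rewrite /conv_family (crossed_rep_q hp); last exact: (Cc_lmul halpha).
  by rewrite (IF_lmul halpha hmu hp)// (IF_translate halpha hmu hp).
- by move=> b b'; exact: (repD repT).
- by move=> r b; exact: (repZ repT).
- by move=> b; rewrite mulrC; exact: crossed_rep_le.
Qed.

Lemma inner_IF_star (H : hilbertType R) (pi : A -> H -> H) (U : G -> H -> H) f g x z :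
  cov pi U -> Cc f -> Cc g ->
  inner (IF pi U (conv (Cc_star alpha Delta f) g) x) z = inner (IF pi U g x) (IF pi U f z).
Proof.
move=> hp cf cg.
have e : IF pi U (conv (Cc_star alpha Delta f) g) x =
    IF pi U (Cc_star alpha Delta f) (IF pi U g x).
  exact: (IF_conv halpha hmu hp x (Cc_Cc_star halpha hmu hDelta cf) cg).
apply: etrans (congr1 (fun v => inner v z) e) _.
exact: (IF_star halpha hmu hDelta hp (IF pi U g x) z cf).
Qed.

(** Relations of the form [(S f)^* * g = f^* * S' g] can be tested on inner
products, where they say that [S] and [S'] act as adjoint operators. *)
Lemma q_eq_adjoint f f' g g' : Cc f -> Cc f' -> Cc g -> Cc g' ->
  (forall H pi U, @cov H pi U -> forall x z,
    inner (IF pi U g x) (IF pi U f z) = inner (IF pi U g' x) (IF pi U f' z)) ->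
  bmul (bstar (q f)) (q g) = bmul (bstar (q f')) (q g').
Proof.
move=> cf cf' cg cg' fg.
have cs h : Cc h -> Cc (Cc_star alpha Delta h) by exact: (Cc_Cc_star halpha hmu hDelta).
rewrite -(q_star cf) -(q_star cf') -(q_conv (cs _ cf) cg) -(q_conv (cs _ cf') cg').
apply: q_eq; [exact/(Cc_conv halpha hmu)/cg/cs|exact/(Cc_conv halpha hmu)/cg'/cs|].
move=> H pi U hp x; apply: inner_ext => z.
apply: etrans (inner_IF_star x z hp cf cg) (etrans (fg _ _ _ hp x z) _).
exact: esym (inner_IF_star x z hp cf' cg').
Qed.

Lemma q_lmul_adjoint a f g : Cc f -> Cc g ->
  bmul (bstar (q (lmul a f))) (q g) = bmul (bstar (q f)) (q (lmul (bstar a) g)).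
Proof.
move=> cf cg; apply: (q_eq_adjoint (Cc_lmul halpha a cf) cf cg (Cc_lmul halpha _ cg)).
move=> H pi U hp x z; rewrite [X in inner _ X = _](IF_lmul halpha hmu hp _ _ cf).
rewrite [X in _ = inner X _](IF_lmul halpha hmu hp _ _ cg).
by rewrite (pi_star hp) bstarK.
Qed.

Lemma q_translate_adjoint r f g : Cc f -> Cc g ->
  bmul (bstar (q (translate alpha r f))) (q g) =
  bmul (bstar (q f)) (q (translate alpha r^-1%g g)).
Proof.
move=> cf cg; apply: (q_eq_adjoint (Cc_translate halpha r cf) cf cg (Cc_translate halpha _ cg)).
move=> H pi U hp x z; rewrite [X in inner _ X = _](IF_translate halpha hmu hp _ _ cf).
rewrite [X in _ = inner X _](IF_translate halpha hmu hp _ _ cg).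
by rewrite (U_adj hp) invgK.
Qed.

Lemma q_lmul_conv a h f : Cc h -> Cc f -> q (conv (lmul a h) f) = q (lmul a (conv h f)).
Proof.
move=> ch cf; have cc := Cc_conv halpha hmu ch cf; have cl := Cc_lmul halpha a ch.
apply: q_eq; [exact: (Cc_conv halpha hmu)|exact: (Cc_lmul halpha)|move=> H pi U hp x].
rewrite [LHS](IF_conv halpha hmu hp _ cl cf) [RHS](IF_lmul halpha hmu hp _ _ cc).
rewrite [X in _ = pi a X](IF_conv halpha hmu hp _ ch cf).
by rewrite [LHS](IF_lmul halpha hmu hp _ _ ch).
Qed.

Lemma q_translate_conv r h f : Cc h -> Cc f ->
  q (conv (translate alpha r h) f) = q (translate alpha r (conv h f)).
Proof.
move=> ch cf; have cc := Cc_conv halpha hmu ch cf; have cl := Cc_translate halpha r ch.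
apply: q_eq; [exact: (Cc_conv halpha hmu)|exact: (Cc_translate halpha)|move=> H pi U hp x].
rewrite [LHS](IF_conv halpha hmu hp _ cl cf) [RHS](IF_translate halpha hmu hp _ _ cc).
rewrite [X in _ = U r X](IF_conv halpha hmu hp _ ch cf).
by rewrite [LHS](IF_translate halpha hmu hp _ _ ch).
Qed.

Section Backward.
Variables (H : hilbertType R) (T : B -> H -> H).
Hypothesis repT : algebra_rep T.
Hypothesis ndT : Defs.nondegenerate T.
Hypothesis invT : involutive_rep T.

Lemma rep_le b x : rnorm (T b x) <= rnorm b * rnorm x.
Proof. exact: cstar_rep_contractive. Qed.

Lemma rep_linear b : linear (T b).
Proof. by case: repT => /(_ b) []. Qed.

(** Finite sums of vectors [T (q (S f)) y]. With [S] the identity these form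
the dense subspace on which the new operators are defined, and the operator
attached to [S] sends [rep_sum id p] to [rep_sum S p]. *)
Definition rep_sum (S : (G -> A) -> (G -> A)) n (p : 'I_n -> (G -> A) * H) : H :=
  \sum_(i < n) T (q (S (p i).1)) (p i).2.

(** Non-degeneracy gives density of the span of the vectors [T b x]; each [b]
is replaced by some [q f] and scalars are moved into the vectors. *)
Lemma rep_sum_dense x (e : R) : 0 < e ->
  exists n (p : 'I_n -> (G -> A) * H),
    (forall i, Cc (p i).1) /\ rnorm (rep_sum id p - x) < e.
Proof.
move=> e0; have e2 : 0 < e / 2 by rewrite divr_gt0.
have [y [n [c [v [vS ->]]]] xy] := (dense_rnormP _).1 ndT x _ e2.
have /choice[w vE] : forall i, exists w : B * H, v i = T w.1 w.2.
  by move=> i; have [a [z ->]] := vS i; exists (a, z).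
pose C := \sum_(i < n) rnorm (c i *: (w i).2).
have C0 : 0 <= C by apply: sumr_ge0 => i _; exact: rnorm_ge0.
have C1 : 0 < C + 1 by rewrite ltr_wpDl.
have /choice[f fP] : forall i, exists f, Cc f /\ rnorm (q f - (w i).1) < e / 2 / (C + 1).
  by move=> i; have [f cf fw] := q_dense (w i).1 (divr_gt0 e2 C1); exists f.
exists n, (fun i => (f i, c i *: (w i).2)); split=> [i|]; first by case: (fP i).
apply: le_lt_trans (rnorm_triangle (\sum_(i < n) c i *: v i) _ _) _.
rewrite [ltRHS]splitr; apply: ler_ltD => //.
rewrite /rep_sum -sumrB; apply: le_trans (rnorm_sum _ _ _) _.
apply: le_trans (_ : \sum_(i < n) (e / 2 / (C + 1)) * rnorm (c i *: (w i).2) <= _).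
  apply: ler_sum => i _; rewrite /= vE -(linZ (rep_linear _)) -(repB repT).
  by apply: le_trans (rep_le _ _) _; rewrite ler_wpM2r ?rnorm_ge0// ltW//; case: (fP i).
rewrite -mulr_sumr -/C -mulrA -[leRHS]mulr1; apply: ler_wpM2l; first exact: ltW.
by rewrite mulrC ler_pdivrMr// mul1r lerDl.
Qed.

Lemma rep_dense_eq (X : normedModType R[i]) (F F' : H -> X) (M M' : R) :
  linear F -> linear F' ->
  (forall x, rnorm (F x) <= M * rnorm x) -> (forall x, rnorm (F' x) <= M' * rnorm x) ->
  (forall f x, Cc f -> F (T (q f) x) = F' (T (q f) x)) -> forall x, F x = F' x.
Proof.
move=> lF lF' FM FM' FF' x; apply: (@rnorm_le_eqM _ _ _ _ (`|M| + `|M'|)) => e e0.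
have [n [p [cp px]]] := rep_sum_dense x e0.
have small N : N * rnorm (rep_sum id p - x) <= `|N| * e.
  apply: le_trans (_ : `|N| * rnorm (rep_sum id p - x) <= _).
    by rewrite ler_wpM2r ?rnorm_ge0// ler_norm.
  by rewrite ler_wpM2l// ltW.
apply: le_trans (rnorm_triangle (F (rep_sum id p)) _ _) _; rewrite mulrDl; apply: lerD.
  by rewrite rnorm_distC; apply: le_trans (rep_dist_op _ _ lF FM) (small _).
have -> : F (rep_sum id p) = F' (rep_sum id p).
  by rewrite /rep_sum (lin_sum lF) (lin_sum lF'); apply: eq_bigr => i _; exact: FF'.
by apply: le_trans (rep_dist_op _ _ lF' FM') (small _).
Qed.

(** [S] is an operation on functions, such as a product with an element of [A]
or a translation, and [L] the operator by which it acts. *)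
Definition multiplier_of S (L : H -> H) : Prop :=
  forall f x, Cc f -> L (T (q f) x) = T (q (S f)) x.

Lemma multiplier_sum S L n (p : 'I_n -> (G -> A) * H) : linear L -> multiplier_of S L ->
  (forall i, Cc (p i).1) -> L (rep_sum id p) = rep_sum S p.
Proof.
by move=> lL LS cp; rewrite /rep_sum (lin_sum lL); apply: eq_bigr => i _; rewrite LS.
Qed.

Lemma rep_sum_dist (S S' : (G -> A) -> (G -> A)) n (p : 'I_n -> (G -> A) * H) (d : R) :
  (forall i, rnorm (q (S (p i).1) - q (S' (p i).1)) <= d) ->
  rnorm (rep_sum S p - rep_sum S' p) <= d * \sum_(i < n) rnorm (p i).2.
Proof.
move=> Sd; rewrite /rep_sum -sumrB mulr_sumr; apply: le_trans (rnorm_sum _ _ _) _.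
apply: ler_sum => i _; rewrite -(repB repT).
by apply: le_trans (rep_le _ _) _; rewrite ler_wpM2r ?rnorm_ge0.
Qed.

(** The relation sending [rep_sum id p] to [rep_sum S p] is bounded by [c]:
with [h] an approximate left unit for the functions in [p], the vector
[rep_sum S p] is close to [T (q (S h))] applied to [rep_sum id p], and [|q (S
h)| <= c (1 + e)]. *)
Lemma multiplier_ex (S : (G -> A) -> (G -> A)) (c : R) : 0 <= c ->
  (forall f, Cc f -> Cc (S f)) ->
  (forall h f, Cc h -> Cc f -> q (conv (S h) f) = q (S (conv h f))) ->
  (forall f g, Cc f -> Cc g -> rnorm (q (S f) - q (S g)) <= c * rnorm (q f - q g)) ->
  (forall f, Cc f -> rnorm (q (S f)) <= c * rnorm (q f)) ->
  exists L, [/\ linear L, forall x, rnorm (L x) <= c * rnorm x & multiplier_of S L].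
Proof.
move=> c0 cS Sconv Sdist Sle.
pose P v w := exists n (p : 'I_n -> (G -> A) * H),
  [/\ forall i, Cc (p i).1, v = rep_sum id p & w = rep_sum S p].
have [|k v w v' w' [n [p [cp -> ->]]] [m [p' [cp' -> ->]]]
    |v w [n [p [cp vE wE]]]|x e e0|L [lL Lc LP]] :=
    @graph_extension R H H P c.
- exact: c0.
(* The concatenation of [p], with its vectors scaled by [k], and [p']. *)
- pose p2 (i : 'I_(n + m)%N) := match fintype.split i with
    inl j => ((p j).1, k *: (p j).2) | inr j => p' j end.
  have p2E S' : rep_sum S' p2 = k *: rep_sum S' p + rep_sum S' p'.
    rewrite /rep_sum big_split_ord scaler_sumr; congr (_ + _); apply: eq_bigr => i _.
      by rewrite /p2 (unsplitK (inl i)) (linZ (rep_linear _)).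
    by rewrite /p2 (unsplitK (inr i)).
  exists (n + m)%N, p2; split; rewrite ?p2E// => i.
  by rewrite /p2; case: (fintype.split i).
- apply: (@ler_addgt0M _ _ _ (c * rnorm v + c * \sum_(i < n) rnorm (p i).2)) => e e0.
  have [h [ch h1 hf]] := q_left_approx cp e0 e0.
  have chf i : Cc (conv h (p i).1) by exact: (Cc_conv halpha hmu).
  have hv : T (q (S h)) v = rep_sum (fun f => S (conv h f)) p.
    rewrite vE /rep_sum (lin_sum (rep_linear _)); apply: eq_bigr => i _.
    by rewrite -(repM repT) -q_conv ?Sconv//; exact: cS.
  have d : rnorm (w - T (q (S h)) v) <= (c * e) * \sum_(i < n) rnorm (p i).2.
    rewrite hv wE; apply: rep_sum_dist => i.
    apply: le_trans (Sdist _ _ (cp i) (chf i)) _.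
    by rewrite ler_wpM2l// rnorm_distC.
  have b : rnorm (T (q (S h)) v) <= c * (1 + e) * rnorm v.
    apply: le_trans (rep_le _ _) _; rewrite ler_wpM2r ?rnorm_ge0//.
    by apply: le_trans (Sle _ ch) _; rewrite ler_wpM2l.
  have t : rnorm w <= rnorm (w - T (q (S h)) v) + rnorm (T (q (S h)) v).
    by apply: le_trans (rnormD _ _); rewrite subrK.
  apply: (le_trans t); apply: le_trans (lerD d b) _.
  by rewrite le_eqVlt; apply/orP; left; apply/eqP; ring.
- have [n [p [cp px]]] := rep_sum_dense x e0.
  by exists (rep_sum id p), (rep_sum S p); split=> //; exists n, p.
exists L; split=> // f x cf; apply: LP; exists 1%N, (fun=> (f, x)).
by split=> //; rewrite /rep_sum big_ord1.
Qed.

(** The relation in [B] is the adjoint relation for vectors [T (q f) x]; it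
extends by density, first in one argument and then in the other. *)
Lemma multiplier_adjoint S S' L L' (c c' : R) :
  linear L -> linear L' -> (forall x, rnorm (L x) <= c * rnorm x) ->
  (forall x, rnorm (L' x) <= c' * rnorm x) -> multiplier_of S L -> multiplier_of S' L' ->
  (forall f g, Cc f -> Cc g -> bmul (bstar (q (S f))) (q g) = bmul (bstar (q f)) (q (S' g))) ->
  forall x y, inner (L x) y = inner x (L' y).
Proof.
move=> lL lL' Lc Lc' LS LS' SS' x y.
have half g v u : Cc g -> inner (L u) (T (q g) v) = inner u (L' (T (q g) v)).
  move=> cg; apply: (@rep_dense_eq (cscalar R) (fun u => inner (L u) (T (q g) v))
    (fun u => inner u (L' (T (q g) v))) (c * rnorm (T (q g) v)) (rnorm (L' (T (q g) v)))).
  - by move=> k w z; rewrite lL innerDl innerZl.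
  - by move=> k w z; rewrite innerDl innerZl.
  - move=> w; apply: le_trans (cauchy_schwarz _ _) _.
    by rewrite mulrAC ler_wpM2r ?rnorm_ge0.
  - by move=> w; apply: le_trans (cauchy_schwarz _ _) _; rewrite mulrC.
  - by move=> f w cf; rewrite LS// LS'// !invT -!(repM repT) SS'.
rewrite innerC [RHS]innerC; congr (Num.conj _).
apply: (@rep_dense_eq (cscalar R) (fun y => inner y (L x)) (fun y => inner (L' y) x)
  (rnorm (L x)) (c' * rnorm x)).
- by move=> k w z; rewrite innerDl innerZl.
- by move=> k w z; rewrite lL' innerDl innerZl.
- by move=> w; apply: le_trans (cauchy_schwarz _ _) _; rewrite mulrC.
- move=> w; apply: le_trans (cauchy_schwarz _ _) _.
  by rewrite mulrAC ler_wpM2r ?rnorm_ge0.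
- by move=> g v cg; rewrite innerC [RHS]innerC half.
Qed.

(** A multiplier whose action on finitely many functions is close to the
identity moves [x] only a little. This yields both the strong continuity of
[U] and the non-degeneracy of [pi]. *)
Lemma multiplier_near1 x (e c : R) : 0 < e -> 0 <= c ->
  exists n (f : 'I_n -> G -> A) (d : R), [/\ forall i, Cc (f i), 0 < d &
    forall S L, linear L -> (forall x, rnorm (L x) <= c * rnorm x) -> multiplier_of S L ->
      (forall i, rnorm (q (S (f i)) - q (f i)) <= d) -> rnorm (L x - x) < e].
Proof.
move=> e0 c0; have c1 : 0 < c + 1 by rewrite ltr_wpDl.
have e2 : 0 < e / 2 by rewrite divr_gt0.
have [n [p [cp px]]] := rep_sum_dense x (divr_gt0 e2 c1).
set v := rep_sum id p in px.
pose C := \sum_(i < n) rnorm (p i).2.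
have C0 : 0 <= C by apply: sumr_ge0 => i _; exact: rnorm_ge0.
have C1 : 0 < C + 1 by rewrite ltr_wpDl.
exists n, (fun i => (p i).1), (e / 2 / (C + 1)); split=> //; first by rewrite divr_gt0.
move=> S L lL Lc LS Sd.
have h1 : rnorm (L v - v) <= e / 2.
  rewrite /v (multiplier_sum lL LS cp); apply: le_trans (rep_sum_dist Sd) _.
  rewrite -/C -mulrA -[leRHS]mulr1; apply: ler_wpM2l; first exact: ltW.
  by rewrite mulrC ler_pdivrMr// mul1r lerDl.
have h2 : rnorm (L x - L v) <= c * rnorm (v - x).
  by rewrite (rnorm_distC v); exact: rep_dist_op.
have h3 : (c + 1) * rnorm (v - x) < e / 2 by rewrite mulrC -ltr_pdivlMr.
have h4 := rnorm_triangle (L v) (L x) x; have h5 := rnorm_triangle v (L v) x.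
rewrite mulrDl mul1r in h3; rewrite [ltRHS]splitr.
apply: (le_lt_trans h4); apply: le_lt_trans (lerD h2 h5) _.
by rewrite addrA addrAC; apply: ltr_leD.
Qed.

Lemma multipliers_ex : exists (pi : A -> H -> H) (U : G -> H -> H),
  (forall a, [/\ linear (pi a), forall x, rnorm (pi a x) <= rnorm a * rnorm x &
     multiplier_of (lmul a) (pi a)]) /\
  (forall r, [/\ linear (U r), forall x, rnorm (U r x) <= 1 * rnorm x &
     multiplier_of (translate alpha r) (U r)]).
Proof.
have /choice[pi piP] : forall a, exists L, [/\ linear L,
    forall x, rnorm (L x) <= rnorm a * rnorm x & multiplier_of (lmul a) L].
  move=> a; apply: multiplier_ex.
  - exact: rnorm_ge0.
  - by move=> f; exact: (Cc_lmul halpha).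
  - exact: q_lmul_conv.
  - exact: q_lmul_dist.
  - exact: q_lmul_le.
have /choice[U UP] : forall r, exists L, [/\ linear L,
    forall x, rnorm (L x) <= 1 * rnorm x & multiplier_of (translate alpha r) L].
  move=> r; apply: multiplier_ex.
  - exact: ler01.
  - by move=> f; exact: (Cc_translate halpha).
  - exact: q_translate_conv.
  - by move=> f g; rewrite mul1r; exact: q_translate_dist.
  - by move=> f; rewrite mul1r; exact: q_translate_le.
by exists pi, U.
Qed.

Section Multipliers.
Variables (pi : A -> H -> H) (U : G -> H -> H).
Hypothesis piP : forall a, [/\ linear (pi a),
  forall x, rnorm (pi a x) <= rnorm a * rnorm x & multiplier_of (lmul a) (pi a)].
Hypothesis UP : forall r, [/\ linear (U r),
  forall x, rnorm (U r x) <= 1 * rnorm x & multiplier_of (translate alpha r) (U r)].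

Let piL a : linear (pi a). Proof. by case: (piP a). Qed.
Let piB a x : rnorm (pi a x) <= rnorm a * rnorm x.
Proof. by case: (piP a) => _ + _; exact. Qed.
Let piq a : multiplier_of (lmul a) (pi a). Proof. by case: (piP a). Qed.
Let UL r : linear (U r). Proof. by case: (UP r). Qed.
Let UB r x : rnorm (U r x) <= 1 * rnorm x.
Proof. by case: (UP r) => _ + _; exact. Qed.
Let Uq r : multiplier_of (translate alpha r) (U r). Proof. by case: (UP r). Qed.
Let cl a f : Cc f -> Cc (lmul a f). Proof. exact: (Cc_lmul halpha). Qed.
Let ct r f : Cc f -> Cc (translate alpha r f). Proof. exact: (Cc_translate halpha). Qed.

Let lin_comp (L L' : H -> H) : linear L -> linear L' -> linear (L \o L').
Proof. by move=> lL lL' k x y /=; rewrite lL' lL. Qed.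

Let bnd_comp (L L' : H -> H) (c c' : R) : 0 <= c -> (forall x, rnorm (L x) <= c * rnorm x) ->
  (forall x, rnorm (L' x) <= c' * rnorm x) ->
  forall x, rnorm ((L \o L') x) <= (c * c') * rnorm x.
Proof.
by move=> c0 Lc Lc' x; apply: le_trans (Lc _) _; rewrite -mulrA ler_wpM2l.
Qed.

Lemma multiplier_algebra_rep : algebra_rep pi.
Proof.
split=> [a|c a b|a b].
- by split; [exact: piL|exists (rnorm a); exact: piB].
- apply: (@rep_dense_eq H (pi (c *: a + b)) (fun x => c *: pi a x + pi b x)
    (rnorm (c *: a + b)) (complex.Re `|c| * rnorm a + rnorm b)).
  + exact: piL.
  + by move=> k x y; rewrite !(piL _ k) !scalerDr !scalerA [c * k]mulrC addrACA.
  + exact: piB.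
  + move=> x; apply: le_trans (rnormD _ _) _; rewrite rnormZ mulrDl -mulrA.
    apply: lerD; last exact: piB.
    apply: ler_wpM2l; last exact: piB.
    by rewrite -ler0c RRe_real ?normr_real.
  + by move=> f x cf; rewrite !piq// q_lmul_lin// (repD repT) (repZ repT).
- apply: (@rep_dense_eq H (pi (bmul a b)) (pi a \o pi b) (rnorm (bmul a b))
    (rnorm a * rnorm b)).
  + exact: piL.
  + exact: lin_comp.
  + exact: piB.
  + by apply: bnd_comp => [|x|x]; [exact: rnorm_ge0|exact: piB|exact: piB].
  + by move=> f x cf /=; rewrite !piq ?lmulM//; exact: cl.
Qed.

Lemma multiplier_U1 x : U 1%g x = x.
Proof.
apply: (@rep_dense_eq H (U 1%g) id 1 1) => // [y|f y cf]; first by rewrite mul1r.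
by rewrite Uq// translate1.
Qed.

Lemma multiplier_UM r s x : U (r * s)%g x = U r (U s x).
Proof.
apply: (@rep_dense_eq H (U (r * s)%g) (U r \o U s) 1 (1 * 1)) => //.
- exact: lin_comp.
- exact: bnd_comp ler01 _ _.
- by move=> f y cf /=; rewrite !Uq ?translateM//; exact: ct.
Qed.

Let UVK r x : U r^-1%g (U r x) = x. Proof. by rewrite -multiplier_UM mulVg multiplier_U1. Qed.
Let UKV r x : U r (U r^-1%g x) = x. Proof. by rewrite -multiplier_UM mulgV multiplier_U1. Qed.

Lemma multiplier_group_rep : group_rep U.
Proof.
have bU r : bounded_op (U r) by split=> //; exists 1; exact: UB.
split=> [r|]; last exact: multiplier_UM.
split=> //; exists (U r^-1%g).
by split; [exact: bU|exact: UVK|exact: UKV].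
Qed.

(** In terms of functions: [s . (a (s^-1 . f)) = (alpha s a) f]. *)
Lemma multiplier_covariance a s x : pi (alpha s a) x = U s (pi a (U s^-1%g x)).
Proof.
apply: (@rep_dense_eq H (pi (alpha s a)) (U s \o (pi a \o U s^-1%g))
  (rnorm (alpha s a)) (1 * (rnorm a * 1))) => //.
- by apply: lin_comp => //; exact: lin_comp.
- by apply: bnd_comp => //; exact: bnd_comp (rnorm_ge0 _) _ _.
- move=> f y cf /=; rewrite !piq ?Uq//; [|by auto..].
  rewrite piq; last exact: ct.
  by rewrite Uq; [rewrite translate_lmul -translateM mulgV translate1|exact/cl/ct].
Qed.

Lemma multiplier_star a x y : inner (pi a x) y = inner x (pi (bstar a) y).
Proof.
apply: (multiplier_adjoint (piL a) (piL _) (piB a) (piB _) (@piq a) (@piq _)).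
by move=> f g; exact: q_lmul_adjoint.
Qed.

Lemma multiplier_U_adj r x y : inner (U r x) y = inner x (U r^-1%g y).
Proof.
apply: (multiplier_adjoint (UL r) (UL _) (UB r) (UB _) (@Uq r) (@Uq _)).
by move=> f g; exact: q_translate_adjoint.
Qed.

Lemma multiplier_unitary r : unitary_op (U r).
Proof.
split; last by move=> x y; rewrite multiplier_U_adj UVK.
by apply/seteqP; split=> // x _; exists (U r^-1%g x) => //; exact: UKV.
Qed.

Lemma multiplier_strongly_continuous : strongly_continuous U.
Proof.
move=> x r; apply/cts_rnormP => e e0.
have [n [f [d [cf d0 near]]]] := multiplier_near1 x e0 ler01.
have V1 : \forall s \near (1%g : G), forall i,
    rnorm (q (translate alpha s (f i)) - q (f i)) <= d.
  by apply: filter_forall => i; exact: q_translate_near1.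
have cm : continuous (fun s : G => (r^-1 * s)%g) by exact: continuous_lmulg.
have h1 : nbhs (r^-1 * r)%g [set t | forall i,
    rnorm (q (translate alpha t (f i)) - q (f i)) <= d] by rewrite mulVg.
have : \forall s \near r, forall i,
    rnorm (q (translate alpha (r^-1 * s)%g (f i)) - q (f i)) <= d.
  exact: (cm r _ h1).
apply: filterS => s sf.
have -> : s = (r * (r^-1 * s))%g by rewrite mulVKg.
rewrite multiplier_UM -(linB (UL r)); apply: le_lt_trans (UB _ _) _; rewrite mul1r.
by apply: near sf.
Qed.

Lemma multiplier_nondegenerate : Defs.nondegenerate pi.
Proof.
apply/dense_rnormP => x e e0.
have [I [F [u [FF u2 ua]]]] := left_approx_id_filter (hA ltr01).
have [n [f [d [cf d0 near]]]] := multiplier_near1 x e0 (addr_ge0 ler01 ler01).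
have [i fi] : exists i, forall j, rnorm (q (lmul (u i) (f j)) - q (f j)) <= d.
  by apply: (@filter_ex _ F FF); apply: filter_forall => j; exact: (q_lmul_near _ u2 ua).
exists (pi (u i) x).
  exists 1%N, (fun=> 1), (fun=> pi (u i) x).
  by split; [move=> _; exists (u i), x|rewrite big_ord1 scale1r].
apply: near fi; [exact: piL| |exact: piq].
by move=> y; apply: le_trans (piB _ _) _; rewrite ler_wpM2r ?rnorm_ge0 ?u2.
Qed.

Hypothesis HHH : HH H.

Lemma multiplier_cov : cov pi U.
Proof.
have pic : contractive_rep pi by move=> a; apply: opnorm_le; [exact: rnorm_ge0|exact: piB].
split=> //.
- split; last exact: multiplier_strongly_continuous.
    by split; [exact: multiplier_algebra_rep|exact: multiplier_group_rep|
      exact: multiplier_covariance].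
  by exists 1 => a; rewrite mul1r.
- exact: multiplier_nondegenerate.
- by split=> //; exact: multiplier_star.
- exact: multiplier_unitary.
Qed.

(** On a vector [T (q g) y] the left side is [T (q f * q g) y]. The product is
a [B]-valued integral, and [b |-> T b y] passes through it, giving [pi (f s)
(U s (T (q g) y))] as integrand. *)
Lemma multiplier_integrated f x : Cc f -> T (q f) x = IF pi U f x.
Proof.
move=> cf; have hp := multiplier_cov; have [_ [M IFM]] := IF_op hp cf.
apply: (@rep_dense_eq H (T (q f)) (IF pi U f) (rnorm (q f)) M) => //.
- exact: rep_linear.
- exact: (IF_linear halpha hmu hp).
- exact: rep_le.
move=> g y cg; rewrite -(repM repT) -(conv_family_integral cf cg).
rewrite (integral_op hG muK (L := T^~ y) (M := rnorm y) _ _ _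
  (supported_conv_family cf cg)).
- congr integral; apply/funext => s /=.
  by rewrite Uq// piq//; exact: ct.
- by move=> b b'; exact: (repD repT).
- by move=> r b; exact: (repZ repT).
- by move=> b; rewrite mulrC; exact: rep_le.
Qed.

Lemma multiplier_crossed_rep : crossed pi U = T.
Proof.
apply: crossed_repE multiplier_cov _; split=> //.
- by exists 1 => b; rewrite mul1r; apply: opnorm_le => [|x]; [exact: rnorm_ge0|exact: rep_le].
- by move=> f cf; apply/funext => x; exact: multiplier_integrated.
Qed.

End Multipliers.
End Backward.

Lemma crossed_rep_surj (H : hilbertType R) (T : B -> H -> H) : HH H ->
  algebra_rep T -> Defs.nondegenerate T -> involutive_rep T ->
  exists pi U, cov pi U /\ crossed pi U = T.
Proof.
move=> HHH repT ndT invT; have [pi [U [piP UP]]] := multipliers_ex repT ndT invT.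
exists pi, U; split; first exact: multiplier_cov piP UP HHH.
exact: multiplier_crossed_rep piP UP HHH.
Qed.

End CrossedProduct.

Local Close Scope complex_scope.

Theorem theorem9p3 (R : realType) (A : banachStarAlgType R) (G : topGroupType)
  (alpha : G -> A -> A) (mu : {measure set (borel G) -> \bar R})
  (Delta : G -> R) (HH : hilbertType R -> Prop)
  (halpha : dynamical_system alpha)
  (halpha_star : forall s a, alpha s (bstar a) = bstar (alpha s a))
  (hA : forall eps : R, 0 < eps -> bounded_left_approx_id A (1 + eps))
  (hmu : left_haar_measure mu)
  (hDelta : modular_function mu Delta)
  (hR : exists p, covariant_class alpha HH p)
  (B : cstarAlgType R) (q : (G -> A) -> B)
  (hB : is_crossed_product alpha mu Delta (covariant_class alpha HH) q) :
  [/\ class_bij (covariant_class alpha HH) (involutive_rep_class HH B)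
        (crossed_rep_map mu q),
      forall p : covpair A G, covariant_class alpha HH p ->
        invariant_subspaces_cov p =
        invariant_subspaces_rep (crossed_rep_map mu q p)
    & forall p p' : covpair A G,
        covariant_class alpha HH p -> covariant_class alpha HH p' ->
        intertwiners_cov p p' =
        intertwiners_rep (crossed_rep_map mu q p) (crossed_rep_map mu q p')].
Proof.
split.
- split.
  + move=> [H [pi U]] hp /=; split.
    * by case: hp.
    * exact: (crossed_rep_rep halpha hmu hB hp).
    * exact: (crossed_rep_nondegenerate halpha hA hmu hB hp).
    * exact: (crossed_rep_involutive halpha hmu hDelta hB hp).
  + move=> [H [pi U]] [H' [pi' U']] hp hp' TT'.
    have HH' : H = H' := congr1 (@projT1 _ _) TT'.
    case: H' / HH' => /= in pi' U' hp' TT' *.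
    have TT2 : crossed_rep mu q pi U = crossed_rep mu q pi' U' := existT_inj TT'.
    by have [-> ->] := crossed_rep_inj halpha hA hmu hB hp hp' TT2.
  + move=> [H T] [HHH repT ndT invT].
    have [pi [U [hp <-]]] :=
      crossed_rep_surj halpha hA hmu hDelta hR hB HHH repT ndT invT.
    by exists (existT _ H (pi, U)).
- move=> [H [pi U]] hp; apply/seteqP; split=> M /=.
  + move=> [cM Mpi MU]; split=> //.
    exact: (invariant_subspaces_eq halpha hA hmu hB hp cM).1.
  + move=> [cM MT]; have [Mpi MU] := (invariant_subspaces_eq halpha hA hmu hB hp cM).2 MT.
    by split.
- move=> [H [pi U]] [H' [pi' U']] hp hp'; apply/seteqP; split=> F /=.
  + move=> [bF Fpi FU]; split=> //.
    exact: (intertwiners_eq halpha hA hmu hB hp hp' bF).1.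
  + move=> [bF FT].
    by have [Fpi FU] := (intertwiners_eq halpha hA hmu hB hp hp' bF).2 FT.
Qed.
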